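(* Let $Y$ be any of the spaces $\mathcal{LM}$, $\mathcal L L^1$, $\mathcal{LM}_d$, $\mathcal{LM}_s$, $\mathcal R_0$, $\mathcal J_0$. Then the closure of $Y$ in $\mathcal B$ with respect to the $\mathcal B$-norm coincides with the closure of $Y$ in $\mathcal B$ with respect to the sup norm $\|\cdot\|_\infty$. Moreover, if $Y$ is any of $\mathcal LL^1$, $\mathcal R_0$, $\mathcal J_0$, then the closure of $Y$ in $\mathcal B$ (for the $\mathcal B$-norm) is $\mathcal B\cap C_0(\overline{\mathbb C}_+)$.
   Context: $\mathbb C_+=\{z:\Re z>0\}$. $\mathcal B$ is the space of holomorphic $f$ on $\mathbb C_+$ with $\|f\|_{\mathcal B_0}:=\int_0^\infty\sup_{\beta\in\mathbb R}|f'(\alpha+i\beta)|\,d\alpha<\infty$; such $f$ are bounded and extend continuously to $\overline{\mathbb C}_+$; norm $\|f\|_{\mathcal B}=\|f\|_\infty+\|f\|_{\mathcal B_0}$. For a set $\mathcal N$ of bounded Borel measures on $\mathbb R_+=[0,\infty)$, $\mathcal{LN}=\{\mathcal L\mu:\mu\in\mathcal N\}$ with $\mathcal L\mu(z)=\int e^{-zt}d\mu(t)$; $M=M(\mathbb R_+)$ is all bounded Borel measures, $L^1$ the absolutely continuous ones, $M_d$ the discrete ones, $M_s$ the singular non-atomic ones. It is known that $\mathcal{LM}\subset\mathcal B$. $\mathcal R_0$ is the space of rational functions vanishing at infinity with no poles in $\overline{\mathbb C}_+$; $\mathcal J_0$ is the space of entire functions of exponential type belonging to $H^\infty(\mathbb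 C_+)\cap C_0(\overline{\mathbb C}_+)$. $C_0(\overline{\mathbb C}_+)$ denotes continuous functions on $\overline{\mathbb C}_+$ tending to $0$ as $|z|\to\infty$. *)

(* Defs.v *)
From HB Require Import structures.
From mathcomp Require Import all_boot all_order all_algebra.
From mathcomp Require Import all_classical all_reals all_analysis.
From mathcomp Require Export complex.
Import Order.TTheory GRing.Theory Num.Theory.
Import numFieldNormedType.Exports.

Set Implicit Arguments.
Unset Strict Implicit.
Unset Printing Implicit Defensive.

Local Open Scope ring_scope.
Local Open Scope classical_set_scope.

Section Defs.
Variable R : realType.

Notation Cn := ((R[i] : numFieldType)^o).

Definition cabs (z : R[i]) : R := ComplexField.Normc.normc z.

Definition Cplus : set R[i] := [set z | 0 < complex.Re z].

Definition holo (f : R[i] -> R[i]) : Prop :=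
  forall z : R[i], 0 < complex.Re z -> derivable (f : Cn -> Cn) (z : Cn) 1.

Definition Rpos : set R := `]0, +oo[%classic.

Definition B0norm (f : R[i] -> R[i]) : \bar R :=
  (\int[@lebesgue_measure R]_(a in Rpos)
     ereal_sup [set (cabs ('D_1 (f : Cn -> Cn) ((a +i* b)%C : Cn)))%:E
               | b in [set: R]])%E.

Definition supn (f : R[i] -> R[i]) : \bar R :=
  ereal_sup [set (cabs (f z))%:E | z in Cplus].

Definition Bnorm (f : R[i] -> R[i]) : \bar R := (supn f + B0norm f)%E.

Definition Bspace : set (R[i] -> R[i]) :=
  [set f | holo f /\ (B0norm f < +oo)%E].

Definition closB (Y : set (R[i] -> R[i])) : set (R[i] -> R[i]) :=
  [set f | Bspace f /\ forall e : R, 0 < e ->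
     exists2 g, Y g & (Bnorm (fun z => (f z - g z)%R) < e%:E)%E].

Definition closInf (Y : set (R[i] -> R[i])) : set (R[i] -> R[i]) :=
  [set f | Bspace f /\ forall e : R, 0 < e ->
     exists2 g, Y g & (supn (fun z => (f z - g z)%R) < e%:E)%E].

Definition C0cl (f : R[i] -> R[i]) : Prop :=
  exists F : R[i] -> R[i],
    [/\ {within [set z : Cn | 0 <= complex.Re (z : R[i])], continuous (F : Cn -> Cn)},
        (forall z, 0 < complex.Re z -> F z = f z) &
        (forall e : R, 0 < e -> exists M : R, forall z : R[i],
             0 <= complex.Re z -> M < cabs z -> cabs (F z) < e)].

(* bounded complex Borel measures on R_+ : mu = (m1 - m2) + i (m3 - m4)
   with m_k finite positive Borel measures on R carried by [0, +oo) *)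
Record cmeas := CMeas {
  cm1 : {finite_measure set R -> \bar R};
  cm2 : {finite_measure set R -> \bar R};
  cm3 : {finite_measure set R -> \bar R};
  cm4 : {finite_measure set R -> \bar R} }.

Definition cm_on_Rplus (mu : cmeas) : Prop :=
  [/\ cm1 mu `]-oo, 0[ = 0%E, cm2 mu `]-oo, 0[ = 0%E,
      cm3 mu `]-oo, 0[ = 0%E & cm4 mu `]-oo, 0[ = 0%E].

Definition cmval (mu : cmeas) (A : set R) : R[i] :=
  ((fine (cm1 mu A) - fine (cm2 mu A)) +i* (fine (cm3 mu A) - fine (cm4 mu A)))%C.

(* int e^{-zt} dnu(t) for a finite positive measure nu *)
Definition lapR (nu : {finite_measure set R -> \bar R}) (z : R[i]) : R[i] :=
  ((Rintegral nu `[0, +oo[ (fun t => expR (- ((complex.Re z : R) * (t : R))) * cos ((complex.Im z : R) * (t : R))))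
   +i* (- Rintegral nu `[0, +oo[ (fun t => expR (- ((complex.Re z : R) * (t : R))) * sin ((complex.Im z : R) * (t : R)))))%C.

Definition lap (mu : cmeas) (z : R[i]) : R[i] :=
  (lapR (cm1 mu) z - lapR (cm2 mu) z) + 'i%C * (lapR (cm3 mu) z - lapR (cm4 mu) z).

Definition LN (P : cmeas -> Prop) : set (R[i] -> R[i]) :=
  [set f | exists mu, [/\ cm_on_Rplus mu, P mu & f = lap mu]].

Definition Mall : cmeas -> Prop := fun _ => True.

Definition Mac (mu : cmeas) : Prop :=
  forall A : set R, measurable A -> @lebesgue_measure R A = 0%E -> cmval mu A = 0.

Definition Mdisc (mu : cmeas) : Prop :=
  exists S : set R, countable S /\
    forall A : set R, measurable A -> A `&` S = set0 -> cmval mu A = 0.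

Definition Msing (mu : cmeas) : Prop :=
  (forall t : R, cmval mu [set t] = 0) /\
  exists N : set R, [/\ measurable N, @lebesgue_measure R N = 0%E &
    forall A : set R, measurable A -> A `&` N = set0 -> cmval mu A = 0].

Definition LM := LN Mall.
Definition LL1 := LN Mac.
Definition LMd := LN Mdisc.
Definition LMs := LN Msing.

Definition R0 : set (R[i] -> R[i]) :=
  [set f | exists p q : {poly R[i]},
     [/\ (size p < size q)%N, (forall z, root q z -> complex.Re z < 0) &
         f = (fun z => p.[z] / q.[z])]].

Definition J0 : set (R[i] -> R[i]) :=
  [set f | [/\ forall z : R[i], derivable (f : Cn -> Cn) (z : Cn) 1,
     exists A B : R, forall z, cabs (f z) <= A * expR (B * cabs z),
     (supn f < +oo)%E & C0cl f]].

End Defs.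

Arguments LM R : clear implicits.
Arguments LL1 R : clear implicits.
Arguments LMd R : clear implicits.
Arguments LMs R : clear implicits.
Arguments R0 R : clear implicits.
Arguments J0 R : clear implicits.

(* Main.v *)
(* Let f in B be uniformly within e0 of g in Y.  The function
   h(z) = g(z + eps) - g(z + N) + g(+oo) is again in Y: on transforms of measures it
   multiplies the measure by the weight e^{-eps t} - e^{-N t} and restores the mass at 0,
   which preserves each of the four classes.  Cauchy estimates bound the derivative of
   f - g on the line Re z = a by C e0 / a, and f'(z) - f'(z + eps) by C eps / a^2; with
   the integrability of sup_b |f'(a + ib)| near 0 and near infinity they make ||f - h||_B
   small (choose N, then eps, then e0).  Hence the two closures agree.

   For the second part, the Cayley transform and the Taylor expansion show that every f in
   B with a C_0 extension is a uniform limit of combinations of 1/(z + l), l > 0, and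
   1/(z + l) is a uniform limit of elements of Y.  Conversely elements of L(L^1) are C_0
   because densities are L^1-limits of continuous functions on segments [0, T], and the
   transforms of those are uniform limits of combinations of (1 - e^{-Tz}) / z. *)
Require Import Defs.
From HB Require Import structures.
From mathcomp Require Import all_boot all_order all_algebra.
From mathcomp Require Import all_classical all_reals all_analysis measurable_realfun.
From mathcomp Require Import complex.
From mathcomp Require Import ring lra.
Import Order.TTheory GRing.Theory Num.Theory.
Import numFieldNormedType.Exports.
Set Implicit Arguments. Unset Strict Implicit. Unset Printing Implicit Defensive.
Local Open Scope ring_scope.
Local Open Scope classical_set_scope.

Local Notation Cn R := ((R[i] : numFieldType)^o).
Local Notation is_cderive z f l :=
  (is_derive (z : Cn _) (1 : Cn _) (f : Cn _ -> Cn _) (l : Cn _)).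

Section Modulus.
Variable R : realType.
Implicit Types (x y : R) (z w : R[i]).

Lemma cabsE x y : cabs (x +i* y)%C = Num.sqrt (x ^+ 2 + y ^+ 2).
Proof. by []. Qed.

Lemma normr_cabsE z : `|z| = ((cabs z)%:C)%C.
Proof. by []. Qed.

Lemma cabs_ge0 z : 0 <= cabs z.
Proof. by case: z => x y; rewrite cabsE sqrtr_ge0. Qed.

Lemma cabs0 : cabs (0 : R[i]) = 0.
Proof. exact: ComplexField.Normc.normc0. Qed.

Lemma cabs1 : cabs (1 : R[i]) = 1.
Proof. exact: ComplexField.Normc.normc1. Qed.

Lemma cabsM z w : cabs (z * w) = cabs z * cabs w.
Proof. exact: ComplexField.Normc.normcM. Qed.

Lemma cabsV z : cabs z^-1 = (cabs z)^-1.
Proof. exact: ComplexField.Normc.normcV. Qed.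

Lemma cabsX z n : cabs (z ^+ n) = cabs z ^+ n.
Proof. by elim: n => [|n IH]; rewrite ?expr0 ?cabs1 // !exprS cabsM IH. Qed.

Lemma cabsN z : cabs (- z) = cabs z.
Proof. exact: normcN. Qed.

Lemma le_cabsD z w : cabs (z + w) <= cabs z + cabs w.
Proof. exact: le_normcD. Qed.

Lemma le_cabsB z w : cabs (z - w) <= cabs z + cabs w.
Proof. by rewrite -(cabsN w) le_cabsD. Qed.

Lemma cabs_distC z w : cabs (z - w) = cabs (w - z).
Proof. by rewrite -cabsN opprB. Qed.

Lemma cabs_distD v z w : cabs (z - w) <= cabs (z - v) + cabs (v - w).
Proof. by rewrite (le_trans _ (le_cabsD _ _)) // addrA subrK. Qed.

Lemma lerB_cabs z w : cabs z - cabs w <= cabs (z - w).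
Proof. by rewrite lerBlDr -{1}(subrK w z) le_cabsD. Qed.

Lemma cabs_eq0 z : (cabs z == 0) = (z == 0).
Proof.
apply/eqP/eqP => [|->]; last exact: cabs0.
exact: ComplexField.Normc.eq0_normc.
Qed.

Lemma cabs_gt0 z : (0 < cabs z) = (z != 0).
Proof. by rewrite lt_def cabs_eq0 cabs_ge0 andbT. Qed.

Lemma cabs_real x : cabs (x%:C)%C = `|x|.
Proof. by rewrite cabsE expr0n addr0 sqrtr_sqr. Qed.

Lemma cabs_imag x : cabs (x *i)%C = `|x|.
Proof. by rewrite cabsE expr0n add0r sqrtr_sqr. Qed.

Lemma cabs_i : cabs ('i%C : R[i]) = 1.
Proof. by rewrite cabs_imag normr1. Qed.

Lemma sqr_cabs z : cabs z ^+ 2 = complex.Re z ^+ 2 + complex.Im z ^+ 2.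
Proof. by case: z => x y; rewrite cabsE sqr_sqrtr // addr_ge0 // sqr_ge0. Qed.

Lemma normr_Re_le z : `|complex.Re z| <= cabs z.
Proof.
case: z => x y; rewrite cabsE /= -sqrtr_sqr ler_sqrt ?addr_ge0 ?sqr_ge0 //.
by rewrite lerDl sqr_ge0.
Qed.

Lemma normr_Im_le z : `|complex.Im z| <= cabs z.
Proof.
case: z => x y; rewrite cabsE /= -sqrtr_sqr ler_sqrt ?addr_ge0 ?sqr_ge0 //.
by rewrite lerDr sqr_ge0.
Qed.

Lemma Re_le_cabs z : complex.Re z <= cabs z.
Proof. exact: le_trans (ler_norm _) (normr_Re_le z). Qed.

Lemma cabs_le_ReIm z : cabs z <= `|complex.Re z| + `|complex.Im z|.
Proof.
rewrite {1}(complexE z) (le_trans (le_cabsD _ _)) // cabsM cabs_i mul1r.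
by rewrite !cabs_real.
Qed.

Lemma ReD z w : complex.Re (z + w) = complex.Re z + complex.Re w.
Proof. by case: z w => [? ?] [? ?]. Qed.

Lemma ImD z w : complex.Im (z + w) = complex.Im z + complex.Im w.
Proof. by case: z w => [? ?] [? ?]. Qed.

Lemma ReN z : complex.Re (- z) = - complex.Re z.
Proof. by case: z. Qed.

Lemma ImN z : complex.Im (- z) = - complex.Im z.
Proof. by case: z. Qed.

Lemma cReM z w : complex.Re (z * w) =
  complex.Re z * complex.Re w - complex.Im z * complex.Im w.
Proof. by case: z w => [? ?] [? ?]. Qed.

Lemma cImM z w : complex.Im (z * w) =
  complex.Re z * complex.Im w + complex.Im z * complex.Re w.
Proof. by case: z w => [? ?] [? ?]. Qed.

Lemma complex_ext z w :
  complex.Re z = complex.Re w -> complex.Im z = complex.Im w -> z = w.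
Proof. by case: z w => [? ?] [? ?] /= -> ->. Qed.

Lemma complex_addr x y (s : R) : ((x +i* y) + s%:C = (x + s) +i* y)%C.
Proof. by apply: complex_ext; rewrite /= ?addr0. Qed.

Lemma complex_subr x x' y : ((x +i* y) - (x' +i* y) = (x - x')%:C)%C.
Proof. by apply: complex_ext; rewrite /= ?subrr. Qed.

Lemma complex_subi x y y' : ((x +i* y) - (x +i* y') = (y - y')*i)%C.
Proof. by apply: complex_ext; rewrite /= ?subrr. Qed.

End Modulus.

Section ComplexCalculus.
Variable R : realType.
Implicit Types (f g : R[i] -> R[i]) (z w k l : R[i]).

Lemma nbhs_cabsP z (A : set R[i]) : nbhs (z : Cn R) A <->
  exists2 d : R, 0 < d & forall w, cabs (w - z) < d -> A w.
Proof.
split=> [/nbhs_ballP[d /= d0 dA]|[d d0 dA]]; last first.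
  apply/nbhs_ballP; exists (d%:C)%C => /=; first by rewrite ltcR.
  by move=> w; rewrite /ball /= distrC normr_cabsE ltcR => /dA.
have /complex_realP[r rE] : d \is Num.real by rewrite gtr0_real.
move: d0 dA; rewrite {}rE ltcR => r0 rA; exists r => // w wr.
by apply: rA; rewrite /ball /= distrC normr_cabsE ltcR.
Qed.

Lemma cvg_cabsP (T : Type) (F : set_system T) (FF : Filter F) (f : T -> R[i]) l :
  (f : T -> Cn R) x @[x --> F] --> (l : Cn R) <->
  forall e : R, 0 < e -> \forall x \near F, cabs (f x - l) <= e.
Proof.
split=> [/cvgrPdist_le fl e e0|fl].
  have := fl (e%:C)%C; rewrite ltcR => /(_ e0); apply: filterS => x.
  by rewrite distrC normr_cabsE lecR.
apply/cvgrPdist_le => e e0.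
have /complex_realP[r rE] : e \is Num.real by rewrite gtr0_real.
move: e0; rewrite {}rE ltcR => /fl; apply: filterS => x.
by rewrite distrC normr_cabsE lecR.
Qed.

Lemma continuous_cabsP f z : {for z, continuous (f : Cn R -> Cn R)} <->
  forall e : R, 0 < e -> exists2 d : R, 0 < d &
    forall w, cabs (w - z) < d -> cabs (f w - f z) <= e.
Proof.
have cvgP := @cvg_cabsP _ (nbhs (z : Cn R)) _ f (f z).
by split=> [/cvgP cf e /cf /nbhs_cabsP //|cf]; apply/cvgP => e /cf /nbhs_cabsP.
Qed.

Lemma is_derive1P (K : numFieldType) (V : normedModType K) (f : K -> V) (x : K) (l : V) :
  is_derive x 1 f l <->
  forall e, 0 < e -> \forall h \near 0, `|f (x + h) - f x - h *: l| <= e * `|h|.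
Proof.
have slopeE (h : K) : h != 0 ->
    `|l - h^-1 *: (f (h + x) - f x)| = `|f (x + h) - f x - h *: l| / `|h|.
  move=> h0; rewrite [RHS]mulrC -normfV -normrZ distrC (addrC h).
  by rewrite [in RHS]scalerBr scalerA mulVf // scale1r.
suff slopeP : h^-1 *: ((f \o shift x) (h *: (1 : K)) - f x) @[h --> 0^'] --> l <->
    forall e, 0 < e -> \forall h \near 0, `|f (x + h) - f x - h *: l| <= e * `|h|.
  split=> [[df fl]|/slopeP fl]; first by apply/slopeP; rewrite -fl.
  by apply: DeriveDef; [apply/cvg_ex; exists l | exact/cvg_lim].
rewrite cvgrPdist_le; split=> fl e /fl; rewrite near_withinE; apply: filterS => h.
  have [->|h0] := eqVneq h 0.
    by move=> _; rewrite addr0 subrr scale0r subrr !normr0 mulr0.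
  by move=> /(_ isT); rewrite /= [h *: 1]mulr1 slopeE // ler_pdivrMr ?normr_gt0.
by move=> fh h0; rewrite /= [h *: 1]mulr1 slopeE // ler_pdivrMr ?normr_gt0.
Qed.

Lemma is_cderiveP f z l : is_cderive z f l <->
  forall e : R, 0 < e -> exists2 d : R, 0 < d &
    forall h, cabs h < d -> cabs (f (z + h) - f z - l * h) <= e * cabs h.
Proof.
split=> [/is_derive1P fl e e0|fl].
  have := fl (e%:C)%C; rewrite ltcR => /(_ e0) /nbhs_cabsP[d d0 dP].
  exists d => // h hd; have := dP h; rewrite subr0 => /(_ hd).
  by rewrite !normr_cabsE -rmorphM lecR [_ *: _]mulrC.
apply/is_derive1P => e e0.
have /complex_realP[r rE] : e \is Num.real by rewrite gtr0_real.
move: e0; rewrite {}rE ltcR => /fl[d d0 dP]; apply/nbhs_cabsP; exists d => // h.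
rewrite subr0 => /dP; rewrite !normr_cabsE -rmorphM lecR.
by rewrite [_ *: _]mulrC.
Qed.

Lemma is_derive_comp (K : numFieldType) (f g : K^o -> K^o) (x l l' : K^o) :
  is_derive x 1 f l -> is_derive (f x) 1 g l' -> is_derive x 1 (g \o f) (l' * l).
Proof.
move=> [/derivable1_diffP df fl] [/derivable1_diffP dg gl].
have dgf := differentiable_comp df dg.
apply: DeriveDef; first exact/derivable1_diffP.
have Df : 'd f x 1 = l by rewrite -fl; symmetry; exact: deriveE.
have Dg : 'd g (f x) 1 = l' by rewrite -gl; symmetry; exact: deriveE.
have Dgl : 'd g (f x) l = l * l'.
  rewrite -Dg; have {1}-> : l = l *: (1 : K^o) by rewrite /GRing.scale /= mulr1.
  exact: linearZ.
rewrite (deriveE _ dgf) (diff_comp df dg) /=.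
by rewrite [X in _ X = _]Df Dgl mulrC.
Qed.

Lemma is_cderiveMl k z : is_cderive z (fun v => k * v) k.
Proof.
have := is_deriveM (is_derive_cst (k : Cn R) (z : Cn R) 1) (is_derive_id (z : Cn R) 1).
by rewrite /GRing.scale /= mulr1 mulr0 addr0.
Qed.

Definition cderivable f z := derivable (f : Cn R -> Cn R) (z : Cn R) 1.

Lemma is_cderive_derivable f z l : is_cderive z f l -> cderivable f z.
Proof. by case. Qed.

Lemma cderivable_continuous f z : cderivable f z -> {for z, continuous (f : Cn R -> Cn R)}.
Proof. by move=> /derivable1_diffP/differentiable_continuous. Qed.

Lemma cderivable_cst k z : cderivable (fun=> k) z.
Proof. exact: derivable_cst. Qed.

Lemma cderivable_id z : cderivable id z.
Proof. exact: derivable_id. Qed.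

Lemma cderivableD f g z : cderivable f z -> cderivable g z -> cderivable (fun w => f w + g w) z.
Proof. exact: derivableD. Qed.

Lemma cderivableB f g z : cderivable f z -> cderivable g z -> cderivable (fun w => f w - g w) z.
Proof. exact: derivableB. Qed.

Lemma cderivableM f g z : cderivable f z -> cderivable g z -> cderivable (fun w => f w * g w) z.
Proof. exact: derivableM. Qed.

Lemma cderivableV f z : cderivable f z -> f z != 0 -> cderivable (fun w => (f w)^-1) z.
Proof. by move=> df fz; exact: derivableV. Qed.

Lemma near_eq_cderivable f g z : (\forall w \near (z : Cn R), f w = g w) ->
  cderivable f z -> cderivable g z.
Proof. by move=> fg; rewrite /cderivable; exact: near_eq_derivable. Qed.

Lemma cderivable_comp f g z : cderivable f z -> cderivable g (f z) ->
  cderivable (fun w => g (f w)) z.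
Proof. by move=> /derivableP df /derivableP dg; have [] := is_derive_comp df dg. Qed.

Lemma cderivableX f n z : cderivable f z -> cderivable (fun w => f w ^+ n) z.
Proof.
move=> df; apply: (@cderivable_comp f (fun w => w ^+ n)) df _.
exact: exprn_derivable.
Qed.

End ComplexCalculus.

Section ComplexIntegral.
Context d (T : measurableType d) (R : realType).
Variables (mu : {measure set T -> \bar R}) (D : set T).
Hypothesis mD : measurable D.
Implicit Types (f g : T -> R[i]) (k : R[i]) (h : T -> R).

Definition cmeasurable f :=
  measurable_fun D (fun t => complex.Re (f t)) /\
  measurable_fun D (fun t => complex.Im (f t)).

Definition cintegrable f :=
  mu.-integrable D (EFin \o (fun t => complex.Re (f t))) /\
  mu.-integrable D (EFin \o (fun t => complex.Im (f t))).

Definition cintegral f : R[i] :=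
  ((\int[mu]_(t in D) complex.Re (f t)) +i* (\int[mu]_(t in D) complex.Im (f t)))%C.

Lemma cmeasurableM f g : cmeasurable f -> cmeasurable g ->
  cmeasurable (fun t => f t * g t).
Proof.
move=> [fR fI] [gR gI]; split.
  by under eq_fun do rewrite cReM; apply: measurable_funB; exact: measurable_funM.
by under eq_fun do rewrite cImM; apply: measurable_funD; exact: measurable_funM.
Qed.

Lemma measurable_cabs f : cmeasurable f -> measurable_fun D (fun t => cabs (f t)).
Proof.
move=> [fR fI].
have -> : (fun t => cabs (f t)) = @Num.sqrt R \o
    (fun t => complex.Re (f t) ^+ 2 + complex.Im (f t) ^+ 2).
  by apply/funext => t /=; case: (f t).
apply: measurableT_comp; first exact: continuous_measurable_fun (@sqrt_continuous R).
by apply: measurable_funD; exact: measurable_funX.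
Qed.

Lemma cintegrable_measurable f : cintegrable f -> cmeasurable f.
Proof. by move=> [/measurable_int fR /measurable_int fI]; split; exact/measurable_EFinP. Qed.

Lemma le_cintegrable f h : cmeasurable f -> mu.-integrable D (EFin \o h) ->
  (forall t, D t -> cabs (f t) <= h t) -> cintegrable f.
Proof.
move=> [fR fI] ih fh; have h0 t : D t -> 0 <= h t.
  by move=> /fh; exact: le_trans (cabs_ge0 _).
split; (apply: le_integrable ih => //; first exact/measurable_EFinP) => t Dt;
  rewrite lee_fin (ger0_norm (h0 t Dt)); apply: le_trans (fh t Dt).
- exact: normr_Re_le.
- exact: normr_Im_le.
Qed.

Lemma integrable_cabs f : cintegrable f -> mu.-integrable D (EFin \o (fun t => cabs (f t))).
Proof.
move=> fi; have [fR fI] := fi.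
have := integrableD mD (integrable_norm fR) (integrable_norm fI); apply: le_integrable => //.
  by apply/measurable_EFinP; apply: measurable_cabs; exact: cintegrable_measurable.
move=> t _; rewrite lee_fin (ger0_norm (cabs_ge0 _)).
exact: le_trans (cabs_le_ReIm _) (ler_norm _).
Qed.

Lemma cintegrableMl f g (C : R) : cmeasurable g -> (forall t, D t -> cabs (g t) <= C) ->
  cintegrable f -> cintegrable (fun t => g t * f t).
Proof.
move=> mg gC fi; apply: (le_cintegrable (h := fun t => C * cabs (f t))).
- exact: cmeasurableM (cintegrable_measurable fi).
- exact: (integrableZl mD C (integrable_cabs fi)).
- by move=> t Dt; rewrite cabsM ler_wpM2r ?cabs_ge0 ?gC.
Qed.

Lemma cintegrableD f g : cintegrable f -> cintegrable g -> cintegrable (fun t => f t + g t).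
Proof.
move=> [fR fI] [gR gI]; split; under eq_fun do rewrite ?ReD ?ImD.
- exact: (integrableD mD fR gR).
- exact: (integrableD mD fI gI).
Qed.

Lemma cintegrableZl k f : cintegrable f -> cintegrable (fun t => k * f t).
Proof.
move=> [fR fI]; split; under eq_fun do rewrite ?cReM ?cImM.
- exact: (integrableB mD (integrableZl mD _ fR) (integrableZl mD _ fI)).
- exact: (integrableD mD (integrableZl mD _ fI) (integrableZl mD _ fR)).
Qed.

Lemma cintegrableN f : cintegrable f -> cintegrable (fun t => - f t).
Proof. by move=> /(cintegrableZl (-1)); under eq_fun do rewrite mulN1r. Qed.

Lemma cintegrableB f g : cintegrable f -> cintegrable g -> cintegrable (fun t => f t - g t).
Proof. by move=> fi /cintegrableN; exact: cintegrableD. Qed.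

Lemma eq_cintegral f g : (forall t, D t -> f t = g t) -> cintegral f = cintegral g.
Proof.
by move=> fg; congr (_ +i* _)%C; apply: eq_Rintegral => t; rewrite inE => /fg ->.
Qed.

Lemma cintegralD f g : cintegrable f -> cintegrable g ->
  cintegral (fun t => f t + g t) = cintegral f + cintegral g.
Proof.
move=> [fR fI] [gR gI]; apply: complex_ext; rewrite ?ReD ?ImD /=.
- by rewrite -RintegralD //; apply: eq_Rintegral => t _; rewrite ReD.
- by rewrite -RintegralD //; apply: eq_Rintegral => t _; rewrite ImD.
Qed.

Lemma cintegralZl k f : cintegrable f -> cintegral (fun t => k * f t) = k * cintegral f.
Proof.
move=> [fR fI]; have Z h := fun r => @integrableZl _ _ _ mu D mD r (EFin \o h).
apply: complex_ext; rewrite ?cReM ?cImM /= -!RintegralZl //.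
- rewrite -RintegralB //; [|exact: Z fR|exact: Z fI].
  by apply: eq_Rintegral => t _; rewrite cReM.
- rewrite -RintegralD //; [|exact: Z fI|exact: Z fR].
  by apply: eq_Rintegral => t _; rewrite cImM.
Qed.

Lemma cintegralN f : cintegrable f -> cintegral (fun t => - f t) = - cintegral f.
Proof.
by move=> fi; rewrite -mulN1r -cintegralZl //; apply: eq_cintegral => t _; rewrite mulN1r.
Qed.

Lemma cintegralB f g : cintegrable f -> cintegrable g ->
  cintegral (fun t => f t - g t) = cintegral f - cintegral g.
Proof. by move=> fi gi; rewrite cintegralD ?cintegralN //; exact: cintegrableN. Qed.

Lemma cintegrable0 : cintegrable (fun=> 0).
Proof. by split; exact: (integrable0 mu D). Qed.

Lemma cintegral0 : cintegral (fun=> 0) = 0.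
Proof. by apply: complex_ext; rewrite /= /Rintegral integral0. Qed.

Lemma cintegrable_sum n (F : 'I_n -> T -> R[i]) : (forall i, cintegrable (F i)) ->
  cintegrable (fun t => \sum_(i < n) F i t).
Proof.
elim: n F => [|n IH] F Fi.
  by under eq_fun do rewrite big_ord0; exact: cintegrable0.
by under eq_fun do rewrite big_ord_recr; apply: cintegrableD => //; exact: IH.
Qed.

Lemma cintegral_sum n (F : 'I_n -> T -> R[i]) : (forall i, cintegrable (F i)) ->
  cintegral (fun t => \sum_(i < n) F i t) = \sum_(i < n) cintegral (F i).
Proof.
elim: n F => [|n IH] F Fi.
  by rewrite big_ord0 -[RHS]cintegral0; apply: eq_cintegral => t _; rewrite big_ord0.
rewrite big_ord_recr /= -IH // -cintegralD //; last exact: cintegrable_sum.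
by apply: eq_cintegral => t _; rewrite big_ord_recr.
Qed.

(* Rotate the integral onto the positive axis, where it equals the integral of a
   real part. *)
Lemma le_cabs_cintegral f h : cintegrable f -> mu.-integrable D (EFin \o h) ->
  (forall t, D t -> cabs (f t) <= h t) -> cabs (cintegral f) <= \int[mu]_(t in D) h t.
Proof.
move=> fi hi fh; set I := cintegral f.
have [->|I0] := eqVneq I 0.
  by rewrite cabs0; apply: Rintegral_ge0 => t /fh; exact: le_trans (cabs_ge0 _).
pose u : R[i] := (cabs I)%:C%C / I.
have u1 : cabs u = 1.
  by rewrite cabsM cabsV cabs_real ger0_norm ?cabs_ge0 // divff // cabs_eq0.
have -> : cabs I = complex.Re (cintegral (fun t => u * f t)).
  by rewrite cintegralZl // -/I divfK.
apply: le_Rintegral => //; first by have [] := cintegrableZl u fi.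
by move=> t /fh; apply: le_trans; rewrite (le_trans (Re_le_cabs _)) // cabsM u1 mul1r.
Qed.

End ComplexIntegral.

Section ComplexIntegralSets.
Context d (T : measurableType d) (R : realType) (mu : {measure set T -> \bar R}).
Implicit Types (A B : set T) (f : T -> R[i]).

Lemma cintegrableS A B f : measurable A -> measurable B -> B `<=` A ->
  cintegrable mu A f -> cintegrable mu B f.
Proof. by move=> mA mB BA [fR fI]; split; exact: integrableS mA mB BA _. Qed.

Lemma cintegral_setU A B f : measurable A -> measurable B -> [disjoint A & B] ->
  cintegrable mu (A `|` B) f ->
  cintegral mu (A `|` B) f = cintegral mu A f + cintegral mu B f.
Proof.
move=> mA mB AB [fR fI]; apply: complex_ext; rewrite ?ReD ?ImD /=.
- exact: (Rintegral_setU mA mB fR AB).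
- exact: (Rintegral_setU mA mB fI AB).
Qed.

Lemma cintegral_mkcondr A B f :
  cintegral mu (A `&` B) f = cintegral mu A (fun t => if t \in B then f t else 0).
Proof.
by apply: complex_ext; rewrite /= Rintegral_mkcondr; apply: eq_Rintegral => t _;
  rewrite patchE; case: ifP.
Qed.

End ComplexIntegralSets.

Section SegmentIntegral.
Variable R : realType.
Implicit Types (phi : R -> R[i]) (f F : R[i] -> R[i]) (a b m x y : R).
Local Notation leb := (@lebesgue_measure R).

Lemma continuous_Re (T : topologicalType) (phi : T -> R[i]) t :
  {for t, continuous (phi : T -> Cn R)} ->
  {for t, continuous (fun s => complex.Re (phi s))}.
Proof.
move=> /cvg_cabsP c; apply/cvgrPdist_le => e /c; apply: filterS => s.
by apply: le_trans; rewrite distrC -ReN -ReD normr_Re_le.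
Qed.

Lemma continuous_Im (T : topologicalType) (phi : T -> R[i]) t :
  {for t, continuous (phi : T -> Cn R)} ->
  {for t, continuous (fun s => complex.Im (phi s))}.
Proof.
move=> /cvg_cabsP c; apply/cvgrPdist_le => e /c; apply: filterS => s.
by apply: le_trans; rewrite distrC -ImN -ImD normr_Im_le.
Qed.

Lemma continuous_horizontal y : continuous ((fun x => (x +i* y)%C) : R -> Cn R).
Proof.
move=> x; apply/cvg_cabsP => e e0; apply/nbhs_ballP; exists e => // s /ltW.
by rewrite complex_subr cabs_real distrC.
Qed.

Lemma continuous_real_complex : continuous ((fun x => x%:C%C) : R -> Cn R).
Proof. by move=> x; have := @continuous_horizontal 0 x. Qed.

Lemma continuous_vertical x : continuous ((fun y => (x +i* y)%C) : R -> Cn R).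
Proof.
move=> y; apply/cvg_cabsP => e e0; apply/nbhs_ballP; exists e => // s /ltW.
by rewrite complex_subi cabs_imag distrC.
Qed.

Lemma continuous_horizontal_comp f x y : {for (x +i* y)%C, continuous (f : Cn R -> Cn R)} ->
  {for x, continuous ((fun t => f (t +i* y)%C) : R -> Cn R)}.
Proof. by move=> cf; exact: (continuous_comp (@continuous_horizontal y x) cf). Qed.

Lemma continuous_vertical_comp f x y : {for (x +i* y)%C, continuous (f : Cn R -> Cn R)} ->
  {for y, continuous ((fun t => f (x +i* t)%C) : R -> Cn R)}.
Proof. by move=> cf; exact: (continuous_comp (@continuous_vertical x y) cf). Qed.

Definition continuous_on_itv a b phi :=
  forall t, a <= t <= b -> {for t, continuous (phi : R -> Cn R)}.

Definition itv_integral a b phi := cintegral leb `[a, b] phi.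

Lemma continuous_itv_cintegrable a b phi :
  continuous_on_itv a b phi -> cintegrable leb `[a, b] phi.
Proof.
move=> c; split; (apply: continuous_compact_integrable; first exact: segment_compact);
  apply: continuous_in_subspaceT => t; rewrite inE /= in_itv /= => tab.
- exact: continuous_Re (c _ tab).
- exact: continuous_Im (c _ tab).
Qed.

Lemma Rintegral_itv_split m a b (h : R -> R) : a <= m <= b ->
  leb.-integrable `[a, b] (EFin \o h) ->
  \int[leb]_(t in `[a, b]) h t =
  \int[leb]_(t in `[a, m]) h t + \int[leb]_(t in `[m, b]) h t.
Proof.
move=> /andP[am mb] ih; apply/eqP; rewrite addrC -subr_eq; apply/eqP.
rewrite Rintegral_itvB ?bnd_simp // Rintegral_itv_obnd_cbnd //.
by apply: integrableS ih => //; apply: subset_itvr; rewrite bnd_simp.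
Qed.

Lemma itv_integral_split m a b phi : a <= m <= b -> cintegrable leb `[a, b] phi ->
  itv_integral a b phi = itv_integral a m phi + itv_integral m b phi.
Proof.
by move=> amb [pR pI]; rewrite /itv_integral /cintegral !(Rintegral_itv_split amb).
Qed.

Lemma Rintegral_itv_cst a b (r : R) : a <= b ->
  \int[leb]_(_ in `[a, b]) r = r * (b - a).
Proof.
move=> ab; rewrite Rintegral_cst //= lebesgue_measure_itv /= lte_fin.
move: ab; rewrite le_eqVlt => /orP[/eqP ->|ab]; first by rewrite ltxx subrr.
by rewrite ab.
Qed.

Lemma itv_integral_cst a b (k : R[i]) : a <= b ->
  itv_integral a b (fun=> k) = k * (b - a)%:C%C.
Proof.
by move=> ab; rewrite /itv_integral /cintegral !Rintegral_itv_cst //; case: k => x y; simpc.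
Qed.

Lemma le_cabs_itv_integral a b phi (M : R) : a <= b -> cintegrable leb `[a, b] phi ->
  (forall t, a <= t <= b -> cabs (phi t) <= M) -> cabs (itv_integral a b phi) <= M * (b - a).
Proof.
move=> ab ip pM; rewrite -(Rintegral_itv_cst M ab); apply: le_cabs_cintegral => //.
  apply: continuous_compact_integrable; first exact: segment_compact.
  by apply: continuous_subspaceT => x; exact: cvg_cst.
Qed.

Lemma is_derive_ReIm_horizontal F x y l : is_cderive (x +i* y)%C F l ->
  is_derive x (1 : R) (fun t => complex.Re (F (t +i* y)%C)) (complex.Re l) /\
  is_derive x (1 : R) (fun t => complex.Im (F (t +i* y)%C)) (complex.Im l).
Proof.
move=> /is_cderiveP dF; have step (t : R) : ((x + t) +i* y = (x +i* y) + t%:C)%C.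
  by rewrite complex_addr.
split; apply/is_derive1P => e e0; have [d d0 dP] := dF _ e0;
  apply/nbhs_ballP; exists d => // t; rewrite /ball /= sub0r normrN => td;
  have := dP (t%:C%C); rewrite cabs_real => /(_ td).
- rewrite step; apply: le_trans; rewrite (le_trans _ (normr_Re_le _)) //.
  by rewrite !ReD !ReN cReM /= mulr0 subr0 [_ *: _]mulrC.
- rewrite step; apply: le_trans; rewrite (le_trans _ (normr_Im_le _)) //.
  by rewrite !ImD !ImN cImM /= mulr0 add0r [_ *: _]mulrC.
Qed.

Lemma Rintegral_derive (G g : R -> R) a b : a <= b ->
  (forall x, a <= x <= b -> is_derive x (1 : R) G (g x)) ->
  (forall x, a <= x <= b -> {for x, continuous g}) ->
  \int[leb]_(x in `[a, b]) g x = G b - G a.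
Proof.
rewrite le_eqVlt => /orP[/eqP <- _ _|ab dG cg].
  by rewrite set_itv1 Rintegral_set1 subrr.
have cG x : a <= x <= b -> {for x, continuous G}.
  by move=> /dG[/derivable1_diffP/differentiable_continuous].
rewrite /Rintegral (@continuous_FTC2 _ g G) //.
- by apply: continuous_in_subspaceT => x; rewrite inE /= in_itv /=; exact: cg.
- split=> [x||].
  + by rewrite in_itv /= => /andP[/ltW ax /ltW xb]; have [] := dG x; rewrite ?ax.
  + by apply: cvg_at_right_filter; apply: cG; rewrite lexx ltW.
  + by apply: cvg_at_left_filter; apply: cG; rewrite lexx ltW.
- move=> x; rewrite in_itv /= => /andP[/ltW ax /ltW xb]; rewrite derive1E.
  by have [|_ ->] := dG x; rewrite ?ax.
Qed.

Lemma itv_integral_primitive F f y a b : a <= b ->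
  (forall x, a <= x <= b -> is_cderive (x +i* y)%C F (f (x +i* y)%C)) ->
  continuous_on_itv a b (fun x => f (x +i* y)%C) ->
  itv_integral a b (fun x => f (x +i* y)%C) = F (b +i* y)%C - F (a +i* y)%C.
Proof.
move=> ab dF cf; apply: complex_ext; rewrite ?ReD ?ReN ?ImD ?ImN /=.
- apply: (@Rintegral_derive (fun t => complex.Re (F (t +i* y)%C))) => // x xab.
    by have [] := is_derive_ReIm_horizontal (dF x xab).
  exact: continuous_Re (cf x xab).
- apply: (@Rintegral_derive (fun t => complex.Im (F (t +i* y)%C))) => // x xab.
    by have [] := is_derive_ReIm_horizontal (dF x xab).
  exact: continuous_Im (cf x xab).
Qed.

End SegmentIntegral.

Section ComplexExponential.
Variable R : realType.
Implicit Types (z w : R[i]) (x y : R).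

Definition cexp z : R[i] :=
  (expR (complex.Re z) * cos (complex.Im z) +i* (expR (complex.Re z) * sin (complex.Im z)))%C.

Lemma cexpD z w : cexp (z + w) = cexp z * cexp w.
Proof.
by apply: complex_ext; rewrite ?cReM ?cImM /= ReD ImD expRD ?cosD ?sinD; ring.
Qed.

Lemma cexp0 : cexp 0 = 1.
Proof. by rewrite /cexp /= expR0 cos0 sin0 mulr1 mulr0. Qed.

Lemma cabs_cexp z : cabs (cexp z) = expR (complex.Re z).
Proof. by rewrite cabsE !exprMn -mulrDr cos2Dsin2 mulr1 sqrtr_sqr ger0_norm. Qed.

Lemma cexp_neq0 z : cexp z != 0.
Proof. by rewrite -cabs_gt0 cabs_cexp expR_gt0. Qed.

Lemma cexp_real x : cexp x%:C%C = (expR x)%:C%C.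
Proof. by rewrite /cexp /= cos0 sin0 mulr1 mulr0. Qed.

Lemma cexp_periodic z : cexp (z + (pi *+ 2)*i%C) = cexp z.
Proof. by rewrite /cexp /= ReD ImD /= addr0 cosD2pi sinD2pi. Qed.

Lemma cexp_near0_le (q x y : R) : 0 < q <= 1 -> `|x| <= 1 ->
  `|expR x - 1 - x| <= q * `|x| -> `|cos y - 1| <= q * `|y| -> `|sin y - y| <= q * `|y| ->
  `|y| <= q -> `|expR x * cos y - 1 - x| <= q * `|x| + 3 * q * `|y| /\
  `|expR x * sin y - y| <= 2 * q * `|x| + 3 * q * `|y|.
Proof.
move=> /andP[q0 q1] x1 expx cosy siny yq.
have expx1 : `|expR x - 1| <= 2 * `|x|.
  by have := ler_normD (expR x - 1 - x) x; have := normr_ge0 x; rewrite subrK; nra.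
have expx3 : `|expR x| <= 3.
  by have := ler_normD (expR x - 1) 1; rewrite subrK normr1; lra.
have mul3 (u : R) : `|u| <= q * `|y| -> `|expR x * u| <= 3 * q * `|y|.
  by move=> uq; rewrite normrM -mulrA ler_pM.
split.
- have -> : expR x * cos y - 1 - x = (expR x - 1 - x) + expR x * (cos y - 1) by ring.
  by rewrite (le_trans (ler_normD _ _)) // lerD ?mul3.
- have -> : expR x * sin y - y = (expR x - 1) * y + expR x * (sin y - y) by ring.
  rewrite (le_trans (ler_normD _ _)) // lerD ?mul3 // normrM.
  by rewrite (le_trans (ler_pM _ _ expx1 yq)) // mulrAC.
Qed.

Lemma is_cderive_cexp0 : is_cderive 0 cexp 1.
Proof.
apply/is_cderiveP => e e0; pose q := Num.min 1 (e / 9).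
have q0 : 0 < q by rewrite lt_min ltr01 divr_gt0.
have [q1 qe] : q <= 1 /\ q <= e / 9 by rewrite /q; split; rewrite ge_min lexx ?orbT.
clearbody q; have first_order (f : R -> R) l : is_derive (0 : R) (1 : R) f l -> exists2 d : R,
    0 < d & forall t, `|t| < d -> `|f t - f 0 - t * l| <= q * `|t|.
  move=> /is_derive1P/(_ q q0)/nbhs_ballP[d d0 dP]; exists d => // t td.
  by have := dP t; rewrite /ball /= sub0r normrN add0r; exact.
have [d1 d10 exp0] := first_order _ _ (is_derive_expR 0).
have [d2 d20 cos0'] := first_order _ _ (is_derive_cos 0).
have [d3 d30 sin0'] := first_order _ _ (is_derive_sin 0).
exists (Num.min q (Num.min d1 (Num.min d2 d3))); first by rewrite !lt_min q0 d10 d20.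
move=> h; rewrite !lt_min => /and4P[hq h1 h2 h3]; rewrite add0r cexp0 mul1r.
have [xh yh] := (normr_Re_le h, normr_Im_le h).
have [||||||re_le im_le] := @cexp_near0_le q (complex.Re h) (complex.Im h).
- by rewrite q0.
- lra.
- by have := exp0 _ (le_lt_trans xh h1); rewrite expR0 mulr1.
- by have := cos0' _ (le_lt_trans yh h2); rewrite cos0 sin0 oppr0 mulr0 subr0.
- by have := sin0' _ (le_lt_trans yh h3); rewrite cos0 sin0 mulr1 subr0.
- lra.
rewrite (le_trans (cabs_le_ReIm _)) // !ReD !ImD !ReN !ImN /= oppr0 addr0.
have : q * `|complex.Re h| <= e / 9 * cabs h by rewrite ler_pM // ltW.
have : q * `|complex.Im h| <= e / 9 * cabs h by rewrite ler_pM // ltW.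
lra.
Qed.

Lemma is_cderive_cexp z : is_cderive z cexp (cexp z).
Proof.
have /is_cderiveP exp0 := is_cderive_cexp0; apply/is_cderiveP => e e0.
have [d d0 dP] := exp0 _ (divr_gt0 e0 (expR_gt0 (complex.Re z))).
exists d => // h /dP; rewrite add0r cexp0 mul1r => hP.
have -> : cexp (z + h) - cexp z - cexp z * h = cexp z * (cexp h - 1 - h).
  by rewrite cexpD; ring.
by rewrite cabsM cabs_cexp mulrC -ler_pdivlMr ?expR_gt0 // mulrAC.
Qed.

Lemma cderivable_cexp z : cderivable cexp z.
Proof. exact: is_cderive_derivable (is_cderive_cexp z). Qed.

Lemma continuous_cexp : continuous (cexp : Cn R -> Cn R).
Proof. by move=> z; apply: cderivable_continuous; exact: cderivable_cexp. Qed.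

Lemma is_cderive_cexpMl w z : is_cderive z (fun v => cexp (w * v)) (w * cexp (w * z)).
Proof. by rewrite mulrC; exact: is_derive_comp (is_cderiveMl w z) (is_cderive_cexp (w * z)). Qed.

Lemma continuous_cexpMl w : continuous ((fun v => cexp (w * v)) : Cn R -> Cn R).
Proof.
move=> z; have d := is_cderive_derivable (is_cderive_cexpMl w z).
exact: cderivable_continuous d.
Qed.

Lemma continuous_cexp_ray w y : continuous ((fun t => cexp (w * (t +i* y)%C)) : R -> Cn R).
Proof. by move=> t; exact: (continuous_horizontal_comp (@continuous_cexpMl w (t +i* y)%C)). Qed.

Lemma Re_scale_le (t : R) w : 0 <= t <= 1 -> complex.Re (w * t%:C%C) <= cabs w.
Proof.
move=> /andP[t0 t1]; rewrite cReM /= mulr0 subr0.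
by have := Re_le_cabs w; have := cabs_ge0 w; nra.
Qed.

Lemma cabs_cexp_sub1 w : cabs (cexp w - 1) <= cabs w * expR (cabs w).
Proof.
have cf : continuous_on_itv 0 1 (fun t => w * cexp (w * t%:C%C)).
  by move=> t _; exact: (cvgM (cvg_cst _) (@continuous_cexp_ray w 0 t)).
have := @itv_integral_primitive _ (fun v => cexp (w * v)) (fun v => w * cexp (w * v)) 0 0 1
  ler01 (fun x _ => is_cderive_cexpMl w _) cf.
rewrite mulr1 mulr0 cexp0 => <-; rewrite -[leRHS]mulr1 -[X in _ * X](subr0 1).
apply: le_cabs_itv_integral => //; first exact: continuous_itv_cintegrable.
by move=> t t01; rewrite cabsM cabs_cexp ler_wpM2l ?cabs_ge0 // ler_expR Re_scale_le.
Qed.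

Lemma cabs_cexp_sub1Dx w : cabs (cexp w - 1 - w) <= cabs w ^+ 2 * expR (cabs w).
Proof.
have cf : continuous_on_itv 0 1 (fun t => w * cexp (w * t%:C%C) - w).
  move=> t _; apply: cvgB; last exact: cvg_cst.
  exact: (cvgM (cvg_cst _) (@continuous_cexp_ray w 0 t)).
have dF (z : R[i]) : is_cderive z (fun v => cexp (w * v) - w * v) (w * cexp (w * z) - w).
  exact: is_deriveB (is_cderive_cexpMl w z) (is_cderiveMl w z).
have := @itv_integral_primitive _ (fun v => cexp (w * v) - w * v)
  (fun v => w * cexp (w * v) - w) 0 0 1 ler01 (fun x _ => dF _) cf.
rewrite mulr1 mulr0 cexp0 subr0 addrAC => <-; rewrite -[leRHS]mulr1 -[X in _ * X](subr0 1).
apply: le_cabs_itv_integral => //; first exact: continuous_itv_cintegrable.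
move=> t t01; have -> : w * cexp (w * t%:C%C) - w = w * (cexp (w * t%:C%C) - 1) by ring.
rewrite cabsM expr2 -mulrA ler_wpM2l ?cabs_ge0 // (le_trans (cabs_cexp_sub1 _)) //.
have tw : cabs (w * t%:C%C) <= cabs w.
  by move: t01 => /andP[t0 t1]; rewrite cabsM cabs_real ger0_norm // ler_piMr ?cabs_ge0.
by rewrite ler_pM ?cabs_ge0 ?expR_ge0 // ler_expR.
Qed.

End ComplexExponential.

Section RectangleBisection.
Variable R : realType.
Implicit Types (a b c d : R).

Lemma nested_itv (A B : nat -> R) :
  (forall n, A n <= A n.+1) -> (forall n, B n.+1 <= B n) -> (forall n, A n <= B n) ->
  exists x, forall n, A n <= x <= B n.
Proof.
move=> /nondecreasing_seqP ndA /nonincreasing_seqP niB AB.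
have AmBn m n : A m <= B n.
  by rewrite (le_trans (ndA _ _ (leq_maxl m n))) // (le_trans (AB _)) // niB // leq_maxr.
exists (sup (range A)) => n; apply/andP; split.
  by apply: ub_le_sup; [exists (B n) => _ [m _ <-]; exact: AmBn | exists n].
by apply: ge_sup; [exists (A n), n | move=> _ [m _ <-]; exact: AmBn].
Qed.

Lemma half_pow_small (K e : R) : 0 < e -> exists n, K / 2 ^+ n <= e.
Proof.
move=> e0; exists (Num.bound (K / e)).
rewrite ler_pdivrMr ?exprn_gt0 // mulrC -ler_pdivrMr //.
have [/archi_boundP/ltW Kn|/ltW K0] := leP 0 (K / e); last first.
  by rewrite (le_trans K0) // exprn_ge0.
by rewrite (le_trans Kn) // -natrX ler_nat ltnW // ltn_expl.
Qed.

Variable P : R -> R -> R -> R -> Prop.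
Hypothesis P_quarters : forall a b c d, a <= b -> c <= d ->
  P a ((a + b) / 2) c ((c + d) / 2) -> P ((a + b) / 2) b c ((c + d) / 2) ->
  P a ((a + b) / 2) ((c + d) / 2) d -> P ((a + b) / 2) b ((c + d) / 2) d ->
  P a b c d.

Let bad (q : (R * R) * (R * R)) :=
  [/\ q.1.1 <= q.1.2, q.2.1 <= q.2.2 & ~ P q.1.1 q.1.2 q.2.1 q.2.2].

Let quarter (q q' : (R * R) * (R * R)) :=
  [/\ q.1.1 <= q'.1.1, q'.1.2 <= q.1.2, q.2.1 <= q'.2.1, q'.2.2 <= q.2.2 &
      q'.1.2 - q'.1.1 = (q.1.2 - q.1.1) / 2 /\ q'.2.2 - q'.2.1 = (q.2.2 - q.2.1) / 2].

Let bad_quarter q : exists q', bad q -> bad q' /\ quarter q q'.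
Proof.
case: q => -[a b] [c d]; pose m := (a + b) / 2; pose n := (c + d) / 2.
apply: contrapT => none; have bad_q : bad ((a, b), (c, d)).
  by apply: contrapT => nbad; apply: none; exists ((a, b), (c, d)) => /nbad.
have [/= ab cd nP] := bad_q; apply: nP; apply: P_quarters => //; apply: contrapT => nP;
  apply: none.
- by exists ((a, m), (c, n)); split; split=> //=; try split; rewrite /m /n; lra.
- by exists ((m, b), (c, n)); split; split=> //=; try split; rewrite /m /n; lra.
- by exists ((a, m), (n, d)); split; split=> //=; try split; rewrite /m /n; lra.
- by exists ((m, b), (n, d)); split; split=> //=; try split; rewrite /m /n; lra.
Qed.

(* A failure would propagate to nested rectangles that shrink to a point. *)
Lemma rect_ind a b c d : a <= b -> c <= d ->
  (forall x y, a <= x <= b -> c <= y <= d -> exists2 e : R, 0 < e &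
     forall a' b' c' d', a <= a' -> a' <= x <= b' -> b' <= b ->
       c <= c' -> c' <= y <= d' -> d' <= d -> b' - a' <= e -> d' - c' <= e ->
       P a' b' c' d') ->
  P a b c d.
Proof.
move=> ab cd Ploc; apply: contrapT => nP.
have [next nextP] := choice bad_quarter.
pose q n := iter n next ((a, b), (c, d)).
have bad_q n : bad (q n) by elim: n => [|n IH] //; have [] := nextP _ IH.
have step n : quarter (q n) (q n.+1) by have [] := nextP _ (bad_q n).
have [x xq] : exists x, forall n, (q n).1.1 <= x <= (q n).1.2.
  by apply: nested_itv => n; [have [] := step n | have [] := step n | have [] := bad_q n].
have [y yq] : exists y, forall n, (q n).2.1 <= y <= (q n).2.2.
  by apply: nested_itv => n; [have [] := step n | have [] := step n | have [] := bad_q n].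
have [e e0 small] := Ploc x y (xq 0%N) (yq 0%N).
have sub n : [/\ a <= (q n).1.1, (q n).1.2 <= b, c <= (q n).2.1 & (q n).2.2 <= d].
  elim: n => [|n [a_le le_b c_le le_d]] //; have [leA geB leC geD _] := step n.
  by split; [exact: le_trans leA|exact: le_trans le_b|exact: le_trans leC|exact: le_trans le_d].
have width n : (q n).1.2 - (q n).1.1 = (b - a) / 2 ^+ n /\
    (q n).2.2 - (q n).2.1 = (d - c) / 2 ^+ n.
  elim: n => [|n [wx wy]]; first by rewrite expr0 !divr1.
  have [_ _ _ _ [-> ->]] := step n.
  by rewrite wx wy exprS [(2 * _)^-1]invfM; split; rewrite mulrA mulrAC.
have [n nsmall] := half_pow_small ((b - a) + (d - c)) e0.
have [_ _ nPn] := bad_q n; have [wx wy] := width n; have [a_le le_b c_le le_d] := sub n.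
apply: nPn; apply: small => //.
- by rewrite wx (le_trans _ nsmall) // ler_pM2r ?invr_gt0 ?exprn_gt0 //; lra.
- by rewrite wy (le_trans _ nsmall) // ler_pM2r ?invr_gt0 ?exprn_gt0 //; lra.
Qed.

End RectangleBisection.

Section Goursat.
Variable R : realType.
Implicit Types (H G F f : R[i] -> R[i]) (a b c d m : R) (z p k l : R[i]).

Definition inrect a b c d z := a <= complex.Re z <= b /\ c <= complex.Im z <= d.

Definition continuous_on_rect H a b c d :=
  forall z, inrect a b c d z -> {for z, continuous (H : Cn R -> Cn R)}.

Definition rect_integral H a b c d : R[i] :=
  itv_integral a b (fun x => H (x +i* c)%C) - itv_integral a b (fun x => H (x +i* d)%C) +
  'i%C * (itv_integral c d (fun y => H (b +i* y)%C) - itv_integral c d (fun y => H (a +i* y)%C)).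

Lemma inrect_dist a b c d z p : inrect a b c d z -> inrect a b c d p ->
  cabs (z - p) <= (b - a) + (d - c).
Proof.
move=> [/andP[z1 z2] /andP[z3 z4]] [/andP[p1 p2] /andP[p3 p4]].
rewrite (le_trans (cabs_le_ReIm _)) // ReD ImD ReN ImN.
by rewrite lerD // ler_norml; apply/andP; split; lra.
Qed.

Lemma continuous_on_subrect a' b' c' d' H a b c d :
  a <= a' -> b' <= b -> c <= c' -> d' <= d ->
  continuous_on_rect H a b c d -> continuous_on_rect H a' b' c' d'.
Proof.
move=> aa bb cc dd h z [/andP[z1 z2] /andP[z3 z4]]; apply: h.
by split; apply/andP; split; lra.
Qed.

Lemma rect_horizontal_cintegrable H a b c d y : continuous_on_rect H a b c d -> c <= y <= d ->
  cintegrable (@lebesgue_measure R) `[a, b] (fun x => H (x +i* y)%C).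
Proof.
move=> cH cyd; apply: continuous_itv_cintegrable => x axb.
by apply: continuous_horizontal_comp; apply: cH.
Qed.

Lemma rect_vertical_cintegrable H a b c d x : continuous_on_rect H a b c d -> a <= x <= b ->
  cintegrable (@lebesgue_measure R) `[c, d] (fun y => H (x +i* y)%C).
Proof.
move=> cH axb; apply: continuous_itv_cintegrable => y cyd.
by apply: continuous_vertical_comp; apply: cH.
Qed.

Lemma rect_integral_quarters H m n a b c d : a <= m <= b -> c <= n <= d ->
  continuous_on_rect H a b c d ->
  rect_integral H a b c d =
  rect_integral H a m c n + rect_integral H m b c n +
  (rect_integral H a m n d + rect_integral H m b n d).
Proof.
move=> amb cnd cH; have [am mb] := andP amb; have [cn nd] := andP cnd.
have hor y : c <= y <= d -> itv_integral a b (fun x => H (x +i* y)%C) =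
    itv_integral a m (fun x => H (x +i* y)%C) + itv_integral m b (fun x => H (x +i* y)%C).
  by move=> cyd; apply: itv_integral_split => //; exact: rect_horizontal_cintegrable cH _.
have ver x : a <= x <= b -> itv_integral c d (fun y => H (x +i* y)%C) =
    itv_integral c n (fun y => H (x +i* y)%C) + itv_integral n d (fun y => H (x +i* y)%C).
  by move=> axb; apply: itv_integral_split => //; exact: rect_vertical_cintegrable cH _.
rewrite /rect_integral !hor ?lexx ?(le_trans cn nd) //.
by rewrite !ver ?lexx ?(le_trans am mb) //; ring.
Qed.

Lemma rect_integralB H G a b c d : a <= b -> c <= d ->
  continuous_on_rect H a b c d -> continuous_on_rect G a b c d ->
  rect_integral (fun z => H z - G z) a b c d = rect_integral H a b c d - rect_integral G a b c d.
Proof.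
move=> ab cd cH cG; rewrite /rect_integral.
rewrite /itv_integral !cintegralB //; try by
  [apply: rect_horizontal_cintegrable cH _; rewrite lexx ?cd
  |apply: rect_horizontal_cintegrable cG _; rewrite lexx ?cd
  |apply: rect_vertical_cintegrable cH _; rewrite lexx ?ab
  |apply: rect_vertical_cintegrable cG _; rewrite lexx ?ab].
ring.
Qed.

Lemma le_cabs_rect_integral H a b c d (M : R) : a <= b -> c <= d ->
  continuous_on_rect H a b c d -> (forall z, inrect a b c d z -> cabs (H z) <= M) ->
  cabs (rect_integral H a b c d) <= 2 * M * ((b - a) + (d - c)).
Proof.
move=> ab cd cH HM.
have hor y : c <= y <= d -> cabs (itv_integral a b (fun x => H (x +i* y)%C)) <= M * (b - a).
  move=> cyd; apply: le_cabs_itv_integral => //; first exact: rect_horizontal_cintegrable cH _.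
  by move=> x axb; apply: HM.
have ver x : a <= x <= b -> cabs (itv_integral c d (fun y => H (x +i* y)%C)) <= M * (d - c).
  move=> axb; apply: le_cabs_itv_integral => //; first exact: rect_vertical_cintegrable cH _.
  by move=> y cyd; apply: HM.
rewrite (le_trans (le_cabsD _ _)) // cabsM cabs_i mul1r.
have -> : 2 * M * (b - a + (d - c)) =
  (M * (b - a) + M * (b - a)) + (M * (d - c) + M * (d - c)) by ring.
apply: lerD; apply: (le_trans (le_cabsB _ _)); apply: lerD;
  [apply: hor|apply: hor|apply: ver|apply: ver]; by rewrite lexx ?ab ?cd.
Qed.

Lemma itv_integral_vertical_primitive F f x c d : c <= d ->
  (forall z, is_cderive z F (f z)) -> continuous (f : Cn R -> Cn R) ->
  'i%C * itv_integral c d (fun y => f (x +i* y)%C) = F (x +i* d)%C - F (x +i* c)%C.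
Proof.
move=> cd dF cf; have rotE (y : R) : ('i * (y +i* (- x)))%C = (x +i* y)%C :> R[i].
  by apply: complex_ext; rewrite /= ?mul0r ?mul1r ?sub0r ?opprK ?add0r.
have drot z : is_cderive z (fun v => F ('i%C * v)) ('i%C * f ('i%C * z)).
  by rewrite mulrC; exact: is_derive_comp (is_cderiveMl 'i%C z) (dF _).
have := @itv_integral_primitive _ _ (fun v => 'i%C * f ('i%C * v)) (- x) c d cd (fun y _ => drot _).
under eq_fun do rewrite rotE.
rewrite !rotE => <-; last first.
  by move=> y _; exact: (cvgM (cvg_cst _) (continuous_vertical_comp (cf _))).
rewrite /itv_integral -cintegralZl //; last first.
  by apply: continuous_itv_cintegrable => y _; apply: continuous_vertical_comp; exact: cf.
Qed.

Lemma rect_integral_primitive F f a b c d : a <= b -> c <= d ->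
  (forall z, is_cderive z F (f z)) -> continuous (f : Cn R -> Cn R) ->
  rect_integral f a b c d = 0.
Proof.
move=> ab cd dF cf; have hor y : continuous_on_itv a b (fun x => f (x +i* y)%C).
  by move=> x _; apply: continuous_horizontal_comp; exact: cf.
rewrite /rect_integral !(itv_integral_primitive ab (fun x _ => dF _)) //.
by rewrite mulrBr !(itv_integral_vertical_primitive _ cd dF cf); ring.
Qed.

Lemma continuous_affine k l : continuous ((fun z => k + l * z) : Cn R -> Cn R).
Proof.
move=> z; have dl := is_cderive_derivable (is_cderiveMl l z).
exact: (cvgD (cvg_cst _) (cderivable_continuous dl)).
Qed.

Lemma rect_integral_affine k l a b c d : a <= b -> c <= d ->
  rect_integral (fun z => k + l * z) a b c d = 0.
Proof.
pose F z := k * z + l / 2 * (z * z); pose f z := k + l * z; move=> ab cd.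
have dF z : is_cderive z F (f z).
  have dsqr : is_cderive z (fun v => v * v) (z + z).
    have := is_deriveM (is_derive_id (z : Cn R) 1) (is_derive_id (z : Cn R) 1).
    by rewrite /GRing.scale /= mulr1.
  have -> : f z = k + l / 2 * (z + z) by rewrite /f; field.
  exact: is_deriveD (is_cderiveMl k z) (is_deriveZ (l / 2) dsqr).
exact: (rect_integral_primitive ab cd dF (@continuous_affine k l)).
Qed.

Lemma is_cderive_rect_integral H p l (e : R) : is_cderive p H l -> 0 < e ->
  exists2 r : R, 0 < r & forall a b c d, a <= b -> c <= d -> inrect a b c d p ->
    b - a <= r -> d - c <= r -> continuous_on_rect H a b c d ->
    cabs (rect_integral H a b c d) <= e * ((b - a) + (d - c)) ^+ 2.
Proof.
move=> /is_cderiveP dH e0; have [r r0 rP] := dH _ (divr_gt0 e0 (ltr0n R 2)).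
exists (r / 4) => [|a b c d ab cd pr br dr cH]; first by rewrite divr_gt0.
pose A z := (H p - l * p) + l * z.
have cA : continuous_on_rect A a b c d by move=> z _; exact: continuous_affine.
rewrite -[rect_integral H _ _ _ _]subr0 -(rect_integral_affine (H p - l * p) l ab cd).
rewrite -rect_integralB // expr2 mulrA.
have -> : e * ((b - a) + (d - c)) = 2 * (e / 2 * ((b - a) + (d - c))) by field.
apply: (le_cabs_rect_integral ab cd) => z zr; first exact: (cvgB (cH z zr) (cA z zr)).
have zp := inrect_dist zr pr.
have -> : H z - (H p - l * p + l * z) = H (p + (z - p)) - H p - l * (z - p).
  by rewrite (addrC p (z - p)) subrK; ring.
rewrite (le_trans (rP _ _)) //; first by rewrite (le_lt_trans zp) //; lra.
by rewrite ler_pM2l // divr_gt0.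
Qed.

Lemma le0_of_eps (x C : R) : 0 <= C -> (forall e, 0 < e -> x <= e * C) -> x <= 0.
Proof.
move=> C0 xC; rewrite leNgt; apply/negP => x0.
have C1 : 0 < 2 * (C + 1) by lra.
have := xC _ (divr_gt0 x0 C1); rewrite mulrAC ler_pdivlMr //; nra.
Qed.

Theorem goursat H a b c d : a <= b -> c <= d ->
  (forall z, inrect a b c d z -> cderivable H z) ->
  rect_integral H a b c d = 0.
Proof.
move=> ab cd dH; have cH : continuous_on_rect H a b c d.
  by move=> z /dH/cderivable_continuous.
apply/eqP; rewrite -cabs_eq0 eq_le cabs_ge0 andbT.
apply: (@le0_of_eps _ (((b - a) + (d - c)) ^+ 2)) => [|e e0]; first exact: sqr_ge0.
pose P a' b' c' d' := a <= a' -> b' <= b -> c <= c' -> d' <= d ->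
  cabs (rect_integral H a' b' c' d') <= e * ((b' - a') + (d' - c')) ^+ 2.
suff: P a b c d by apply.
apply: rect_ind => //.
- move=> {}a' {}b' {}c' {}d' ab' cd'.
  set m := (a' + b') / 2; set n := (c' + d') / 2 => Pld Prd Plu Pru aa bb cc dd.
  rewrite (@rect_integral_quarters _ m n); last exact: continuous_on_subrect cH.
  + have -> : e * (b' - a' + (d' - c')) ^+ 2 =
      (e * (m - a' + (n - c')) ^+ 2 + e * (b' - m + (n - c')) ^+ 2) +
      (e * (m - a' + (d' - n)) ^+ 2 + e * (b' - m + (d' - n)) ^+ 2).
      by rewrite /m /n; field.
    by rewrite (le_trans (le_cabsD _ _)) // lerD // (le_trans (le_cabsD _ _)) // lerD //;
      [apply: Pld|apply: Prd|apply: Plu|apply: Pru]; rewrite /m /n; lra.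
  + by rewrite /m; lra.
  + by rewrite /n; lra.
- move=> x y xab ycd; have /derivableP dHp := dH (x +i* y)%C (conj xab ycd).
  have [r r0 rP] := is_cderive_rect_integral dHp e0.
  exists r => // a' b' c' d' aa /andP[ax xb] bb cc /andP[cy yd] dd br dr _ _ _ _.
  apply: rP => //; [lra|lra| |exact: continuous_on_subrect cH].
  by split; apply/andP; split.
Qed.

End Goursat.

Section PeriodIntegral.
Variable R : realType.
Implicit Types (H : R[i] -> R[i]) (z : R[i]) (rho u v M : R).
Local Notation leb := (@lebesgue_measure R).
Local Notation pi2 := (pi *+ 2 : R).

Lemma pi2_gt0 : 0 < pi2.
Proof. by rewrite mulrn_wgt0 // pi_gt0. Qed.

Definition period_integral H rho := itv_integral 0 pi2 (fun y => H (rho +i* y)%C).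

Lemma le_cabs_period_integral H rho M :
  (forall z, complex.Re z = rho -> {for z, continuous (H : Cn R -> Cn R)}) ->
  (forall z, complex.Re z = rho -> cabs (H z) <= M) ->
  cabs (period_integral H rho) <= M * pi2.
Proof.
move=> cH HM; rewrite -[X in _ * X]subr0; apply: le_cabs_itv_integral; first exact: ltW pi2_gt0.
  by apply: continuous_itv_cintegrable => y _; apply: continuous_vertical_comp; exact: cH.
by move=> y _; exact: HM.
Qed.

Lemma period_integral_const H rho1 rho2 : rho1 <= rho2 ->
  (forall z, H (z + pi2*i%C) = H z) ->
  (forall z, rho1 <= complex.Re z <= rho2 -> cderivable H z) ->
  period_integral H rho1 = period_integral H rho2.
Proof.
move=> r12 per dH.
have := goursat r12 (ltW pi2_gt0) (fun z zr => dH z zr.1).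
have perE x : H (x +i* pi2)%C = H (x +i* 0)%C.
  by rewrite -(per (x +i* 0)%C); congr H; apply: complex_ext; rewrite /= ?addr0 ?add0r.
rewrite /rect_integral (_ : (fun x => H (x +i* pi2)%C) = (fun x => H (x +i* 0)%C));
  last exact/funext.
rewrite subrr add0r => /eqP; rewrite mulf_eq0 subr_eq0 => /orP[|/eqP //].
by rewrite -cabs_eq0 cabs_i oner_eq0.
Qed.

Lemma period_integral_continuous H u v M rho : u < rho < v ->
  (forall z, u < complex.Re z < v -> {for z, continuous (H : Cn R -> Cn R)}) ->
  (forall z, u < complex.Re z < v -> cabs (H z) <= M) ->
  {for rho, continuous (period_integral H : R -> Cn R)}.
Proof.
move=> uv cH HM.
have component (p : R[i] -> R) : (forall z, `|p z| <= cabs z) ->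
    (forall (phi : R -> R[i]) t, {for t, continuous (phi : R -> Cn R)} ->
      {for t, continuous (fun s => p (phi s))}) ->
    {for rho, continuous (fun l => \int[leb]_(y in `[0, pi2]) p (H (l +i* y)%C))}.
  move=> ple pc.
  apply: (@continuity_under_integral _ _ _ leb (fun l y => p (H (l +i* y)%C)) _ _ u v _ _
    (fun=> M)).
  - exact: measurable_itv.
  - move=> l /=; rewrite in_itv /= => luv.
    apply: continuous_compact_integrable; first exact: segment_compact.
    apply: continuous_subspaceT => y; apply: pc.
    by apply: continuous_vertical_comp; exact: cH.
  - apply: aeW => y _ l; rewrite inE /= in_itv /= => luv.
    by apply: pc; apply: continuous_horizontal_comp; exact: cH.
  - apply: continuous_compact_integrable; first exact: segment_compact.
    by apply: continuous_subspaceT => y; exact: cvg_cst.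
  - move=> l /=; rewrite in_itv /= => luv; apply: aeW => y _.
    by rewrite (le_trans (ple _)) // HM.
  - by rewrite inE /= in_itv.
have /cvgrPdist_le cR := component _ (@normr_Re_le R) (fun phi t => @continuous_Re R _ phi t).
have /cvgrPdist_le cI := component _ (@normr_Im_le R) (fun phi t => @continuous_Im R _ phi t).
apply/cvg_cabsP => e e0; near=> l.
rewrite (le_trans (cabs_le_ReIm _)) // ReD ImD ReN ImN [e]splitr lerD //= distrC.
- by near: l; apply: cR; rewrite divr_gt0.
- by near: l; apply: cI; rewrite divr_gt0.
Unshelve. all: by end_near. Qed.

Lemma piecewise_const_continuous (g : R -> R[i]) (x0 B : R) : x0 < B ->
  {for x0, continuous (g : R -> Cn R)} ->
  (forall a b, a <= b < B -> ~~ (a <= x0 <= b) -> g a = g b) ->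
  forall a, a < B -> g a = g x0.
Proof.
move=> x0B /cvg_cabsP cg gconst a aB; apply/eqP; rewrite -subr_eq0 -cabs_eq0 eq_le cabs_ge0 andbT.
apply: (@le0_of_eps _ _ 1) => // e e0; rewrite mulr1.
have /nbhs_ballP[d /= d0 gd] := cg e e0.
have [ax|xa|->] := ltgtP a x0; last by rewrite subrr cabs0 ltW.
- pose b := Num.max a (x0 - d / 2).
  have bx : b < x0 by rewrite gt_max ax; lra.
  have bd : x0 - d / 2 <= b by rewrite le_max lexx orbT.
  rewrite (gconst a b); first by apply: gd; rewrite /ball /= ger0_norm; lra.
    by rewrite le_max lexx (lt_trans bx).
  by rewrite negb_and -!ltNge bx orbT.
- pose b := Num.min a (x0 + d / 2).
  have bx : x0 < b by rewrite lt_min xa; lra.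
  have bd : b <= x0 + d / 2 by rewrite ge_min lexx orbT.
  rewrite -(gconst b a); first by apply: gd; rewrite /ball /= ler0_norm; lra.
    by rewrite ge_min lexx.
  by rewrite negb_and -!ltNge bx.
Qed.

End PeriodIntegral.

Section Circle.
Variable R : realType.
Implicit Types (F G K : R[i] -> R[i]) (z w k : R[i]) (r M : R).
Local Notation leb := (@lebesgue_measure R).
Local Notation pi2 := (pi *+ 2 : R).

Definition circ r (t : R) : R[i] := cexp (ln r +i* t)%C.

Definition circle_integral r G := itv_integral 0 pi2 (fun t => G (circ r t)).

Lemma circ_neq0 r t : circ r t != 0.
Proof. exact: cexp_neq0. Qed.

Lemma cabs_circ r t : 0 < r -> cabs (circ r t) = r.
Proof. by move=> r0; rewrite cabs_cexp /= lnK ?posrE. Qed.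

Lemma circ_sub_neq0 r w t : cabs w < r -> circ r t - w != 0.
Proof.
move=> wr; rewrite subr_eq0; apply: contraTneq wr => <-.
have [r0|r0] := ltP 0 r; first by rewrite cabs_circ // ltxx.
by rewrite -leNgt (le_trans r0) ?cabs_ge0.
Qed.

Lemma circle_cintegrable r G :
  (forall t, {for circ r t, continuous (G : Cn R -> Cn R)}) ->
  cintegrable leb `[0, pi2] (fun t => G (circ r t)).
Proof.
move=> cG; apply: continuous_itv_cintegrable => t _.
apply: (continuous_vertical_comp (f := fun z => G (cexp z))).
exact: (continuous_comp (@continuous_cexp _ _) (cG t)).
Qed.

Lemma le_cabs_circle_integral r G M :
  (forall t, {for circ r t, continuous (G : Cn R -> Cn R)}) ->
  (forall t, cabs (G (circ r t)) <= M) -> cabs (circle_integral r G) <= M * pi2.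
Proof.
move=> cG GM; rewrite -[X in _ * X]subr0; apply: le_cabs_itv_integral.
- exact: ltW (pi2_gt0 R).
- exact: circle_cintegrable.
- by move=> t _; exact: GM.
Qed.

(* The logarithm turns circles around 0 into vertical segments, so the integral of
   [K dz] over a circle does not depend on the radius and vanishes in the limit. *)
Lemma circle_integral_eq0 K w (rmax M r : R) : 0 < r < rmax -> cabs w < rmax ->
  (forall z, cabs z < rmax -> {for z, continuous (K : Cn R -> Cn R)}) ->
  (forall z, cabs z < rmax -> cabs (K z) <= M) ->
  (forall z, cabs z < rmax -> z != w -> cderivable K z) ->
  circle_integral r (fun z => K z * z) = 0.
Proof.
move=> /andP[r0 rR] wR cK KM dK; have rmax_gt0 := lt_trans r0 rR.
pose H z : R[i] := K (cexp z) * cexp z.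
have in_disc z : complex.Re z < ln rmax -> cabs (cexp z) < rmax.
  by rewrite cabs_cexp -ltr_expR lnK.
have cH z : complex.Re z < ln rmax -> {for z, continuous (H : Cn R -> Cn R)}.
  move=> /in_disc /cK cKz; have ce := @continuous_cexp R z.
  exact: (cvgM (continuous_comp ce cKz) ce).
have HM z : complex.Re z < ln rmax -> cabs (H z) <= M * expR (complex.Re z).
  by move=> /in_disc /KM KzM; rewrite cabsM cabs_cexp ler_wpM2r ?expR_ge0.
have M0 : 0 <= M by rewrite (le_trans (cabs_ge0 _) (KM 0 _)) // cabs0.
have [x0 x0R wx0] : exists2 x0 : R, x0 < ln rmax & forall z, cexp z = w -> complex.Re z = x0.
  have [->|w0] := eqVneq w 0.
    by exists (ln r) => [|z /eqP]; [rewrite ltr_ln | rewrite (negbTE (cexp_neq0 z))].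
  exists (ln (cabs w)) => [|z <-]; first by rewrite ltr_ln ?posrE ?cabs_gt0.
  by rewrite cabs_cexp expRK.
have const a : a < ln rmax -> period_integral H a = period_integral H x0.
  apply: (@piecewise_const_continuous _ (period_integral H) x0 (ln rmax) x0R).
    apply: (@period_integral_continuous _ H (x0 - 1) (ln rmax) (M * rmax)).
    - by rewrite x0R andbT; lra.
    - by move=> z /andP[_]; exact: cH.
    - move=> z /andP[_ zR]; rewrite (le_trans (HM z zR)) // ler_wpM2l //.
      by rewrite -[leRHS]lnK ?posrE // ler_expR ltW.
  move=> p q /andP[pq qR] pxq; apply: period_integral_const => // z.
    by rewrite /H cexp_periodic.
  move=> pzq; have /andP[_ zq] := pzq; have zR := le_lt_trans zq qR.
  have cw : cexp z != w by apply: contraNneq pxq => /wx0 <-.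
  have ce := @cderivable_cexp R z.
  exact: cderivableM (cderivable_comp ce (dK _ (in_disc _ zR) cw)) ce.
rewrite -[LHS]/(period_integral H (ln r)).
apply/eqP; rewrite -cabs_eq0 eq_le cabs_ge0 andbT.
apply: (@le0_of_eps _ _ (M * pi2)) => [|e e0].
  by rewrite mulr_ge0 // ltW // pi2_gt0.
have rho_lt : Num.min (ln r) (ln e) < ln rmax by rewrite gt_min ltr_ln // rR.
rewrite (const (ln r)) ?ltr_ln // -(const _ rho_lt) mulrA (mulrC e).
apply: le_cabs_period_integral => z zrho; first by apply: cH; rewrite zrho.
rewrite (le_trans (HM _ _)) ?zrho // ler_wpM2l // -[leRHS]lnK ?posrE // ler_expR.
by rewrite ge_min lexx orbT.
Qed.

Lemma circle_integralB r F G :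
  (forall t, {for circ r t, continuous (F : Cn R -> Cn R)}) ->
  (forall t, {for circ r t, continuous (G : Cn R -> Cn R)}) ->
  circle_integral r (fun z => F z - G z) = circle_integral r F - circle_integral r G.
Proof.
move=> cF cG; rewrite /circle_integral /itv_integral.
by rewrite (cintegralB _ (circle_cintegrable cF) (circle_cintegrable cG)).
Qed.

Lemma circle_integralZl r k G : (forall t, {for circ r t, continuous (G : Cn R -> Cn R)}) ->
  circle_integral r (fun z => k * G z) = k * circle_integral r G.
Proof.
move=> cG; rewrite /circle_integral /itv_integral.
by rewrite (cintegralZl _ k (circle_cintegrable cG)).
Qed.

Lemma cderivable_cauchy_kernel w z : z - w != 0 -> cderivable (fun z => z / (z - w)) z.
Proof.
have dzw := cderivableB (@cderivable_id R z) (@cderivable_cst R w z).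
by move=> zw; exact: cderivableM (@cderivable_id R z) (cderivableV dzw zw).
Qed.

Lemma circle_winding w r : cabs w < r ->
  circle_integral r (fun z => z / (z - w)) = pi2%:C%C.
Proof.
move=> wr; have r0 := le_lt_trans (cabs_ge0 w) wr.
pose H z : R[i] := cexp z / (cexp z - w).
have cw_gt0 z : ln r <= complex.Re z -> 0 < expR (complex.Re z) - cabs w.
  by move=> rz; rewrite subr_gt0 (lt_le_trans wr) // -[leLHS]lnK ?posrE // ler_expR.
have cw0 z : ln r <= complex.Re z -> cexp z - w != 0.
  move=> /cw_gt0 zw; rewrite -cabs_gt0 (lt_le_trans zw) //.
  by rewrite -cabs_cexp lerB_cabs.
have dH z : ln r <= complex.Re z -> cderivable H z.
  have ce := @cderivable_cexp R z; move=> /cw0 zw.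
  exact: cderivableM ce (cderivableV (cderivableB ce (@cderivable_cst R w z)) zw).
have cH z : ln r <= complex.Re z -> {for z, continuous (H : Cn R -> Cn R)}.
  by move=> /dH/cderivable_continuous.
apply/eqP; rewrite -subr_eq0 -cabs_eq0 eq_le cabs_ge0 andbT.
apply: (@le0_of_eps _ _ pi2) => [|e e0]; first exact: ltW (pi2_gt0 R).
pose T := Num.max r (cabs w * (1 + e^-1)).
have T0 : 0 < T by rewrite lt_max r0.
have rT : ln r <= ln T by rewrite ler_ln ?posrE // le_max lexx.
rewrite -[circle_integral _ _]/(period_integral H (ln r)).
rewrite (period_integral_const rT) => [|z|z /andP[rz _]].
- have wT : cabs w < T by rewrite lt_max wr.
  rewrite -[period_integral _ _]/(circle_integral T (fun z => z / (z - w))).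
  have -> : pi2%:C%C = circle_integral T (fun=> 1).
    by rewrite /circle_integral itv_integral_cst ?(ltW (pi2_gt0 R)) // subr0 mul1r.
  have cG t : {for circ T t, continuous ((fun z => z / (z - w)) : Cn R -> Cn R)}.
    exact: cderivable_continuous (cderivable_cauchy_kernel (circ_sub_neq0 t wT)).
  have c1 t : {for circ T t, continuous ((fun=> 1) : Cn R -> Cn R)}.
    exact: cderivable_continuous (@cderivable_cst R 1 _).
  rewrite -(circle_integralB cG c1); apply: le_cabs_circle_integral => t.
    exact: (cvgB (cG t) (c1 t)).
  have zw := circ_sub_neq0 t wT.
  have -> : circ T t / (circ T t - w) - 1 = w / (circ T t - w) by field.
  rewrite cabsM cabsV ler_pdivrMr ?cabs_gt0 //.
  apply: le_trans (ler_wpM2l (ltW e0) (lerB_cabs _ _)); rewrite cabs_circ // mulrBr.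
  have /(ler_wpM2l (ltW e0)) : cabs w * (1 + e^-1) <= T by rewrite le_max lexx orbT.
  rewrite (_ : e * (cabs w * _) = e * cabs w + cabs w); first by lra.
  by field; rewrite gt_eqF.
- by rewrite /H cexp_periodic.
- exact: dH.
Qed.

Section DifferenceQuotient.
Variables (F : R[i] -> R[i]) (w : R[i]) (rmax M : R).
Hypotheses (wR : cabs w < rmax) (dF : forall z, cabs z < rmax -> cderivable F z).
Hypothesis FM : forall z, cabs z < rmax -> cabs (F z) <= M.

Definition difference_quotient z : R[i] :=
  if z == w then 'D_1 (F : Cn R -> Cn R) (w : Cn R) else (F z - F w) / (z - w).

Lemma difference_quotient_near e : 0 < e -> exists2 d : R, 0 < d & forall z, cabs (z - w) < d ->
  cabs (difference_quotient z - difference_quotient w) <= e.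
Proof.
move=> e0; have /derivableP/is_cderiveP/(_ e e0)[d d0 dP] := dF wR; exists d => // z zd.
rewrite /difference_quotient eqxx; case: eqVneq => [_|zw]; first by rewrite subrr cabs0 ltW.
have zw0 : z - w != 0 by rewrite subr_eq0.
have := dP _ zd; rewrite (addrC w) subrK.
move: ('D_1 (F : Cn R -> Cn R) (w : Cn R) : R[i]) => l Fzw.
have -> : (F z - F w) / (z - w) - l = (F z - F w - l * (z - w)) / (z - w) by field.
by rewrite cabsM cabsV ler_pdivrMr // cabs_gt0.
Qed.

Lemma cderivable_difference_quotient z : cabs z < rmax -> z != w ->
  cderivable difference_quotient z.
Proof.
move=> zR zw; have zw0 : z - w != 0 by rewrite subr_eq0.
apply: (@near_eq_cderivable _ (fun v => (F v - F w) / (v - w))).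
  apply/nbhs_cabsP; exists (cabs (z - w)) => [|v vz]; first by rewrite cabs_gt0.
  by rewrite /difference_quotient ifN //; apply: contraTneq vz => ->; rewrite cabs_distC ltxx.
apply: cderivableM; first exact: cderivableB (dF zR) (@cderivable_cst R (F w) z).
exact: cderivableV (cderivableB (@cderivable_id R z) (@cderivable_cst R w z)) zw0.
Qed.

Lemma difference_quotient_continuous z : cabs z < rmax ->
  {for z, continuous (difference_quotient : Cn R -> Cn R)}.
Proof.
move=> zR; have [->|zw] := eqVneq z w.
  by apply/continuous_cabsP => e; exact: difference_quotient_near.
exact: cderivable_continuous (cderivable_difference_quotient zR zw).
Qed.

Lemma difference_quotient_bounded : exists C : R, forall z, cabs z < rmax ->
  cabs (difference_quotient z) <= C.
Proof.
have M0 : 0 <= M by rewrite (le_trans (cabs_ge0 _) (FM wR)).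
have [d d0 dP] := difference_quotient_near ltr01; set L := difference_quotient w in dP.
have Md : 0 <= (M + M) / d by rewrite divr_ge0 ?(ltW d0) ?addr_ge0.
exists (1 + cabs L + (M + M) / d) => z zR; have [near_w|far] := ltP (cabs (z - w)) d.
  by have := dP z near_w; have := lerB_cabs (difference_quotient z) L; lra.
suff : cabs (difference_quotient z) <= (M + M) / d by have := cabs_ge0 L; lra.
have zw : z != w by apply: contraTneq far => ->; rewrite subrr cabs0 -ltNge.
rewrite /difference_quotient ifN // cabsM cabsV ler_pM ?invr_ge0 ?cabs_ge0 //.
  by rewrite (le_trans (le_cabsB _ _)) // lerD // FM.
by rewrite lef_pV2 ?posrE // cabs_gt0 subr_eq0.
Qed.

End DifferenceQuotient.

Lemma cauchy_formula F w (rmax M r : R) : cabs w < r < rmax ->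
  (forall z, cabs z < rmax -> cderivable F z) -> (forall z, cabs z < rmax -> cabs (F z) <= M) ->
  circle_integral r (fun z => F z * (z / (z - w))) = F w * pi2%:C%C.
Proof.
move=> /andP[wr rR] dF FM; have r0 := le_lt_trans (cabs_ge0 w) wr.
have wR := lt_trans wr rR; have [C quotC] := difference_quotient_bounded wR dF FM.
have zw t := circ_sub_neq0 t wr.
have cker t := cderivable_continuous (cderivable_cauchy_kernel (zw t)).
have cF t : {for circ r t, continuous (F : Cn R -> Cn R)}.
  by apply: cderivable_continuous; apply: dF; rewrite cabs_circ.
have cFker t : {for circ r t, continuous ((fun z => F z * (z / (z - w))) : Cn R -> Cn R)}.
  exact: (cvgM (cF t) (cker t)).
have cFwker t : {for circ r t, continuous ((fun z => F w * (z / (z - w))) : Cn R -> Cn R)}.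
  exact: (cvgM (cvg_cst _) (cker t)).
rewrite -(circle_winding wr) -(circle_integralZl _ cker); apply/eqP; rewrite -subr_eq0.
have r0R : 0 < r < rmax by rewrite r0.
apply/eqP; rewrite -(circle_integralB cFker cFwker).
rewrite -[RHS](circle_integral_eq0 r0R wR (difference_quotient_continuous wR dF) quotC
  (cderivable_difference_quotient dF)).
apply: eq_cintegral => t _; rewrite /difference_quotient ifN; last by rewrite -subr_eq0 zw.
by have := zw t; move: (circ r t) => v vw; field.
Qed.

Lemma geom_kernel_expansion (u w : R[i]) n : u != 0 -> u - w != 0 ->
  u / (u - w) = \sum_(k < n) w ^+ k * u^-1 ^+ k + (w / u) ^+ n * (u / (u - w)).
Proof.
move=> u0 uw; elim: n => [|n IH]; first by rewrite big_ord0 add0r expr0 mul1r.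
rewrite {1}IH big_ord_recr /= -addrA; congr (_ + _).
by rewrite exprS exprMn; field; rewrite uw.
Qed.

Definition taylor_coef F r (k : nat) : R[i] :=
  pi2%:C%C^-1 * circle_integral r (fun z => F z * z^-1 ^+ k).

Lemma cabs_pi2V : cabs (pi2%:C%C^-1 : R[i]) = pi2^-1.
Proof. by rewrite cabsV cabs_real ger0_norm // ltW // pi2_gt0. Qed.

Section Taylor.
Variables (F : R[i] -> R[i]) (rmax M r : R).
Hypotheses (r0 : 0 < r) (rR : r < rmax).
Hypothesis dF : forall z, cabs z < rmax -> cderivable F z.
Hypothesis FM : forall z, cabs z < rmax -> cabs (F z) <= M.

Let dF_circ t : cderivable F (circ r t).
Proof. by apply: dF; rewrite cabs_circ. Qed.

Let FM_circ t : cabs (F (circ r t)) <= M.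
Proof. by apply: FM; rewrite cabs_circ. Qed.

Let coef_continuous (k : nat) t :
  {for circ r t, continuous ((fun z => F z * z^-1 ^+ k) : Cn R -> Cn R)}.
Proof.
have dV := cderivableV (@cderivable_id R (circ r t)) (circ_neq0 r t).
have dG := cderivableM (@dF_circ t) (cderivableX (n := k) dV).
exact: cderivable_continuous dG.
Qed.

Lemma cabs_taylor_coef (k : nat) : cabs (taylor_coef F r k) <= M / r ^+ k.
Proof.
rewrite cabsM cabs_pi2V ler_pdivrMl ?pi2_gt0 // mulrC.
apply: le_cabs_circle_integral => t; first exact: coef_continuous.
rewrite cabsM cabsX cabsV cabs_circ // exprVn ler_wpM2r ?FM_circ //.
by rewrite invr_ge0 exprn_ge0 // ltW.
Qed.

Lemma taylor_remainder n w : cabs w < r ->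
  cabs (F w - \sum_(k < n) taylor_coef F r k * w ^+ k) <=
  M * ((cabs w / r) ^+ n * (r / (r - cabs w))).
Proof.
move=> wr; have wrR : cabs w < r < rmax by rewrite wr.
pose rem z : R[i] := F z * ((w / z) ^+ n * (z / (z - w))).
have zw t := circ_sub_neq0 t wr.
have crem t : {for circ r t, continuous (rem : Cn R -> Cn R)}.
  have dV := cderivableV (@cderivable_id R (circ r t)) (circ_neq0 r t).
  have dX := cderivableX (n := n) (cderivableM (@cderivable_cst R w (circ r t)) dV).
  have dker := cderivable_cauchy_kernel (zw t).
  have drem := cderivableM (@dF_circ t) (cderivableM dX dker).
  exact: cderivable_continuous drem.
have expand : F w * pi2%:C%C =
    \sum_(k < n) w ^+ k * circle_integral r (fun z => F z * z^-1 ^+ k) + circle_integral r rem.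
  have coefi (k : 'I_n) : cintegrable leb `[0, pi2]
      (fun t => w ^+ k * (F (circ r t) * (circ r t)^-1 ^+ k)).
    apply: cintegrableZl; first exact: measurable_itv.
    exact: (circle_cintegrable (@coef_continuous k)).
  rewrite -(cauchy_formula wrR dF FM).
  under eq_bigr => k _ do rewrite -(circle_integralZl _ (@coef_continuous k)).
  rewrite -cintegral_sum // -cintegralD //; first last.
  - exact: circle_cintegrable.
  - exact: cintegrable_sum.
  apply: eq_cintegral => t _; rewrite {1}(@geom_kernel_expansion _ w n) ?circ_neq0 //.
  rewrite mulrDr mulr_sumr; congr (_ + _); apply: eq_bigr => k _; ring.
have pC0 : pi2%:C%C != 0 :> R[i] by rewrite -cabs_gt0 cabs_real normr_gt0 gt_eqF ?pi2_gt0.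
have -> : F w - \sum_(k < n) taylor_coef F r k * w ^+ k = pi2%:C%C^-1 * circle_integral r rem.
  rewrite -[F w](mulfK pC0) expand mulrC mulrDr mulr_sumr addrAC.
  rewrite -sumrB big1 ?add0r // => k _; rewrite /taylor_coef; ring.
rewrite cabsM cabs_pi2V ler_pdivrMl ?pi2_gt0 // mulrC; apply: le_cabs_circle_integral => // t.
rewrite /rem !cabsM cabsX cabsM !cabsV cabs_circ // ler_pM ?cabs_ge0 ?FM_circ //.
  by rewrite !mulr_ge0 ?exprn_ge0 ?mulr_ge0 ?invr_ge0 ?cabs_ge0 // ltW.
rewrite ler_wpM2l ?exprn_ge0 ?divr_ge0 ?cabs_ge0 ?(ltW r0) // ler_wpM2l ?(ltW r0) //.
rewrite lef_pV2 ?posrE ?subr_gt0 // ?cabs_gt0 //.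
by rewrite (le_trans _ (lerB_cabs _ _)) // cabs_circ.
Qed.

End Taylor.

End Circle.

Section DiscEstimates.
Variable R : realType.
Implicit Types (F f h : R[i] -> R[i]) (z w v l : R[i]) (M a q C e : R).

Definition bounded_holo_on (D : set R[i]) M F :=
  forall z, D z -> cderivable F z /\ cabs (F z) <= M.

Definition cdisc z a : set R[i] := [set v | cabs (v - z) < a].

Lemma cdisc_center z a : 0 < a -> cdisc z a z.
Proof. by rewrite /cdisc /= subrr cabs0. Qed.

(* Locked because [lra] would otherwise compare derivatives by unfolding limits. *)
Definition cderiv : (R[i] -> R[i]) -> R[i] -> R[i] :=
  locked (fun f z => 'D_1 (f : Cn R -> Cn R) (z : Cn R)).

Lemma cderivE f z : cderiv f z = 'D_1 (f : Cn R -> Cn R) (z : Cn R).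
Proof. by rewrite /cderiv -lock. Qed.

Lemma is_cderive_cderiv f z : cderivable f z -> is_cderive z f (cderiv f z).
Proof. by move=> df; rewrite cderivE; exact/derivableP. Qed.

Lemma is_cderive_val f z l : is_cderive z f l -> cderiv f z = l.
Proof. by move=> df; rewrite cderivE; exact: derive_val. Qed.

Lemma exprn_mul_small q C e : 0 <= q < 1 -> 0 <= C -> 0 < e -> exists n, q ^+ n * C <= e.
Proof.
move=> /andP[q0 q1] C0 e0.
have qn1 : `|q| < 1 by rewrite ger0_norm.
have /cvgrPdist_le/(_ (e / (C + 1)))[|n _ /(_ n (leqnn n))] := cvg_expr qn1.
  by rewrite divr_gt0 // ltr_wpDl.
rewrite sub0r normrN ger0_norm ?exprn_ge0 // ler_pdivlMr ?ltr_wpDl // => qn.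
by exists n; apply: le_trans qn; rewrite ler_wpM2l ?exprn_ge0 // lerDl.
Qed.

Lemma quadratic_is_cderive F z l (a K : R) : 0 < a -> 0 <= K ->
  (forall w, cabs w <= a -> cabs (F (z + w) - F z - l * w) <= K * cabs w ^+ 2) ->
  is_cderive z F l.
Proof.
move=> a0 K0 FK; apply/is_cderiveP => e e0.
exists (Num.min a (e / (K + 1))); first by rewrite lt_min a0 divr_gt0 // ltr_wpDl.
move=> w; rewrite lt_min ltr_pdivlMr ?ltr_wpDl // => /andP[wa we].
rewrite (le_trans (FK w (ltW wa))) // expr2 mulrA ler_wpM2r ?cabs_ge0 //.
by have := cabs_ge0 w; move: we; rewrite mulrDr; lra.
Qed.

Lemma bounded_holo_on_ge0 z a M F : 0 < a -> bounded_holo_on (cdisc z a) M F -> 0 <= M.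
Proof. by move=> a0 /(_ z (cdisc_center z a0))[_]; apply: le_trans; exact: cabs_ge0. Qed.

Lemma disc_expansion F z a M : 0 < a -> bounded_holo_on (cdisc z a) M F ->
  exists2 l, cabs l <= 2 * M / a & forall w, cabs w <= a / 4 ->
    cabs (F (z + w) - F z - l * w) <= 8 * M / a ^+ 2 * cabs w ^+ 2.
Proof.
move=> a0 FM; have M0 := bounded_holo_on_ge0 a0 FM.
pose G v : R[i] := F (v + z).
have in_disc v : cabs v < a -> cdisc z a (v + z) by rewrite /cdisc /= addrK.
have dG v : cabs v < a -> cderivable G v.
  move=> /in_disc/FM[dF _].
  exact: cderivable_comp (cderivableD (@cderivable_id R v) (@cderivable_cst R z v)) dF.
have GM v : cabs v < a -> cabs (G v) <= M by move=> /in_disc/FM[].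
have r0 : 0 < a / 2 by rewrite divr_gt0.
have ra : a / 2 < a by lra.
have coef0 : taylor_coef G (a / 2) 0 = F z.
  have := taylor_remainder r0 ra dG GM 1; move=> /(_ 0).
  rewrite cabs0 => /(_ r0); rewrite big_ord1 expr0 mulr1 mul0r expr1 mul0r mulr0.
  rewrite /G add0r => Fz; apply/eqP; rewrite eq_sym -subr_eq0 -cabs_eq0 eq_le cabs_ge0.
  by rewrite Fz.
exists (taylor_coef G (a / 2) 1) => [|w wa].
  have := cabs_taylor_coef r0 ra dG GM 1; rewrite expr1 => /le_trans; apply.
  by rewrite le_eqVlt; apply/orP; left; apply/eqP; field; rewrite gt_eqF.
have w0 := cabs_ge0 w; have wr : cabs w < a / 2 by lra.
have := taylor_remainder r0 ra dG GM 2 wr.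
rewrite big_ord_recr big_ord1 /= expr0 mulr1 coef0 expr1 opprD addrA /G (addrC w).
move=> /le_trans; apply; rewrite expr_div_n.
have -> : 8 * M / a ^+ 2 * cabs w ^+ 2 = M * (cabs w ^+ 2 / (a / 2) ^+ 2 * 2).
  by field; rewrite gt_eqF.
rewrite ler_wpM2l // ler_wpM2l ?divr_ge0 ?exprn_ge0 ?(ltW r0) //.
by rewrite ler_pdivrMr; lra.
Qed.

Lemma cauchy_estimate F z a M : 0 < a -> bounded_holo_on (cdisc z a) M F ->
  cabs (cderiv F z) <= 2 * M / a /\ forall w, cabs w <= a / 4 ->
    cabs (F (z + w) - F z - cderiv F z * w) <= 8 * M / a ^+ 2 * cabs w ^+ 2.
Proof.
move=> a0 FM; have M0 := bounded_holo_on_ge0 a0 FM.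
have [l l_le Fl] := disc_expansion a0 FM.
rewrite (is_cderive_val (quadratic_is_cderive _ _ Fl)) ?divr_gt0 //.
by rewrite divr_ge0 ?mulr_ge0 ?exprn_ge0 ?(ltW a0).
Qed.

Lemma cderiv_lipschitz F z w a M : 0 < a ->
  bounded_holo_on (cdisc z a) M F -> bounded_holo_on (cdisc w a) M F ->
  cabs (cderiv F z - cderiv F w) <= 16 * M / a ^+ 2 * cabs (z - w).
Proof.
move=> a0 Fz Fw; have M0 := bounded_holo_on_ge0 a0 Fz.
have [dz Ez] := cauchy_estimate a0 Fz; have [dw Ew] := cauchy_estimate a0 Fw.
have [->|zw] := eqVneq z w; first by rewrite !subrr cabs0 mulr0.
have k0 : 0 < cabs (z - w) by rewrite cabs_gt0 subr_eq0.
have [far|near_z] := ltP (a / 4) (cabs (z - w)).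
  rewrite (le_trans (le_cabsB _ _)) // (le_trans (lerD dz dw)) //.
  have -> : 2 * M / a + 2 * M / a = 16 * M / a ^+ 2 * (a / 4) by field; rewrite gt_eqF.
  by rewrite ler_wpM2l ?(ltW far) // divr_ge0 ?mulr_ge0 ?exprn_ge0 ?(ltW a0).
have := Ez (w - z); rewrite (cabs_distC w) (addrC z (w - z)) subrK => /(_ near_z) {}Ez.
have := Ew (z - w); rewrite (addrC w) subrK => /(_ near_z) {}Ew.
rewrite -(ler_pM2r k0) -cabsM.
have -> : (cderiv F z - cderiv F w) * (z - w) =
    (F w - F z - cderiv F z * (w - z)) + (F z - F w - cderiv F w * (z - w)) by ring.
rewrite (le_trans (le_cabsD _ _)) // (le_trans (lerD Ez Ew)) //.
by rewrite le_eqVlt; apply/orP; left; apply/eqP; ring.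
Qed.

Lemma cderiv_continuous F z a M : 0 < a -> bounded_holo_on (cdisc z a) M F ->
  {for z, continuous (cderiv F : Cn R -> Cn R)}.
Proof.
move=> a0 FM; have M0 := bounded_holo_on_ge0 a0 FM; have a2 : 0 < a / 2 by rewrite divr_gt0.
have subdisc w : cabs (w - z) < a / 2 -> bounded_holo_on (cdisc w (a / 2)) M F.
  move=> wz v vw; apply: FM; rewrite /cdisc /= in vw *.
  by have := cabs_distD w v z; lra.
pose L := 16 * M / (a / 2) ^+ 2; have L0 : 0 <= L by rewrite /L divr_ge0 ?sqr_ge0 // mulr_ge0.
apply/continuous_cabsP => e e0.
exists (Num.min (a / 2) (e / (L + 1))) => [|w]; first by rewrite lt_min a2 divr_gt0 ?ltr_wpDl.
rewrite lt_min => /andP[wza]; rewrite ltr_pdivlMr ?ltr_wpDl // mulrDr mulr1 => wze.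
have zz : cabs (z - z) < a / 2 by rewrite subrr cabs0.
rewrite (le_trans (cderiv_lipschitz a2 (subdisc w wza) (subdisc z zz))) // -/L mulrC.
by have := cabs_ge0 (w - z); lra.
Qed.

Lemma near_eq_cderiv f h z : (\forall w \near (z : Cn R), f w = h w) -> cderiv f z = cderiv h z.
Proof. by move=> fh; rewrite !cderivE; exact: (@near_eq_derive _ (Cn R) (Cn R) f h z 1 fh). Qed.

Lemma cderiv_translate f z v : cderiv (fun w => f (w + v)) z = cderiv f (z + v).
Proof.
rewrite !cderivE /derive; apply: (congr1 (fun g : Cn R -> Cn R => lim (g @ (0 : Cn R)^'))).
apply/funext => h /=.
by rewrite addrA.
Qed.

Lemma cderivDc f z v : cderiv (fun w => f w + v) z = cderiv f z.
Proof.
rewrite !cderivE /derive; apply: (congr1 (fun g : Cn R -> Cn R => lim (g @ (0 : Cn R)^'))).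
apply/funext => h /=.
by rewrite opprD addrACA subrr addr0.
Qed.

End DiscEstimates.

Section VanishingAtInfinity.
Variable R : realType.
Implicit Types (f g F : R[i] -> R[i]) (z w v l : R[i]) (a b c d e : R).

Lemma within_cabsP (D : set R[i]) F :
  {within (D : set (Cn R)), continuous (F : Cn R -> Cn R)} <->
  forall z, D z -> forall e, 0 < e -> exists2 d : R, 0 < d &
    forall w, D w -> cabs (w - z) < d -> cabs (F w - F z) <= e.
Proof.
split=> [/subspace_continuousP cF z Dz e e0|cF].
  have FF : Filter (within D (nbhs (z : Cn R))) by exact: within_filter.
  have /(cvg_cabsP FF)/(_ e e0) := cF z Dz.
  by rewrite near_withinE => /nbhs_cabsP[d d0 dP]; exists d => // w Dw /dP; exact.
apply/subspace_continuousP => z Dz.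
have FF : Filter (within D (nbhs (z : Cn R))) by exact: within_filter.
apply/(cvg_cabsP FF) => e e0; rewrite near_withinE.
by have [d d0 dP] := cF z Dz e e0; apply/nbhs_cabsP; exists d => // w /dP wP /wP.
Qed.

Definition unif_continuous_on (D : set R[i]) F :=
  forall e, 0 < e -> exists2 d : R, 0 < d &
    forall v w, D v -> D w -> cabs (v - w) < d -> cabs (F v - F w) <= e.

Definition vanishes_on (D : set R[i]) F :=
  forall e, 0 < e -> exists M : R, forall z, D z -> M < cabs z -> cabs (F z) <= e.

Lemma rect_unif_continuous F a b c d : a <= b -> c <= d ->
  {within [set z : Cn R | inrect a b c d z], continuous (F : Cn R -> Cn R)} ->
  unif_continuous_on (inrect a b c d) F.
Proof.
move=> ab cd /within_cabsP cF e e0.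
pose close_on a' b' c' d' := exists2 r : R, 0 < r & forall v w,
  inrect a b c d v -> inrect a b c d w -> inrect a' b' c' d' v ->
  cabs (v - w) < r -> cabs (F v - F w) <= e.
suff [r r0 rF] : close_on a b c d by exists r => // v w vD wD; exact: rF.
apply: rect_ind => // [a' b' c' d' ab' cd' [r1 r1_gt0 ld] [r2 r2_gt0 rd] [r3 r3_gt0 lu]
    [r4 r4_gt0 ru]|x y xab ycd].
  exists (Num.min (Num.min r1 r2) (Num.min r3 r4)); first by rewrite !lt_min r1_gt0 r2_gt0 r3_gt0.
  move=> v w vD wD [/andP[va vb] /andP[vc vd]].
  rewrite !lt_min => /andP[/andP[vw1 vw2] /andP[vw3 vw4]].
  have [vl|vr] := leP (complex.Re v) ((a' + b') / 2);
    have [vdown|vup] := leP (complex.Im v) ((c' + d') / 2).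
  - by apply: ld => //; rewrite /inrect va vl vc vdown.
  - by apply: lu => //; rewrite /inrect va vl vd (ltW vup).
  - by apply: rd => //; rewrite /inrect vb (ltW vr) vc vdown.
  - by apply: ru => //; rewrite /inrect vb (ltW vr) vd (ltW vup).
have xyD : inrect a b c d (x +i* y)%C by [].
have e2 : 0 < e / 2 by rewrite divr_gt0.
have [r r0 rF] := cF (x +i* y)%C xyD _ e2.
exists (r / 8); first by rewrite divr_gt0.
move=> a' b' c' d' _ xab' _ _ ycd' _ ab' cd'; exists (r / 4); first by rewrite divr_gt0.
move=> v w vD wD v_sub vw.
have xy_sub : inrect a' b' c' d' (x +i* y)%C by [].
have vxy := inrect_dist v_sub xy_sub.
rewrite (le_trans (cabs_distD (F (x +i* y)%C) _ _)) // [leRHS]splitr lerD //.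
  by apply: rF => //; lra.
rewrite cabs_distC; apply: rF => //.
by have := cabs_distD v w (x +i* y)%C; rewrite (cabs_distC w v); lra.
Qed.

Lemma halfplane_addr z a : 0 <= complex.Re z -> 0 < a -> Cplus (z + a%:C%C).
Proof. by rewrite /Cplus /= ReD /=; lra. Qed.

Lemma cabs_halfplane_addr z a : 0 <= complex.Re z -> 0 <= a -> cabs z <= cabs (z + a%:C%C).
Proof.
case: z => [x y] x0 a0; rewrite complex_addr !cabsE ler_wsqrtr // lerD2r.
by rewrite ler_sqr ?nnegrE ?addr_ge0 // lerDl.
Qed.

Lemma halfplane_unif_continuous F :
  {within [set z : Cn R | 0 <= complex.Re (z : R[i])], continuous (F : Cn R -> Cn R)} ->
  vanishes_on [set z | 0 <= complex.Re z] F ->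
  unif_continuous_on [set z | 0 <= complex.Re z] F.
Proof.
move=> cF vF e e0; have e2 : 0 < e / 2 by rewrite divr_gt0.
have [M0 F_small] := vF _ e2; pose M := Num.max M0 0 + 2.
have M2 : 2 <= M by rewrite lerDr le_max lexx orbT.
have MM0 : M0 <= M - 2 by rewrite addrK le_max lexx.
have cF_rect : {within [set z : Cn R | inrect 0 M (- M) M z], continuous (F : Cn R -> Cn R)}.
  by apply: continuous_subspaceW cF => z [/andP[]].
clearbody M; have [||d d0 dF] := rect_unif_continuous _ _ cF_rect e0; [lra|lra|].
exists (Num.min d 1) => [|v w v0 w0]; first by rewrite lt_min d0 ltr01.
rewrite lt_min => /andP[vwd vw1].
have in_rect z : 0 <= complex.Re z -> cabs z <= M -> inrect 0 M (- M) M z.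
  move=> z0 zM; have := normr_Re_le z; have := normr_Im_le z.
  by move=> /ler_normlP[z1 z2] /ler_normlP[z3 z4]; split; apply/andP; split; lra.
have := lerB_cabs w v; have := lerB_cabs v w; rewrite (cabs_distC w v) => vw wv.
have [zM|Mz] := leP (cabs v) (M - 1).
  by apply: dF => //; apply: in_rect => //; lra.
rewrite (le_trans (le_cabsB _ _)) // [leRHS]splitr lerD //; apply: F_small => //; lra.
Qed.

Lemma complex_cauchy_cvg (u : nat -> R[i]) :
  (forall e, 0 < e -> exists N, forall n m, (N <= n)%N -> (N <= m)%N -> cabs (u n - u m) <= e) ->
  exists l, forall e, 0 < e -> exists N, forall n, (N <= n)%N -> cabs (u n - l) <= e.
Proof.
move=> cauchy.
have real_lim (p : R[i] -> R) : (forall z w, `|p z - p w| <= cabs (z - w)) ->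
    exists l : R, forall e, 0 < e -> exists N, forall n, (N <= n)%N -> `|p (u n) - l| <= e.
  move=> pl; have : cvgn (p \o u).
    apply/cauchy_cvgP; apply: cauchy_exP => e e0.
    have [N NP] := cauchy _ (divr_gt0 e0 (ltr0Sn _ 1)).
    exists (p (u N)); exists N => // n /= Nn; rewrite /ball /=.
    rewrite (le_lt_trans (pl _ _)) // (le_lt_trans (NP _ _ (leqnn N) Nn)) //.
    by rewrite ltr_pdivrMr // ltr_pMr // ltr1n.
  move=> /cvg_ex[l /cvgrPdist_le ul]; exists l => e /ul[N _ NP]; exists N => n /NP.
  by rewrite distrC.
have [x ux] : exists x : R, forall e, 0 < e -> exists N, forall n, (N <= n)%N ->
    `|complex.Re (u n) - x| <= e.
  by apply: real_lim => z w; rewrite -ReN -ReD normr_Re_le.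
have [y uy] : exists y : R, forall e, 0 < e -> exists N, forall n, (N <= n)%N ->
    `|complex.Im (u n) - y| <= e.
  by apply: real_lim => z w; rewrite -ImN -ImD normr_Im_le.
exists (x +i* y)%C => e e0; have e2 : 0 < e / 2 by rewrite divr_gt0.
have [N1 N1P] := ux _ e2; have [N2 N2P] := uy _ e2.
exists (maxn N1 N2) => n; rewrite geq_max => /andP[Nn1 Nn2].
by rewrite (le_trans (cabs_le_ReIm _)) // ReD ImD ReN ImN [leRHS]splitr lerD // ?N1P ?N2P.
Qed.

Lemma unif_continuous_limit f z : unif_continuous_on (@Cplus R) f -> 0 <= complex.Re z ->
  exists l, forall e, 0 < e -> exists2 d : R, 0 < d &
    forall w, Cplus w -> cabs (w - z) < d -> cabs (f w - l) <= e.
Proof.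
move=> cf z0; pose u n := z + (n.+1%:R^-1 : R)%:C%C.
have u_gt0 n : Cplus (u n) by apply: halfplane_addr; rewrite ?invr_gt0.
have uz d : 0 < d -> exists N, forall n, (N <= n)%N -> cabs (u n - z) < d.
  move=> d0; exists (Num.bound d^-1) => n Nn.
  rewrite /u (addrC z) addrK cabs_real ger0_norm ?invr_ge0 //.
  rewrite invf_plt ?posrE // (lt_le_trans (archi_boundP _)) ?invr_ge0 ?(ltW d0) //.
  by rewrite ler_nat ltnW.
have [e e0|l ul] := @complex_cauchy_cvg (fun n => f (u n)).
  have [d d0 df] := cf e e0; have d2 : 0 < d / 2 by rewrite divr_gt0.
  have [N NP] := uz _ d2; exists N => n m Nn Nm; apply: df => //.
  have := NP n Nn; have := NP m Nm; have := cabs_distD z (u n) (u m).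
  by rewrite (cabs_distC z); lra.
exists l => e e0; have e2 : 0 < e / 2 by rewrite divr_gt0.
have [d d0 df] := cf _ e2; have d2 : 0 < d / 2 by rewrite divr_gt0.
have [N1 N1P] := uz _ d2; have [N2 N2P] := ul _ e2; pose n := maxn N1 N2.
exists (d / 2) => // w w0 wz.
rewrite (le_trans (cabs_distD (f (u n)) _ _)) // [leRHS]splitr lerD //.
  apply: df => //; have := N1P n (leq_maxl _ _); have := cabs_distD z w (u n).
  by rewrite (cabs_distC z); lra.
exact: N2P n (leq_maxr _ _).
Qed.

Lemma C0cl_elim f : C0cl f -> unif_continuous_on (@Cplus R) f /\ vanishes_on (@Cplus R) f.
Proof.
move=> [F [cF Ff vF]].
have vanF : vanishes_on [set z | 0 <= complex.Re z] F.
  by move=> e /vF[M MF]; exists M => z z0 Mz; rewrite ltW // MF.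
split=> e e0.
  have [d d0 dF] := halfplane_unif_continuous cF vanF e0; exists d => // v w v0 w0 vw.
  by rewrite -!Ff //; apply: dF => //; exact: ltW.
by have [M MF] := vanF e e0; exists M => z z0 Mz; rewrite -Ff // MF //; exact: ltW.
Qed.

Lemma C0cl_intro f : unif_continuous_on (@Cplus R) f -> vanishes_on (@Cplus R) f -> C0cl f.
Proof.
move=> cf vf.
have [F fF] : exists F, forall z, 0 <= complex.Re z -> forall e, 0 < e ->
    exists2 d : R, 0 < d & forall w, Cplus w -> cabs (w - z) < d -> cabs (f w - F z) <= e.
  suff ex_lim z : exists l, 0 <= complex.Re z -> forall e, 0 < e -> exists2 d : R, 0 < d &
      forall w, Cplus w -> cabs (w - z) < d -> cabs (f w - l) <= e.
    by have [F fF] := choice ex_lim; exists F.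
  have [z0|_] := leP 0 (complex.Re z); last by exists 0.
  by have [l fl] := unif_continuous_limit cf z0; exists l.
have near_z z d : 0 <= complex.Re z -> 0 < d -> exists2 w, Cplus w & cabs (w - z) < d.
  move=> z0 d0; exists (z + (d / 2)%:C%C); first by apply: halfplane_addr; rewrite ?divr_gt0.
  by rewrite (addrC z) addrK cabs_real ger0_norm; lra.
exists F; split.
- apply/within_cabsP => z z0 e e0; have e2 : 0 < e / 2 by rewrite divr_gt0.
  have [d d0 dF] := fF z z0 _ e2; have d2 : 0 < d / 2 by rewrite divr_gt0.
  exists (d / 2) => // w w0 wz; have [r r0 rF] := fF w w0 _ e2.
  have [|v v0] := near_z w (Num.min r (d / 2)) w0; first by rewrite lt_min r0.
  rewrite lt_min => /andP[vr vd]; rewrite (le_trans (cabs_distD (f v) _ _)) // [leRHS]splitr.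
  rewrite lerD //; first by rewrite cabs_distC rF.
  by apply: dF => //; have := cabs_distD w v z; lra.
- move=> z z0; apply/eqP; rewrite eq_sym -subr_eq0 -cabs_eq0 eq_le cabs_ge0 andbT.
  apply: (@le0_of_eps _ _ 1) => // e e0; rewrite mulr1.
  by have [d d0] := fF z (ltW z0) _ e0; apply=> //; rewrite subrr cabs0.
- move=> e e0; have e3 : 0 < e / 3 by rewrite divr_gt0.
  have [M Mf] := vf _ e3; exists (M + 1) => z z0 Mz; have [d d0 dF] := fF z z0 _ e3.
  have [|v v0] := near_z z (Num.min d 1) z0; first by rewrite lt_min d0 ltr01.
  rewrite lt_min => /andP[/(dF _ v0) fvF vz].
  have := lerB_cabs z v; have := lerB_cabs (F z) (f v).
  rewrite (cabs_distC z) (cabs_distC (F z)) => Fv zv.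
  by have := Mf _ v0; lra.
Qed.

Lemma C0cl_bounded f : C0cl f -> exists M : R, forall z, Cplus z -> cabs (f z) <= M.
Proof.
move=> /C0cl_elim[cf vf]; have [d d0 dP] := cf _ ltr01; have [M MP] := vf _ ltr01.
have step_le z n : Cplus z -> cabs (f z) <= cabs (f (z + (d / 2 * n%:R)%:C%C)) + n%:R.
  move=> z0; elim: n => [|n IH]; first by rewrite mulr0 !addr0.
  pose u : R[i] := z + (d / 2 * n%:R)%:C%C; pose u' : R[i] := z + (d / 2 * n.+1%:R)%:C%C.
  have u_gt0 m : Cplus (z + (d / 2 * m%:R)%:C%C).
    by rewrite /Cplus /= ReD ltr_wpDr //= mulr_ge0 // ltW // divr_gt0.
  have : cabs (f u - f u') <= 1.
    apply: (dP _ _ (u_gt0 n) (u_gt0 n.+1)); rewrite opprD addrACA subrr add0r -rmorphB cabs_real.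
    rewrite -mulrBr -(natr1 n) opprD addrA subrr sub0r mulrN1 normrN ger0_norm; lra.
  have := lerB_cabs (f u) (f u'); move: IH; rewrite -/u -/u' -(natr1 n).
  by move: (cabs _) (cabs _) (cabs _) (cabs _) => *; lra.
have d2 : 0 < d / 2 by rewrite divr_gt0.
have [n nM] : exists n : nat, M < d / 2 * n%:R.
  exists (Num.bound (`|M| / (d / 2))); rewrite mulrC -ltr_pdivrMr //.
  apply: le_lt_trans (archi_boundP _); last by rewrite divr_ge0 // ltW.
  by rewrite ler_pM2r ?invr_gt0 ?ler_norm.
exists (1 + n%:R) => z z0; rewrite (le_trans (step_le z n z0)) // lerD2r MP //.
  by rewrite /Cplus /= ReD ltr_wpDr //= mulr_ge0 // ltW.
by rewrite (lt_le_trans nM) // (le_trans _ (Re_le_cabs _)) // ReD /= lerDr ltW.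
Qed.

Definition sup_close e f g := forall z, Cplus z -> cabs (f z - g z) <= e.

Definition sup_closed (P : (R[i] -> R[i]) -> Prop) :=
  forall f, (forall e, 0 < e -> exists2 g, P g & sup_close e f g) -> P f.

Definition lin_closed (P : (R[i] -> R[i]) -> Prop) :=
  forall (c : R[i]) f g, P f -> P g -> P (fun z => f z + c * g z).

Lemma C0cl_sup_closed : sup_closed (@C0cl R).
Proof.
move=> f fg; apply: C0cl_intro => e e0.
  have e3 : 0 < e / 3 by rewrite divr_gt0.
  have [g /C0cl_elim[cg _] fge] := fg _ e3; have [d d0 dg] := cg _ e3.
  exists d => // v w v0 w0 vw.
  have := dg _ _ v0 w0 vw; have := fge _ v0; have := fge _ w0; rewrite (cabs_distC (f w)).
  have := cabs_distD (g v) (f v) (f w); have := cabs_distD (g w) (g v) (f w).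
  by lra.
have e2 : 0 < e / 2 by rewrite divr_gt0.
have [g /C0cl_elim[_ vg] fge] := fg _ e2; have [M Mg] := vg _ e2.
exists M => z z0 /(Mg _ z0); have := fge _ z0; have := lerB_cabs (f z) (g z).
by lra.
Qed.

Lemma eq_C0cl f g : (forall z, Cplus z -> f z = g z) -> C0cl f -> C0cl g.
Proof. by move=> fg [F [cF Ff vF]]; exists F; split=> // z z0; rewrite Ff // fg. Qed.

Lemma C0cl_lin_closed : lin_closed (@C0cl R).
Proof.
move=> c f g /C0cl_elim[cf vf] /C0cl_elim[cg vg].
have k0 : 0 < 1 + cabs c by rewrite ltr_pwDl // cabs_ge0.
have cg_small e w : cabs w <= e / (1 + cabs c) -> cabs (c * w) <= e.
  rewrite ler_pdivlMr // cabsM => we; rewrite (le_trans _ we) // mulrC.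
  by rewrite ler_wpM2l ?cabs_ge0 // lerDr.
apply: C0cl_intro => e e0; have e2 : 0 < e / 2 by rewrite divr_gt0.
  have [d d0 df] := cf _ e2; have [r r0 rg] := cg _ (divr_gt0 e2 k0).
  exists (Num.min d r) => [|v w v0 w0]; first by rewrite lt_min d0.
  rewrite lt_min => /andP[vwd vwr]; rewrite opprD addrACA -mulrBr.
  by rewrite (le_trans (le_cabsD _ _)) // [leRHS]splitr lerD ?df // cg_small ?rg.
have [M Mf] := vf _ e2; have [K Kg] := vg _ (divr_gt0 e2 k0).
exists (Num.max M K) => z z0; rewrite gt_max => /andP[Mz Kz].
by rewrite (le_trans (le_cabsD _ _)) // [leRHS]splitr lerD ?Mf // cg_small ?Kg.
Qed.

Definition translate a f : R[i] -> R[i] := fun z => f (z + a%:C%C).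

Lemma C0cl_translate f a : 0 <= a -> C0cl f -> C0cl (translate a f).
Proof.
move=> a0 /C0cl_elim[cf vf].
have shiftC z : Cplus z -> Cplus (z + a%:C%C) by rewrite /Cplus /= ReD /=; lra.
apply: C0cl_intro => e e0.
  have [d d0 df] := cf _ e0; exists d => // v w v0 w0 vw; apply: df; [exact: shiftC|exact: shiftC|].
  by rewrite opprD addrACA subrr addr0.
have [M Mf] := vf _ e0; exists M => z z0 Mz; apply: Mf; first exact: shiftC.
by rewrite (lt_le_trans Mz) // cabs_halfplane_addr // ltW.
Qed.

Lemma continuous_C0cl f : (forall z, 0 <= complex.Re z -> {for z, continuous (f : Cn R -> Cn R)}) ->
  (forall e, 0 < e -> exists M, forall z, 0 <= complex.Re z -> M < cabs z -> cabs (f z) < e) ->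
  C0cl f.
Proof.
move=> cf vf; exists f; split=> //; apply/within_cabsP => z z0 e e0.
by have /continuous_cabsP/(_ e e0)[d d0 df] := cf z z0; exists d => // w _; exact: df.
Qed.

End VanishingAtInfinity.

Section ResolventSpan.
Variable R : realType.
Implicit Types (f g : R[i] -> R[i]) (z : R[i]) (P : (R[i] -> R[i]) -> Prop) (l e : R).

Definition has_resolvents P := forall l, 0 < l -> P (fun z => (z + l%:C%C)^-1).

Definition resolvent_span f :=
  forall P, has_resolvents P -> lin_closed P -> sup_closed P -> P f.

Lemma resolvent_span_resolvents : has_resolvents resolvent_span.
Proof. by move=> l l0 P resP _ _; exact: resP. Qed.

Lemma resolvent_span_lin : lin_closed resolvent_span.
Proof.
move=> c f g sf sg P resP linP supP.
exact: linP (sf P resP linP supP) (sg P resP linP supP).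
Qed.

Lemma resolvent_span_sup : sup_closed resolvent_span.
Proof.
move=> f fg P resP linP supP; apply: (supP f) => e /fg[g sg fge]; exists g => //.
exact: (sg P resP linP supP).
Qed.

Lemma eq_resolvent_span f g : (forall z, Cplus z -> f z = g z) ->
  resolvent_span g -> resolvent_span f.
Proof.
move=> fg sg; apply: resolvent_span_sup => e e0; exists g => // z z0.
by rewrite fg // subrr cabs0 ltW.
Qed.

Lemma resolvent_spanZ (c : R[i]) f : resolvent_span f -> resolvent_span (fun z => c * f z).
Proof.
move=> sf; apply: eq_resolvent_span (resolvent_span_lin (c - 1) sf sf) => z _; ring.
Qed.

Lemma halfplane_addr_neq0 z l : 0 <= complex.Re z -> 0 < l -> z + l%:C%C != 0.
Proof.
move=> z0 l0; have := halfplane_addr z0 l0; apply: contraTneq => ->.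
by rewrite /Cplus /= ltxx.
Qed.

Lemma cabs_resolvent_le z l : 0 <= complex.Re z -> 0 < l -> cabs (z + l%:C%C)^-1 <= l^-1.
Proof.
move=> z0 l0; rewrite cabsV lef_pV2 ?posrE ?cabs_gt0 ?halfplane_addr_neq0 //.
by rewrite (le_trans _ (Re_le_cabs _)) // ReD /= lerDr.
Qed.

Lemma cderivable_resolvent z l : 0 <= complex.Re z -> 0 < l ->
  cderivable (fun z => (z + l%:C%C)^-1) z.
Proof.
move=> z0 l0; have dzl := cderivableD (@cderivable_id R z) (@cderivable_cst R l%:C%C z).
exact: cderivableV dzl (halfplane_addr_neq0 z0 l0).
Qed.

Lemma C0cl_resolvents : has_resolvents (@C0cl R).
Proof.
move=> l l0; apply: continuous_C0cl => [z z0|e e0].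
  exact: cderivable_continuous (cderivable_resolvent z0 l0).
exists e^-1 => z z0 ze; have z_gt0 : 0 < cabs z by rewrite (lt_trans _ ze) ?invr_gt0.
apply: (@le_lt_trans _ _ (cabs z)^-1); last by rewrite invf_plt ?posrE.
rewrite cabsV lef_pV2 ?posrE // ?cabs_gt0 ?halfplane_addr_neq0 //.
by rewrite cabs_halfplane_addr // ltW.
Qed.

Lemma resolvent_span_C0cl f : resolvent_span f -> C0cl f.
Proof.
by apply; [exact: C0cl_resolvents|exact: C0cl_lin_closed|exact: C0cl_sup_closed].
Qed.

(* Partial fractions when [l != 1]; the double pole at [-1] is a limit of such products. *)
Lemma resolvent_span_mul_resolvent l : 0 < l ->
  resolvent_span (fun z => (z + 1)^-1 * (z + l%:C%C)^-1).
Proof.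
have z1 z : Cplus z -> z + 1 != 0 by move=> z0; exact: (halfplane_addr_neq0 (ltW z0) ltr01).
have simple (k : R) : 0 < k -> k != 1 -> resolvent_span (fun z => (z + 1)^-1 * (z + k%:C%C)^-1).
  move=> k0 k1; have k1C : 1 - k%:C%C != 0 :> R[i].
    by rewrite -(rmorph1 (real_complex R)) -rmorphB -cabs_gt0 cabs_real normr_gt0 subr_eq0 eq_sym.
  have res1 := resolvent_span_resolvents ltr01; have resk := resolvent_span_resolvents k0.
  apply: eq_resolvent_span (resolvent_spanZ (1 - k%:C%C)^-1 (resolvent_span_lin (-1) resk res1)).
  move=> z z0; have zk := halfplane_addr_neq0 (ltW z0) k0.
  by field; rewrite k1C zk z1.
move=> l0; have [->|] := eqVneq l 1; last exact: simple.
apply: resolvent_span_sup => e e0; have e1 : 0 < 1 + e by rewrite addr_gt0.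
exists (fun z => (z + 1)^-1 * (z + (1 + e)%:C%C)^-1) => [|z z0].
  by apply: simple => //; rewrite gt_eqF // ltrDl.
have ze := halfplane_addr_neq0 (ltW z0) e1; have inv1 := cabs_resolvent_le (ltW z0) ltr01.
have -> : (z + 1)^-1 * (z + 1%:C%C)^-1 - (z + 1)^-1 * (z + (1 + e)%:C%C)^-1 =
    e%:C%C * ((z + 1)^-1 * (z + 1)^-1 * (z + (1 + e)%:C%C)^-1).
  by move: ze; rewrite rmorphD rmorph1 => ze; field; rewrite z1 //= ze.
rewrite cabsM cabs_real gtr0_norm // ler_piMr ?(ltW e0) // !cabsM.
rewrite invr1 in inv1; rewrite !mulr_ile1 ?mulr_ge0 ?cabs_ge0 //.
rewrite (le_trans (cabs_resolvent_le (ltW z0) e1)) // invf_le1 //.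
by rewrite lerDl ltW.
Qed.

Lemma resolvent_span_mul f : resolvent_span f -> resolvent_span (fun z => (z + 1)^-1 * f z).
Proof.
move=> sf; apply: (sf (fun f => resolvent_span (fun z => (z + 1)^-1 * f z))) => {f sf}.
- exact: resolvent_span_mul_resolvent.
- move=> c f g sf sg; apply: eq_resolvent_span (resolvent_span_lin c sf sg) => z _.
  by rewrite mulrDr mulrCA.
- move=> f fg; apply: resolvent_span_sup => e /fg[g sg fge].
  exists (fun z => (z + 1)^-1 * g z) => // z z0.
  rewrite -mulrBr cabsM (le_trans _ (fge z z0)) // ler_piMl ?cabs_ge0 //.
  by have := cabs_resolvent_le (ltW z0) ltr01; rewrite invr1.
Qed.

Definition cayley z : R[i] := 1 - 2 * (z + 1)^-1.

Lemma resolvent_span_poly_cayley (p : {poly R[i]}) :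
  resolvent_span (fun z => p.[cayley z] - p.[1]).
Proof.
have res1 := resolvent_span_resolvents ltr01.
elim/poly_ind: p => [|p c sp].
  by apply: eq_resolvent_span (resolvent_spanZ 0 res1) => z _; rewrite !horner0 mul0r subrr.
apply: eq_resolvent_span (resolvent_span_lin (- (2 * p.[1]))
  (resolvent_span_lin (-2) sp (resolvent_span_mul sp)) res1) => z _.
by rewrite !hornerMXaddC /cayley rmorph1; ring.
Qed.

End ResolventSpan.

Section DiscApproximation.
Variable R : realType.
Implicit Types (f F : R[i] -> R[i]) (z w : R[i]) (e M : R).

Definition unit_disc : set R[i] := [set w | cabs w < 1].

Lemma disc_poly_approximation F M : bounded_holo_on unit_disc M F ->
  unif_continuous_on unit_disc F -> forall e, 0 < e ->
  exists p : {poly R[i]}, forall w, cabs w < 1 -> cabs (F w - p.[w]) <= e.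
Proof.
move=> FM cF e e0; have e2 : 0 < e / 2 by rewrite divr_gt0.
have [d d0 dF] := cF _ e2.
have M0 : 0 <= M.
  have disc0 : cabs (0 : R[i]) < 1 by rewrite cabs0.
  by have [_] := FM 0 disc0; apply: le_trans; exact: cabs_ge0.
pose rho : R := 1 - Num.min (1 / 2) (d / 2).
have rho0 : 0 < rho by rewrite subr_gt0 gt_min; apply/orP; left; lra.
have rho1 : rho < 1 by rewrite ltrBlDr ltrDl lt_min !divr_gt0.
have rhod : 1 - rho < d by rewrite /rho subKr gt_min; apply/orP; right; lra.
clearbody rho; pose r : R := (1 + rho) / 2.
have r0 : 0 < r by rewrite /r; lra.
have r1 : r < 1 by rewrite /r; lra.
have rho_r : rho < r by rewrite /r; lra.
clearbody r.
have [n n_small] : exists n, (rho / r) ^+ n * (M * (r / (r - rho))) <= e / 2.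
  apply: exprn_mul_small => //; first by rewrite divr_ge0 ?ltr_pdivrMr ?mul1r // ltW.
  by rewrite !mulr_ge0 ?invr_ge0 ?subr_ge0 ?(ltW r0) ?(ltW rho_r).
exists (\poly_(k < n) (taylor_coef F r k * rho%:C%C ^+ k)) => w w1.
have wrho : cabs (rho%:C%C * w) <= rho by rewrite cabsM cabs_real gtr0_norm // ler_piMr // ltW.
have dw : cabs (F w - F (rho%:C%C * w)) <= e / 2.
  apply: dF => //; first by rewrite /unit_disc /= (le_lt_trans wrho).
  rewrite -[X in X - _]mul1r -mulrBl -(rmorph1 (real_complex R)) -rmorphB cabsM cabs_real.
  rewrite ger0_norm ?subr_ge0 ?(ltW rho1) // (le_lt_trans _ rhod) //.
  by rewrite ler_piMr ?subr_ge0 ?(ltW rho1) ?(ltW w1).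
rewrite (le_trans (cabs_distD (F (rho%:C%C * w)) _ _)) // [leRHS]splitr lerD // horner_poly.
have dF1 z : cabs z < 1 -> cderivable F z by move=> /FM[].
have FM1 z : cabs z < 1 -> cabs (F z) <= M by move=> /FM[].
have := taylor_remainder r0 r1 dF1 FM1 n.
move=> /(_ (rho%:C%C * w) (le_lt_trans wrho rho_r)).
under eq_bigr do rewrite exprMn mulrA.
move=> /le_trans; apply; apply: le_trans n_small; rewrite mulrCA.
have w0 := cabs_ge0 (rho%:C%C * w).
rewrite ler_pM ?mulr_ge0 ?exprn_ge0 ?divr_ge0 ?invr_ge0 ?subr_ge0 ?(ltW r0) //.
- by rewrite ltW // (le_lt_trans wrho).
- by rewrite lerXn2r ?nnegrE ?divr_ge0 ?(ltW r0) ?(ltW rho0) // ler_pM2r ?invr_gt0.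
- rewrite ler_wpM2l // ler_wpM2l ?(ltW r0) // lef_pV2 ?posrE ?subr_gt0 //.
  + by rewrite lerD2l lerN2.
  + by rewrite (le_lt_trans wrho).
Qed.

Definition inv_cayley w : R[i] := (1 + w) / (1 - w).

Lemma disc_sub1_neq0 w : cabs w < 1 -> 1 - w != 0.
Proof. by rewrite subr_eq0; apply: contraTneq => <-; rewrite cabs1 ltxx. Qed.

Lemma inv_cayley_add1 w : cabs w < 1 -> inv_cayley w + 1 = 2 / (1 - w).
Proof. by move=> /disc_sub1_neq0 w1; rewrite /inv_cayley; field. Qed.

Lemma Cplus_cabsP z : Cplus z <-> cabs (z - 1) < cabs (z + 1).
Proof.
rewrite -(ltr_pXn2r (n := 2)) ?nnegrE ?cabs_ge0 // !sqr_cabs !ReD !ImD !ReN !ImN /=.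
by rewrite oppr0 !addr0 /Cplus /=; split; nra.
Qed.

Lemma inv_cayley_Cplus w : cabs w < 1 -> Cplus (inv_cayley w).
Proof.
move=> w1; have w10 := disc_sub1_neq0 w1; apply/Cplus_cabsP.
have -> : inv_cayley w - 1 = 2 * w / (1 - w) by rewrite /inv_cayley; field.
rewrite inv_cayley_add1 // !cabsM ltr_pM2r ?cabs_gt0 ?invr_neq0 //.
by rewrite gtr_pMr // cabs_gt0 pnatr_eq0.
Qed.

Lemma cayley_disc z : Cplus z -> cabs (cayley z) < 1.
Proof.
move=> z0; have z1 := halfplane_addr_neq0 (ltW z0) ltr01; rewrite rmorph1 in z1.
have -> : cayley z = (z - 1) / (z + 1) by rewrite /cayley; field.
by rewrite cabsM cabsV ltr_pdivrMr ?cabs_gt0 // mul1r; exact/Cplus_cabsP.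
Qed.

Lemma cayleyK z : Cplus z -> inv_cayley (cayley z) = z.
Proof.
move=> z0; have z1 := halfplane_addr_neq0 (ltW z0) ltr01; rewrite rmorph1 in z1.
by rewrite /inv_cayley /cayley subKr; field; rewrite z1.
Qed.

Lemma inv_cayley_dist v w M : cabs v < 1 -> cabs w < 1 -> 0 <= M -> cabs (inv_cayley v) <= M ->
  cabs (v - w) <= (M + 1)^-1 -> cabs (inv_cayley v - inv_cayley w) <= (M + 1) ^+ 2 * cabs (v - w).
Proof.
move=> v1 w1 M0 vM vw; have v10 := disc_sub1_neq0 v1; have w10 := disc_sub1_neq0 w1.
have M1 : 0 < M + 1 by rewrite ltr_wpDl.
have v_le : cabs (2 / (1 - v)) <= M + 1.
  by rewrite -inv_cayley_add1 // (le_trans (le_cabsD _ _)) // cabs1 lerD2r.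
have w_le : cabs (1 - w)^-1 <= M + 1.
  rewrite cabsV invf_ple ?posrE ?cabs_gt0 //.
  have : 2 * (M + 1)^-1 <= cabs (1 - v).
    move: v_le; rewrite cabsM cabsV ler_pdivrMr ?cabs_gt0 // ler_pdivrMr // mulrC.
    by rewrite -(rmorph_nat (real_complex R) 2) cabs_real normr_nat.
  have := lerB_cabs (1 - v) (w - v).
  by rewrite opprB addrA subrK (cabs_distC w); move: vw; lra.
have -> : inv_cayley v - inv_cayley w = (2 / (1 - v)) * (1 - w)^-1 * (v - w).
  by rewrite /inv_cayley; field; rewrite v10 w10.
by rewrite !cabsM ler_wpM2r ?cabs_ge0 // expr2 ler_pM ?mulr_ge0 ?cabs_ge0 // -cabsM.
Qed.

Lemma C0cl_disc_unif_continuous f : C0cl f ->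
  unif_continuous_on unit_disc (fun w => f (inv_cayley w)).
Proof.
move=> /C0cl_elim[cf vf] e e0; have e2 : 0 < e / 2 by rewrite divr_gt0.
have [d d0 df] := cf _ e0; have [M0 fM0] := vf _ e2; pose M := Num.max M0 0.
have M_ge0 : 0 <= M by rewrite le_max lexx orbT.
have fM z : Cplus z -> M < cabs z -> cabs (f z) <= e / 2.
  by move=> z0 Mz; apply: fM0 => //; rewrite (le_lt_trans _ Mz) // le_max lexx.
clearbody M; have M1 : 0 < M + 1 by rewrite ltr_wpDl.
have close v w : cabs v < 1 -> cabs w < 1 -> cabs (inv_cayley v) <= M ->
    cabs (v - w) < Num.min (M + 1)^-1 (d / (M + 1) ^+ 2) ->
    cabs (f (inv_cayley v) - f (inv_cayley w)) <= e.
  move=> v1 w1 vM; rewrite lt_min ltr_pdivlMr ?exprn_gt0 // mulrC => /andP[vw vwd].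
  apply: df; [exact: inv_cayley_Cplus|exact: inv_cayley_Cplus|].
  exact: le_lt_trans (inv_cayley_dist v1 w1 M_ge0 vM (ltW vw)) vwd.
exists (Num.min (M + 1)^-1 (d / (M + 1) ^+ 2)) => [|v w v1 w1 vw].
  by rewrite lt_min invr_gt0 M1 divr_gt0 ?exprn_gt0.
have [vM|Mv] := leP (cabs (inv_cayley v)) M; first exact: close.
have [wM|Mw] := leP (cabs (inv_cayley w)) M.
  by rewrite cabs_distC; apply: close => //; rewrite cabs_distC.
by rewrite (le_trans (le_cabsB _ _)) // [leRHS]splitr lerD ?fM //; exact: inv_cayley_Cplus.
Qed.

Theorem C0cl_resolvent_span f : holo f -> C0cl f -> resolvent_span f.
Proof.
move=> hf f0; have [M fM] := C0cl_bounded f0.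
have FM : bounded_holo_on unit_disc M (fun w => f (inv_cayley w)).
  move=> w w1; split; last by apply: fM; exact: inv_cayley_Cplus.
  have d1 := @cderivable_cst R 1 w; have dw := @cderivable_id R w.
  have dC := cderivableM (cderivableD d1 dw) (cderivableV (cderivableB d1 dw) (disc_sub1_neq0 w1)).
  apply: cderivable_comp dC _; apply: hf; exact: inv_cayley_Cplus.
apply: resolvent_span_sup => e e0; have e4 : 0 < e / 4 by rewrite divr_gt0.
have [p pF] := disc_poly_approximation FM (C0cl_disc_unif_continuous f0) e4.
have fp z : Cplus z -> cabs (f z - p.[cayley z]) <= e / 4.
  by move=> z0; have := pF _ (cayley_disc z0); rewrite cayleyK.
have sp := resolvent_span_poly_cayley p.
exists (fun z => p.[cayley z] - p.[1]) => // z z0.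
suff p1 : cabs p.[1] <= 3 * (e / 4).
  rewrite opprB addrA addrAC (le_trans (le_cabsD _ _)) //.
  by have := fp z z0; lra.
have [_ vf] := C0cl_elim f0; have [_ vp] := C0cl_elim (resolvent_span_C0cl sp).
have [K fK] := vf _ e4; have [L pL] := vp _ e4.
pose x := Num.max (Num.max K L) 0 + 1.
have xK : K < x by rewrite ltr_pwDr // !le_max lexx.
have xL : L < x by rewrite ltr_pwDr // !le_max lexx orbT.
have x0 : 0 < x by rewrite ltr_pwDr // !le_max lexx orbT.
clearbody x; have xC : Cplus (x%:C%C : R[i]) by [].
have xE : cabs (x%:C%C : R[i]) = x by rewrite cabs_real gtr0_norm.
have := fK _ xC; have := pL _ xC; rewrite xE => /(_ xL) pxp1 /(_ xK) fx.
have := fp _ xC; move: (f _) (p.[cayley _]) pxp1 fx => a b pxp1 fx ab.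
have -> : p.[1] = a - (a - b) - (b - p.[1]) by ring.
have := le_cabsB (a - (a - b)) (b - p.[1]); have := le_cabsB a (a - b).
by lra.
Qed.

End DiscApproximation.

Section LebesgueIntegration.
Variable R : realType.
Local Notation leb := (@lebesgue_measure R).

Lemma ge0_integral_translate (s : R) (D : set R) (g : R -> \bar R) :
  measurable D -> measurable_fun D g -> (forall x, D x -> 0 <= g x)%E ->
  (\int[leb]_(x in D) g x = \int[leb]_(x in [set x | D (x + s)%R]) g (x + s)%R)%E.
Proof.
move=> mD mg g0.
have ms : measurable_fun [set: measurableTypeR R]
    (fun x : measurableTypeR R => (x + s : measurableTypeR R)) by exact: measurable_funD.
pose mu := pushforward leb (fun x : measurableTypeR R => (x + s : measurableTypeR R)).
have lebE : forall A, measurable A -> leb A = mu A.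
  apply: lebesgue_measure_unique => X /ocitvP[->|[[x y] /= xy ->]].
    by rewrite !measure0.
  rewrite /mu /pushforward.
  have -> : (fun t : R => t + s) @^-1` `]x, y] = `]x - s, y - s]%classic.
    by apply/seteqP; split=> t /=; rewrite !in_itv /= ltrBlDr lerBrDr.
  rewrite !lebesgue_measure_itv /= !lte_fin ltrD2r xy.
  by rewrite -!EFinB; congr EFin; ring.
rewrite (eq_measure_integral mu); last by move=> A mA _; exact: lebE.
by rewrite ge0_integral_pushforward // => x; rewrite inE; exact: g0.
Qed.

Lemma integral_vanishing_sets d (T : measurableType d) (mu : {measure set T -> \bar R})
    (D : set T) (E : nat -> set T) (g : T -> \bar R) :
  measurable D -> (forall n, measurable (E n)) -> (forall n, E n `<=` D) ->
  mu.-integrable D g -> (forall x, D x -> g x \is a fin_num) -> (forall x, D x -> 0 <= g x)%E ->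
  (forall x, D x -> exists N, forall n, (N <= n)%N -> ~ E n x) ->
  forall e : R, 0 < e -> exists n, (\int[mu]_(x in E n) g x < e%:E)%E.
Proof.
move=> mD mE ED ig fin_g g0 leaves e e0; have mg := measurable_int _ ig.
have : (\int[mu]_(x in D) (g \_ (E n)) x)%E @[n --> \oo] --> (\int[mu]_(x in D) (cst 0%E) x)%E.
  apply: (@dominated_cvg _ _ _ mu D mD _ _ g) => //.
  - move=> n; apply/(measurable_restrict _ (mE n) mD).
    by apply: measurable_funS mg => //; exact: subIsetl.
  - move=> x Dx; have [N NP] := leaves x Dx.
    apply: cvg_near_cst; exists N => // n Nn /=.
    by rewrite patchE memNset //; exact: NP.
  - move=> n x Dx; rewrite patchE; case: ifPn => _ /=; first by rewrite gee0_abs ?g0.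
    by rewrite normr0 g0.
rewrite integral0 => /fine_cvgP[[N1 _ fin] /cvgrPdist_lt/(_ _ e0)[N2 _ small]].
pose n := maxn N1 N2; exists n.
have := fin n (leq_maxl _ _); have := small n (leq_maxr _ _).
rewrite /= sub0r normrN -integral_mkcondr setIidr // => small_n fin_n.
by rewrite -(fineK fin_n) lte_fin (le_lt_trans (ler_norm _)).
Qed.

Lemma is_derive_inv (x : R) : x != 0 -> is_derive x (1 : R) (fun x => - x^-1) (x ^- 2).
Proof.
move=> x0; have dV := is_deriveN (is_deriveV x0 (is_derive_id x (1 : R))).
by apply: is_derive_eq dV _; rewrite /GRing.scale /= mulr1 opprK.
Qed.

Lemma integral_inv_sqr (k c : R) : 0 <= k -> 0 < c ->
  (\int[leb]_(a in `]c, +oo[) (k / a ^+ 2)%:E = (k / c)%:E)%E.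
Proof.
move=> k0 c0.
pose F (a : R) := k * - a^-1.
have dF (a : R) : 0 < a -> is_derive a (1 : R) F (k / a ^+ 2).
  move=> a0; have dV := is_derive_inv (lt0r_neq0 a0).
  by apply: is_derive_eq (is_deriveZ k dV) _.
have cf (a : R) : c <= a -> {for a, continuous (fun a : R => k / a ^+ 2)}.
  move=> ca; have a0 : a != 0 by rewrite gt_eqF // (lt_le_trans c0).
  apply: cvgM; first exact: cvg_cst.
  by apply: cvgV; [rewrite expf_neq0|exact: exprn_continuous].
have cfw : {within `[c, +oo[, continuous (fun a : R => k / a ^+ 2)}.
  by apply: continuous_in_subspaceT => a; rewrite inE /= in_itv /= andbT; exact: cf.
rewrite integral_itv_obnd_cbnd; last first.
  apply/measurable_EFinP; apply: open_continuous_measurable_fun; first exact: interval_open.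
  by move=> a; rewrite inE /= in_itv /= andbT => /ltW; exact: cf.
rewrite (@ge0_continuous_FTC2y _ (fun a => k / a ^+ 2) F c 0).
- by rewrite -EFinB sub0r /F mulrN opprK.
- by move=> a ca; rewrite divr_ge0 // sqr_ge0.
- exact: cfw.
- apply/cvgrPdist_le => e e0; near=> a; have a0 : 0 < a by near: a; exact: nbhs_pinfty_gt.
  have kea : k / e <= a by near: a; apply: nbhs_pinfty_ge; rewrite num_real.
  rewrite /F mulrN opprK add0r ger0_norm ?divr_ge0 ?(ltW a0) // ler_pdivrMr //.
  by rewrite mulrC -ler_pdivrMr.
- by move=> a ca; have [] := dF a (lt_trans c0 ca).
- apply: cvg_at_right_filter; have [/derivable1_diffP/differentiable_continuous cF _] := dF c c0.
  exact: cF.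
- move=> a; rewrite in_itv /= andbT => ca; rewrite derive1E.
  by have [_ ->] := dF a (lt_trans c0 ca).
Unshelve. all: by end_near. Qed.

End LebesgueIntegration.

Section DerivativeSup.
Variable R : realType.
Local Notation leb := (@lebesgue_measure R).
Implicit Types (f g : R[i] -> R[i]) (z w : R[i]) (a b s K M e : R).

Lemma RposP a : @Rpos R a <-> 0 < a.
Proof. by rewrite /Rpos /= in_itv /= andbT. Qed.

Lemma measurable_Rpos : measurable (@Rpos R).
Proof. exact: measurable_itv. Qed.

Lemma Cplus_translate z s : Cplus z -> 0 <= s -> Cplus (z + s%:C%C).
Proof. by move=> z0 s0; rewrite /Cplus /= ReD ltr_wpDr. Qed.

Lemma cdisc_Cplus a z : a <= complex.Re z -> cdisc z a `<=` @Cplus R.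
Proof.
move=> az v; rewrite /cdisc /Cplus /= => vz.
by have := normr_Re_le (v - z); rewrite ReD ReN => /ler_normlP[]; lra.
Qed.

Lemma bounded_holo_on_disc M f a z : bounded_holo_on (@Cplus R) M f -> a <= complex.Re z ->
  bounded_holo_on (cdisc z a) M f.
Proof. by move=> fM az w /(cdisc_Cplus az) /fM. Qed.

Lemma bounded_holo_onD M K f g : bounded_holo_on (@Cplus R) M f ->
  bounded_holo_on (@Cplus R) K g -> bounded_holo_on (@Cplus R) (M + K) (fun z => f z + g z).
Proof.
move=> fM gK z z0; have [df fz] := fM z z0; have [dg gz] := gK z z0; split.
  exact: cderivableD df dg.
by rewrite (le_trans (le_cabsD _ _)) // lerD.
Qed.

Lemma bounded_holo_onB M K f g : bounded_holo_on (@Cplus R) M f ->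
  bounded_holo_on (@Cplus R) K g -> bounded_holo_on (@Cplus R) (M + K) (fun z => f z - g z).
Proof.
move=> fM gK z z0; have [df fz] := fM z z0; have [dg gz] := gK z z0; split.
  exact: cderivableB df dg.
by rewrite (le_trans (le_cabsB _ _)) // lerD.
Qed.

Lemma bounded_holo_on_translate M f s : 0 <= s -> bounded_holo_on (@Cplus R) M f ->
  bounded_holo_on (@Cplus R) M (translate s f).
Proof.
move=> s0 fM z z0; have [df fz] := fM _ (Cplus_translate z0 s0); split; last exact: fz.
exact: cderivable_comp (cderivableD (@cderivable_id R z) (@cderivable_cst R s%:C%C z)) df.
Qed.

Definition dsup f a : \bar R :=
  ereal_sup [set (cabs (cderiv f (a +i* b)%C))%:E | b in [set: R]].

Lemma B0normE f : B0norm f = (\int[leb]_(a in @Rpos R) dsup f a)%E.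
Proof.
apply: eq_integral => a _; congr ereal_sup; apply: eq_imagel => b _.
by rewrite cderivE.
Qed.

Lemma dsup_ge f a b : ((cabs (cderiv f (a +i* b)%C))%:E <= dsup f a)%E.
Proof. by apply: ereal_sup_ubound; exists b. Qed.

Lemma dsup_le f a (C : \bar R) : (forall b, (cabs (cderiv f (a +i* b)%C))%:E <= C)%E ->
  (dsup f a <= C)%E.
Proof. by move=> fC; apply: ge_ereal_sup => _ [b _ <-]. Qed.

Lemma dsup_ge0 f a : (0 <= dsup f a)%E.
Proof. by apply: le_trans (dsup_ge f a 0); rewrite lee_fin cabs_ge0. Qed.

Lemma B0norm_ge0 f : (0 <= B0norm f)%E.
Proof. by rewrite B0normE; apply: integral_ge0 => a _; exact: dsup_ge0. Qed.

Lemma eq_B0norm f g : (forall z, Cplus z -> f z = g z) -> B0norm f = B0norm g.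
Proof.
move=> fg; rewrite !B0normE; apply: eq_integral => a; rewrite inE RposP => a0.
congr ereal_sup; apply: eq_imagel => b _; congr (EFin (cabs _)).
apply: near_eq_cderiv; apply/nbhs_cabsP; exists a => // w wa.
by apply: fg; exact: (@cdisc_Cplus a (a +i* b)%C).
Qed.

Lemma B0normDc f (c : R[i]) : B0norm (fun z => f z + c) = B0norm f.
Proof.
rewrite !B0normE; apply: eq_integral => a _; congr ereal_sup.
by apply: eq_imagel => b _; rewrite cderivDc.
Qed.

Lemma dsup_translate f s a : dsup (translate s f) a = dsup f (a + s).
Proof.
congr ereal_sup; apply: eq_imagel => b _.
by rewrite /translate cderiv_translate complex_addr.
Qed.

Section Bounded.
Variables (f : R[i] -> R[i]) (M : R).
Hypothesis fM : bounded_holo_on (@Cplus R) M f.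

Lemma bounded_holo_cderivable a b : 0 < a -> cderivable f (a +i* b)%C.
Proof. by move=> a0; have [] := @fM (a +i* b)%C a0. Qed.

Lemma bounded_holo_on_line_disc a b : bounded_holo_on (cdisc (a +i* b)%C a) M f.
Proof. by apply: bounded_holo_on_disc. Qed.

Lemma dsup_le_div a : 0 < a -> (dsup f a <= (2 * M / a)%:E)%E.
Proof.
move=> a0; apply: dsup_le => b; rewrite lee_fin.
by have [] := cauchy_estimate a0 (@bounded_holo_on_line_disc a b).
Qed.

Lemma dsup_fin_num a : 0 < a -> dsup f a \is a fin_num.
Proof.
move=> a0; rewrite ge0_fin_numE ?dsup_ge0 //.
by rewrite (le_lt_trans (dsup_le_div a0)) // ltry.
Qed.

Lemma cderiv_translate_le a p q b : 0 < a -> a <= p -> a <= q ->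
  cabs (cderiv f (p +i* b)%C - cderiv f (q +i* b)%C) <= 16 * M / a ^+ 2 * `|p - q|.
Proof.
move=> a0 ap aq; rewrite -cabs_real -(complex_subr p q b).
by apply: cderiv_lipschitz; [|exact: bounded_holo_on_disc..].
Qed.

Lemma dsup_lipschitz a p q : 0 < a -> a <= p -> a <= q ->
  (dsup f p <= dsup f q + (16 * M / a ^+ 2 * `|p - q|)%:E)%E.
Proof.
move=> a0 ap aq; apply: dsup_le => b.
apply: le_trans (leeD2r _ (dsup_ge f q b)); rewrite -EFinD lee_fin.
have := cderiv_translate_le b a0 ap aq.
by have := lerB_cabs (cderiv f (p +i* b)%C) (cderiv f (q +i* b)%C); lra.
Qed.

Lemma dsup_continuous a : 0 < a -> {for a, continuous (fine \o dsup f)}.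
Proof.
move=> a0; have a2 : 0 < a / 2 by rewrite divr_gt0.
have M0 := bounded_holo_on_ge0 a0 (@bounded_holo_on_line_disc a 0).
pose L := 16 * M / (a / 2) ^+ 2.
have L0 : 0 <= L by rewrite /L divr_ge0 ?sqr_ge0 // mulr_ge0.
have lip p q : a / 2 <= p -> a / 2 <= q -> fine (dsup f p) - fine (dsup f q) <= L * `|p - q|.
  move=> ap aq; have p0 := lt_le_trans a2 ap; have q0 := lt_le_trans a2 aq.
  by rewrite lerBlDl -lee_fin EFinD !fineK ?dsup_fin_num //; exact: dsup_lipschitz.
apply/cvgrPdist_le => e e0; apply/nbhs_ballP; exists (Num.min (a / 2) (e / (L + 1))) => /=.
  by rewrite lt_min a2 divr_gt0 ?ltr_wpDl.
move=> p; rewrite /ball /= lt_min => /andP[pa pe].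
have ap : a / 2 <= p by move: pa => /ltr_normlP[]; lra.
have aa : a / 2 <= a by lra.
have := lip _ _ aa ap; have := lip _ _ ap aa; rewrite (distrC p).
move: pe; rewrite ltr_pdivlMr ?ltr_wpDl // mulrDr mulr1 => pe lip1 lip2.
by have := normr_ge0 (a - p); rewrite /= ler_norml; lra.
Qed.

Lemma dsup_measurable (D : set R) : measurable D -> D `<=` @Rpos R -> measurable_fun D (dsup f).
Proof.
move=> mD DR; apply: measurable_funS DR _ => //; first exact: measurable_Rpos.
apply: (eq_measurable_fun (EFin \o (fine \o dsup f))) => [a|].
  by rewrite inE RposP => a0; rewrite /= fineK ?dsup_fin_num.
apply/measurable_EFinP; apply: open_continuous_measurable_fun; first exact: interval_open.
by move=> a; rewrite inE RposP; exact: dsup_continuous.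
Qed.

Lemma dsup_integral_subset (A B : set R) : measurable A -> measurable B -> A `<=` B ->
  B `<=` @Rpos R -> (\int[leb]_(a in A) dsup f a <= \int[leb]_(a in B) dsup f a)%E.
Proof.
move=> mA mB AB BR; apply: ge0_subset_integral => //; first exact: dsup_measurable.
by move=> a _; exact: dsup_ge0.
Qed.

Lemma dsup_integral_translate s (A B : set R) : 0 <= s -> measurable A -> B `<=` @Rpos R ->
  measurable B -> (forall a, A a <-> B (a + s)) ->
  (\int[leb]_(a in A) dsup (translate s f) a = \int[leb]_(a in B) dsup f a)%E.
Proof.
move=> s0 mA BR mB AB; rewrite (@ge0_integral_translate _ s B) //; first last.
- by move=> a _; exact: dsup_ge0.
- exact: dsup_measurable.
rewrite (_ : [set a | B (a + s)] = A); last by apply/seteqP; split=> a /AB.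
by apply: eq_integral => a _; rewrite dsup_translate.
Qed.

Lemma dsup_integrable : (B0norm f < +oo)%E -> leb.-integrable (@Rpos R) (dsup f).
Proof.
rewrite B0normE => fin; apply/integrableP; split; first exact: dsup_measurable measurable_Rpos _.
by under eq_integral do rewrite gee0_abs ?dsup_ge0 //.
Qed.

Lemma dsup_integral_near0 e : (B0norm f < +oo)%E -> 0 < e ->
  exists2 d : R, 0 < d & (\int[leb]_(a in `]0%R, d]) dsup f a <= e%:E)%E.
Proof.
move=> fin e0.
have [||||||n n_small] := @integral_vanishing_sets R _ _ leb (@Rpos R)
  (fun n => `]0%R, n.+1%:R^-1]%classic) (dsup f) measurable_Rpos _ _ (dsup_integrable fin) _ _ _ e.
- by move=> n; exact: measurable_itv.
- by move=> n a /=; rewrite RposP in_itv /= => /andP[].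
- by move=> a /RposP; exact: dsup_fin_num.
- by move=> a _; exact: dsup_ge0.
- move=> a /RposP a0; exists (Num.bound a^-1) => n nb /=.
  rewrite in_itv /= a0 /=; apply/negP; rewrite -ltNge invf_plt ?posrE //.
  by rewrite (lt_le_trans (archi_boundP _)) ?invr_ge0 ?(ltW a0) // ler_nat ltnW.
- exact: e0.
by exists n.+1%:R^-1; [rewrite invr_gt0|exact: ltW].
Qed.

Lemma dsup_integral_tail e : (B0norm f < +oo)%E -> 0 < e ->
  exists2 N : R, 1 <= N & (\int[leb]_(a in `]N, +oo[) dsup f a <= e%:E)%E.
Proof.
move=> fin e0.
have [||||||n n_small] := @integral_vanishing_sets R _ _ leb (@Rpos R)
  (fun n => `]n.+1%:R, +oo[%classic) (dsup f) measurable_Rpos _ _ (dsup_integrable fin) _ _ _ e.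
- by move=> n; exact: measurable_itv.
- by move=> n a /=; rewrite RposP in_itv /= andbT; exact: lt_trans.
- by move=> a /RposP; exact: dsup_fin_num.
- by move=> a _; exact: dsup_ge0.
- move=> a /RposP a0; exists (Num.bound a) => n nb /=.
  apply/negP; rewrite in_itv /= andbT -leNgt.
  by rewrite ltW // (lt_le_trans (archi_boundP _)) ?(ltW a0) // ler_nat ltnW.
- exact: e0.
by exists n.+1%:R; [rewrite ler1n|exact: ltW].
Qed.

Lemma sup_le_B0norm (eta c : R) : (B0norm f <= eta%:E)%E ->
  (forall b e, 0 < e -> exists A, forall a, A <= a -> cabs (f (a +i* b)%C) <= c + e) ->
  forall z, Cplus z -> cabs (f z) <= eta + c.
Proof.
move=> B0f far [a b] /= a0; apply/ler_addgt0Pr => e e0; have [A fA] := far b e e0.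
pose a' := Num.max A (a + 1); have aa' : a <= a' by rewrite le_max; apply/orP; right; lra.
have fa' : cabs (f (a' +i* b)%C) <= c + e by apply: fA; rewrite le_max lexx.
have sub : `[a, a'] `<=` @Rpos R.
  by move=> x /=; rewrite RposP in_itv /= => /andP[ax _]; exact: lt_le_trans ax.
have cf : continuous_on_itv a a' (fun x => cderiv f (x +i* b)%C).
  move=> x /andP[ax _]; have x0 := lt_le_trans a0 ax; apply: continuous_horizontal_comp.
  exact: cderiv_continuous x0 (@bounded_holo_on_line_disc x b).
have dF x : a <= x <= a' -> is_cderive (x +i* b)%C f (cderiv f (x +i* b)%C).
  move=> /andP[ax _]; apply: is_cderive_cderiv; apply: bounded_holo_cderivable.
  exact: lt_le_trans ax.
have int_sup : leb.-integrable `[a, a'] (EFin \o (fine \o dsup f)).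
  apply: continuous_compact_integrable; first exact: segment_compact.
  apply: continuous_in_subspaceT => x; rewrite inE => /sub/RposP; exact: dsup_continuous.
have line_le : cabs (f (a' +i* b)%C - f (a +i* b)%C) <= eta.
  rewrite -(itv_integral_primitive aa' dF cf).
  apply: le_trans (le_cabs_cintegral _ (continuous_itv_cintegrable cf) int_sup _) _.
  - exact: measurable_itv.
  - move=> x /sub/RposP x0; rewrite -lee_fin fineK ?dsup_fin_num //; exact: dsup_ge.
  rewrite -lee_fin /Rintegral fineK; last by apply: integrable_fin_num.
  apply: le_trans B0f; rewrite B0normE.
  apply: le_trans (dsup_integral_subset (measurable_itv _) measurable_Rpos sub (@subset_refl _ _)).
  rewrite le_eqVlt; apply/orP; left; apply/eqP; apply: eq_integral => x.
  by rewrite inE => /sub/RposP x0; rewrite /= fineK ?dsup_fin_num.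
have := lerB_cabs (f (a +i* b)%C) (f (a' +i* b)%C); rewrite cabs_distC.
by move: (f _) (f _) fa' line_le => p q; lra.
Qed.

End Bounded.
End DerivativeSup.

Section Regularization.
Variable R : realType.
Local Notation leb := (@lebesgue_measure R).
Implicit Types (f g h u : R[i] -> R[i]) (z w c : R[i]) (a b s d eps N K M e eta : R).

Lemma dsupD f g a : 0 < a -> (forall z, Cplus z -> cderivable f z) ->
  (forall z, Cplus z -> cderivable g z) ->
  (dsup (fun z => (f z + g z)%R) a <= dsup f a + dsup g a)%E.
Proof.
move=> a0 df dg; apply: dsup_le => b; pose z := (a +i* b)%C.
have dz := is_deriveD (is_cderive_cderiv (df z a0)) (is_cderive_cderiv (dg z a0)).
rewrite -/z (is_cderive_val dz) (le_trans _ (leeD (dsup_ge f a b) (dsup_ge g a b))) //.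
by rewrite -EFinD lee_fin le_cabsD.
Qed.

Lemma dsupB f g a : 0 < a -> (forall z, Cplus z -> cderivable f z) ->
  (forall z, Cplus z -> cderivable g z) ->
  (dsup (fun z => (f z - g z)%R) a <= dsup f a + dsup g a)%E.
Proof.
move=> a0 df dg; apply: dsup_le => b; pose z := (a +i* b)%C.
have dz := is_deriveB (is_cderive_cderiv (df z a0)) (is_cderive_cderiv (dg z a0)).
rewrite -/z (is_cderive_val dz) (le_trans _ (leeD (dsup_ge f a b) (dsup_ge g a b))) //.
by rewrite -EFinD lee_fin le_cabsB.
Qed.

Lemma B0normD f g K M : bounded_holo_on (@Cplus R) K f -> bounded_holo_on (@Cplus R) M g ->
  (B0norm (fun z => (f z + g z)%R) <= B0norm f + B0norm g)%E.
Proof.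
move=> fK gM; have mR := @measurable_Rpos R.
have mf := dsup_measurable fK mR (@subset_refl _ _).
have mg := dsup_measurable gM mR (@subset_refl _ _).
have mfg := dsup_measurable (bounded_holo_onD fK gM) mR (@subset_refl _ _).
rewrite !B0normE -ge0_integralD //; try by move=> a _; exact: dsup_ge0.
apply: ge0_le_integral => //.
- by move=> a _; exact: dsup_ge0.
- exact: emeasurable_funD.
- by move=> a /RposP a0; apply: dsupD => // z; [case/fK|case/gM].
Qed.

Section TranslateDifference.
Variables (f : R[i] -> R[i]) (K : R).
Hypothesis fK : bounded_holo_on (@Cplus R) K f.

Lemma bounded_holo_translateB s : 0 <= s ->
  bounded_holo_on (@Cplus R) (K + K) (fun z => f z - translate s f z).
Proof. by move=> s0; exact: bounded_holo_onB fK (bounded_holo_on_translate s0 fK). Qed.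

Lemma itv_oc_Rpos d : `]0%R, d]%classic `<=` @Rpos R.
Proof. by move=> a /=; rewrite RposP in_itv /= => /andP[]. Qed.

Lemma itv_oy_Rpos d : 0 <= d -> `]d, +oo[%classic `<=` @Rpos R.
Proof. by move=> d0 a /=; rewrite RposP in_itv /= andbT; exact: le_lt_trans. Qed.

Lemma dsup_translateB_near0 s d : 0 < s -> s <= d ->
  (\int[leb]_(a in `]0%R, d]) dsup (fun z => (f z - translate s f z)%R) a <=
   \int[leb]_(a in `]0%R, (d + d)%R]) dsup f a + \int[leb]_(a in `]0%R, (d + d)%R]) dsup f a)%E.
Proof.
move=> s0 sd; have d0 := lt_le_trans s0 sd; have fsK := bounded_holo_on_translate (ltW s0) fK.
have mitv (i : interval R) : measurable [set` i] by exact: measurable_itv.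
have mf := dsup_measurable fK (mitv _) (@itv_oc_Rpos d).
have mfs := dsup_measurable fsK (mitv _) (@itv_oc_Rpos d).
have mdiff := dsup_measurable (bounded_holo_translateB (ltW s0)) (mitv _) (@itv_oc_Rpos d).
apply: (@le_trans _ _ (\int[leb]_(a in `]0%R, d]) (dsup f a + dsup (translate s f) a))%E).
  apply: ge0_le_integral => //.
  - by move=> a _; exact: dsup_ge0.
  - exact: emeasurable_funD mf mfs.
  - by move=> a /itv_oc_Rpos/RposP a0; apply: dsupB => // z; [case/fK|case/fsK].
rewrite ge0_integralD //; try by move=> a _; exact: dsup_ge0.
apply: leeD.
  have sub : `]0%R, d]%classic `<=` (`]0%R, (d + d)%R])%classic.
    by move=> a /=; rewrite !in_itv /= => /andP[-> ad]; rewrite (le_trans ad) // lerDl ltW.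
  exact: (dsup_integral_subset fK (mitv _) (mitv _) sub (@itv_oc_Rpos _)).
rewrite (@dsup_integral_translate _ _ _ fK s _ `]s, (d + s)%R]) ?(ltW s0) //.
- have sub : `]s, (d + s)%R]%classic `<=` (`]0%R, (d + d)%R])%classic.
    move=> a /=; rewrite !in_itv /= => /andP[sa ad]; rewrite (lt_trans s0 sa) /=.
    by rewrite (le_trans ad) // lerD2l.
  exact: (dsup_integral_subset fK (mitv _) (mitv _) sub (@itv_oc_Rpos _)).
- by move=> a /=; rewrite RposP in_itv /= => /andP[sa _]; exact: lt_trans sa.
- by move=> a; rewrite /= !in_itv /= ltrDr lerD2r.
Qed.

Lemma dsup_translateB_tail s d : 0 < s -> 0 < d ->
  (\int[leb]_(a in `]d, +oo[) dsup (fun z => (f z - translate s f z)%R) a <=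
   (16 * K * s / d)%:E)%E.
Proof.
move=> s0 d0; have fsK := bounded_holo_on_translate (ltW s0) fK.
have K0 : 0 <= K := bounded_holo_on_ge0 ltr01 (@bounded_holo_on_line_disc _ _ _ fK 1 0).
have mitv (i : interval R) : measurable [set` i] by exact: measurable_itv.
have pos := itv_oy_Rpos (ltW d0).
have mdiff := dsup_measurable (bounded_holo_translateB (ltW s0)) (mitv _) pos.
rewrite -integral_inv_sqr ?mulr_ge0 ?(ltW s0) //; apply: ge0_le_integral => //.
- by move=> a _; exact: dsup_ge0.
- apply/measurable_EFinP; apply: open_continuous_measurable_fun; first exact: interval_open.
  move=> a; rewrite inE => /pos/RposP a0; apply: cvgM; first exact: cvg_cst.
  by apply: cvgV; [rewrite expf_neq0 // gt_eqF|exact: exprn_continuous].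
- move=> a /pos/RposP a0; apply: dsup_le => b; rewrite lee_fin.
  pose z : R[i] := (a +i* b)%C; have [dfz _] := @fK z a0; have [dfs _] := @fsK z a0.
  have dz := is_deriveB (is_cderive_cderiv dfz) (is_cderive_cderiv dfs).
  rewrite -/z (is_cderive_val dz) [cderiv (translate s f) z]cderiv_translate complex_addr.
  rewrite (le_trans (cderiv_translate_le fK b a0 (lexx a) _)) ?lerDl ?(ltW s0) //.
  by rewrite opprD addrA subrr sub0r normrN gtr0_norm // mulrAC.
Qed.

Lemma B0norm_translateB_le s d : 0 < s -> s <= d ->
  (B0norm (fun z => (f z - translate s f z)%R) <=
   \int[leb]_(a in `]0%R, (d + d)%R]) dsup f a + \int[leb]_(a in `]0%R, (d + d)%R]) dsup f a +
   (16 * K * s / d)%:E)%E.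
Proof.
move=> s0 sd; have d0 := lt_le_trans s0 sd; have diffK := bounded_holo_translateB (ltW s0).
have posU : @Rpos R = (`]0%R, d] `|` `]d, +oo[)%classic.
  by rewrite -itv_bndbnd_setU // bnd_simp // ltW.
have mdiff := dsup_measurable diffK (@measurable_Rpos R) (@subset_refl _ _).
rewrite B0normE {1}posU ge0_integral_setU //; try exact: measurable_itv.
- by apply: leeD; [exact: dsup_translateB_near0|exact: dsup_translateB_tail].
- by rewrite -posU.
- by move=> a _; exact: dsup_ge0.
- apply/disj_setPS => a /= []; rewrite !in_itv /= andbT => /andP[_ ad] /(le_lt_trans ad).
  by rewrite ltxx.
Qed.

Lemma B0norm_translate s : 0 <= s ->
  B0norm (translate s f) = (\int[leb]_(a in `]s, +oo[) dsup f a)%E.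
Proof.
move=> s0; rewrite B0normE; apply: (dsup_integral_translate fK) => //.
- exact: measurable_Rpos.
- exact: itv_oy_Rpos.
- by move=> a; rewrite RposP /= in_itv /= andbT ltrDr.
Qed.

End TranslateDifference.

Lemma B0norm_sub_translate_diff_le f g c K M e eps N : bounded_holo_on (@Cplus R) K f ->
  bounded_holo_on (@Cplus R) M g -> sup_close e f g -> 0 < eps -> eps < N ->
  (B0norm (fun z => (f z - (translate eps g z - translate N g z + c))%R) <=
   B0norm (fun z => (f z - translate eps f z)%R) + \int[leb]_(a in `]N, +oo[) dsup f a +
   (16 * e * (N - eps) / eps)%:E)%E.
Proof.
move=> fK gM fg eps0 epsN; have N0 := lt_trans eps0 epsN; pose D z : R[i] := f z - g z.
have De : bounded_holo_on (@Cplus R) e D.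
  by move=> z z0; have [] := bounded_holo_onB fK gM z0; split=> //; exact: fg.
have delta0 : 0 < N - eps by rewrite subr_gt0.
have DtB := bounded_holo_translateB De (ltW delta0).
have fB := bounded_holo_translateB fK (ltW eps0).
have fN := bounded_holo_on_translate (ltW N0) fK.
have -> : (fun z => f z - (translate eps g z - translate N g z + c)) =
    (fun z => f z - translate eps f z + translate N f z +
      translate eps (fun z => D z - translate (N - eps) D z) z + (- c)).
  apply/funext => z; rewrite /D /translate.
  have -> : z + eps%:C%C + (N - eps)%:C%C = z + N%:C%C by rewrite rmorphB; ring.
  by ring.
rewrite B0normDc (le_trans (B0normD (bounded_holo_onD fB fN)
  (bounded_holo_on_translate (ltW eps0) DtB))) //.
rewrite (B0norm_translate DtB (ltW eps0)).
apply: leeD; last exact: (dsup_translateB_tail De delta0 eps0).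
by rewrite -(B0norm_translate fK (ltW N0)); exact: (B0normD fB fN).
Qed.

Lemma regularization f K eta : bounded_holo_on (@Cplus R) K f -> (B0norm f < +oo)%E -> 0 < eta ->
  exists eps N e, [/\ 0 < eps, eps < N, 0 < e, e <= eta &
    forall g M c, bounded_holo_on (@Cplus R) M g -> sup_close e f g ->
      (B0norm (fun z => (f z - (translate eps g z - translate N g z + c))%R) <=
       (5 * eta)%:E)%E].
Proof.
move=> fK finf eta0.
have K0 : 0 <= K := bounded_holo_on_ge0 ltr01 (@bounded_holo_on_line_disc _ _ _ fK 1 0).
have [d2 d2_gt0 near0] := dsup_integral_near0 fK finf eta0.
have [N N1 tail] := dsup_integral_tail fK finf eta0.
pose d := d2 / 2; have d0 : 0 < d by rewrite divr_gt0.
have d2E : d + d = d2 by rewrite -splitr.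
have K1 : 0 < 16 * K + 1 by rewrite ltr_wpDl // mulr_ge0.
pose eps := Num.min (Num.min d (1 / 2)) (eta * d / (16 * K + 1)).
have eps0 : 0 < eps by rewrite !lt_min d0 !divr_gt0 ?mulr_gt0.
have epsd : eps <= d by rewrite !ge_min lexx.
have epsN : eps < N.
  by rewrite (lt_le_trans _ N1) // !gt_min; apply/orP; left; apply/orP; right; lra.
have epsK : 16 * K * eps / d <= eta.
  have : eps <= eta * d / (16 * K + 1) by rewrite ge_min lexx orbT.
  by rewrite ler_pdivlMr // ler_pdivrMr // mulrDr mulr1 mulrC; lra.
clearbody eps; have N0 := lt_trans eps0 epsN.
exists eps, N, (Num.min eta (eta * eps / (16 * N))); split=> //.
- by rewrite lt_min eta0 divr_gt0 ?mulr_gt0.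
- by rewrite ge_min lexx.
set e := Num.min _ _; move=> g M c gM fg.
have eN : 16 * e * (N - eps) / eps <= eta.
  have : e <= eta * eps / (16 * N) by rewrite ge_min lexx orbT.
  have : 0 <= e by rewrite le_min ltW // divr_ge0 ?mulr_ge0 // ltW.
  rewrite ler_pdivlMr ?mulr_gt0 // ler_pdivrMr // => e0 eNle; apply: le_trans eNle.
  by rewrite mulrAC mulrC ler_wpM2l // ler_pM2l //; lra.
apply: le_trans (B0norm_sub_translate_diff_le c fK gM fg eps0 epsN) _.
have -> : (5 * eta)%:E = ((eta%:E + eta%:E + eta%:E) + eta%:E + eta%:E)%E.
  by rewrite -!EFinD; congr EFin; ring.
apply: leeD; last by rewrite lee_fin.
apply: leeD tail; apply: le_trans (B0norm_translateB_le fK eps0 epsd) _; rewrite d2E.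
by apply: leeD; [exact: leeD|rewrite lee_fin].
Qed.

Lemma supn_lt_close f g e : (supn (fun z => (f z - g z)%R) < e%:E)%E -> sup_close e f g.
Proof.
move=> fge z z0; rewrite -lee_fin (le_trans _ (ltW fge)) //.
by apply: ereal_sup_ubound; exists z.
Qed.

Lemma supn_le f e : (forall z, Cplus z -> cabs (f z) <= e) -> (supn f <= e%:E)%E.
Proof. by move=> fe; apply: ge_ereal_sup => _ [z z0 <-]; rewrite lee_fin fe. Qed.

(* On Laplace transforms, translation by [s] multiplies the measure by [e^{-st}], and [c]
   is the mass at [0]. *)
Definition stable_translate_diff (Y : set (R[i] -> R[i])) := forall g eps N, Y g ->
  0 < eps -> eps < N -> exists h c, [/\ Y h,
    forall z, Cplus z -> h z = translate eps g z - translate N g z + c &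
    forall b e, 0 < e -> exists A, forall a, A <= a -> cabs (g (a +i* b)%C - c) <= e].

Theorem closB_eq_closInf (Y : set (R[i] -> R[i])) :
  (forall g, Y g -> exists M, bounded_holo_on (@Cplus R) M g) ->
  stable_translate_diff Y -> closB Y = closInf Y.
Proof.
move=> Yholo Ystable; apply/seteqP; split=> f [Bf fY]; split=> // e e0.
  have [g Yg fg] := fY e e0; exists g => //.
  by rewrite (le_lt_trans _ fg) // /Bnorm leeDl // B0norm_ge0.
have [hf finf] := Bf.
have [K fK] : exists K, bounded_holo_on (@Cplus R) K f.
  have [g Yg /supn_lt_close fg] := fY 1 ltr01; have [M gM] := Yholo g Yg.
  exists (1 + M) => z z0; split; first exact: hf.
  have [_ gz] := gM z z0; have := fg z z0; have := lerB_cabs (f z) (g z); lra.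
pose eta := e / 12; have eta0 : 0 < eta by rewrite divr_gt0.
have [eps [N [r [eps0 epsN r0 reta regular]]]] := regularization fK finf eta0.
have [g Yg /supn_lt_close fg] := fY r r0; have [M gM] := Yholo g Yg.
have [h [c [Yh hE gc]]] := Ystable g eps N Yg eps0 epsN; exists h => //.
have B0 : (B0norm (fun z => f z - h z)%R <= (5 * eta)%:E)%E.
  rewrite (eq_B0norm (g := fun z => f z - (translate eps g z - translate N g z + c))).
    exact: regular gM fg.
  by move=> z z0; rewrite hE.
have [L hL] := Yholo h Yh.
have far b t : 0 < t -> exists A, forall a, A <= a ->
    cabs (f (a +i* b)%C - h (a +i* b)%C) <= eta + t.
  move=> t0; have [A gA] := gc b _ (divr_gt0 t0 (ltr0Sn _ 2)).
  exists (Num.max A 1) => a; rewrite ge_max => /andP[Aa a1].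
  have a0 : 0 < a by rewrite (lt_le_trans ltr01).
  have g0 := gA a Aa; have fga := fg (a +i* b)%C a0.
  have geps : cabs (g ((a + eps) +i* b)%C - c) <= t / 3 by apply: gA; lra.
  have gN : cabs (g ((a + N) +i* b)%C - c) <= t / 3 by apply: gA; lra.
  rewrite hE // /translate !complex_addr.
  move: (f _) (g (a +i* b)%C) (g ((a + eps) +i* b)%C) (g ((a + N) +i* b)%C) g0 geps gN fga.
  move=> p q q' q'' g0 geps gN fga.
  have -> : p - (q' - q'' + c) = (p - q) + (q - c) - (q' - c) + (q'' - c) by ring.
  have := le_cabsD (p - q + (q - c) - (q' - c)) (q'' - c).
  have := le_cabsB (p - q + (q - c)) (q' - c); have := le_cabsD (p - q) (q - c).
  by clear -g0 geps gN fga reta; lra.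
have sup := supn_le (sup_le_B0norm (bounded_holo_onB fK hL) B0 far).
rewrite /Bnorm (le_lt_trans (leeD sup B0)) // -EFinD lte_fin /eta; lra.
Qed.

End Regularization.

Section LaplaceKernel.
Variable R : realType.
Implicit Types (z w h : R[i]) (s t : R).

Definition lexp z s : R[i] := cexp (- (z * s%:C%C)).

Lemma cabs_lexp z s : cabs (lexp z s) = expR (- (complex.Re z * s)).
Proof. by rewrite cabs_cexp ReN cReM /= mulr0 subr0. Qed.

Lemma cabs_lexp_le1 z s : 0 <= complex.Re z -> 0 <= s -> cabs (lexp z s) <= 1.
Proof. by move=> z0 s0; rewrite cabs_lexp -expR0 ler_expR oppr_le0 mulr_ge0. Qed.

Lemma lexp0 z : lexp z 0 = 1.
Proof. by rewrite /lexp mulr0 oppr0 cexp0. Qed.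

Lemma lexpD z w s : lexp (z + w) s = lexp z s * lexp w s.
Proof. by rewrite /lexp mulrDl opprD cexpD. Qed.

Lemma lexp_real t s : lexp t%:C%C s = (expR (- (t * s)))%:C%C.
Proof. by rewrite /lexp -rmorphM -rmorphN cexp_real. Qed.

Lemma continuous_lexp z : continuous (lexp z : R -> Cn R).
Proof.
move=> s; have := @continuous_cexp_ray R (- z) 0 s.
by rewrite (_ : (fun t => _) = lexp z) //; apply/funext => t; rewrite mulNr.
Qed.

Lemma sqr_le_expR s : 0 <= s -> s ^+ 2 <= expR (2 * s).
Proof.
move=> s0; rewrite expRM_natl lerXn2r ?nnegrE ?expR_ge0 //.
by rewrite (le_trans _ (expR_ge1Dx _)) // lerDr.
Qed.

Lemma cabs_lexp_taylor z h s : 0 < complex.Re z -> 0 <= s -> cabs h <= complex.Re z / 2 ->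
  cabs (lexp (z + h) s - lexp z s - - s%:C%C * lexp z s * h) <=
  16 / complex.Re z ^+ 2 * cabs h ^+ 2.
Proof.
move=> z0 s0 hz; rewrite lexpD; set x := complex.Re z in z0 hz *.
have -> : lexp z s * lexp h s - lexp z s - - s%:C%C * lexp z s * h =
    lexp z s * (cexp (- (h * s%:C%C)) - 1 - - (h * s%:C%C)) by rewrite -/(lexp h s); ring.
have hs : cabs (- (h * s%:C%C)) = cabs h * s by rewrite cabsN cabsM cabs_real ger0_norm.
have := cabs_cexp_sub1Dx (- (h * s%:C%C)); rewrite hs => taylor.
rewrite cabsM cabs_lexp -/x (le_trans (ler_wpM2l (expR_ge0 _) taylor)) //.
have decay : expR (- (x * s)) * expR (cabs h * s) <= expR (- (x * s / 2)).
  rewrite -expRD ler_expR.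
  have : cabs h * s <= x / 2 * s by rewrite ler_wpM2r.
  by lra.
rewrite mulrCA (le_trans (ler_wpM2l (sqr_ge0 _) decay)) // exprMn mulrAC -mulrA mulrC.
rewrite ler_wpM2r ?sqr_ge0 // expRN (mulrC _^-1) ler_pdivrMr ?expR_gt0 //.
have := @sqr_le_expR (x * s / 4); rewrite divr_ge0 ?mulr_ge0 ?(ltW z0) // => /(_ isT).
have -> : 2 * (x * s / 4) = x * s / 2 by field.
have -> : (x * s / 4) ^+ 2 = s ^+ 2 * x ^+ 2 / 16 by field.
by move=> sq; rewrite mulrAC ler_pdivlMr ?exprn_gt0 //; lra.
Qed.

Lemma cabs_mul_lexp_le z s : 0 < complex.Re z -> 0 <= s ->
  cabs (- s%:C%C * lexp z s) <= (complex.Re z)^-1.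
Proof.
move=> z0 s0; rewrite cabsM cabsN cabs_real ger0_norm // cabs_lexp expRN.
rewrite ler_pdivrMr ?expR_gt0 // ler_pdivlMl // (le_trans _ (expR_ge1Dx _)) //.
by rewrite lerDr.
Qed.

Definition at0 (s : R) : R[i] := (\1_[set (0 : R)] s)%:C%C.

Lemma at0_0 : at0 0 = 1.
Proof. by rewrite /at0 indicE mem_set. Qed.

Lemma at0_neq0 (s : R) : s != 0 -> at0 s = 0.
Proof. by move=> s0; rewrite /at0 indicE memNset //= => /eqP; exact/negP. Qed.

Lemma cabs_at0_le1 (s : R) : cabs (at0 s) <= 1.
Proof.
by have [->|/at0_neq0 ->] := eqVneq s 0; rewrite ?at0_0 ?cabs1 // cabs0.
Qed.

Lemma cabs_lexpB_at0_le z s (r : R) : 0 <= complex.Re z -> 0 <= s ->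
  cabs (lexp z s - at0 s) <= \1_(`]0, r]%classic) s + expR (- (complex.Re z * r)).
Proof.
move=> z0; rewrite le_eqVlt => /orP[/eqP <-|s0].
  by rewrite lexp0 at0_0 subrr cabs0 addr_ge0 ?expR_ge0 // indicE.
rewrite at0_neq0 ?gt_eqF // subr0; have [sr|rs] := leP s r.
  rewrite indicE mem_set /=; last by rewrite in_itv /= s0.
  by rewrite (le_trans (cabs_lexp_le1 z0 (ltW s0))) // lerDl expR_ge0.
by rewrite cabs_lexp ler_wpDl ?indicE // ler_expR lerN2 ler_wpM2l // ltW.
Qed.

End LaplaceKernel.

Section LaplaceIntegral.
Context d (T : measurableType d) (R : realType).
Variables (mu : {measure set T -> \bar R}) (D : set T) (X : T -> R) (g : T -> R[i]).
Hypotheses (mD : measurable D) (mX : measurable_fun D X) (X0 : forall t, D t -> 0 <= X t).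
Hypothesis ig : cintegrable mu D g.
Implicit Types (z w : R[i]).

Definition laplace_integral z : R[i] := cintegral mu D (fun t => lexp z (X t) * g t).

Let gnorm := \int[mu]_(t in D) cabs (g t).

Let gnorm_ge0 : 0 <= gnorm.
Proof. by apply: Rintegral_ge0 => t _; exact: cabs_ge0. Qed.

Let igc := integrable_cabs mD ig.

Let cmeasurable_continuous_comp (phi : R -> R[i]) : continuous (phi : R -> Cn R) ->
  cmeasurable D (fun t => phi (X t)).
Proof.
move=> cphi; split; apply: (measurableT_comp (f := fun s => _ (phi s))) mX;
  apply: continuous_measurable_fun => s.
- exact: continuous_Re (cphi s).
- exact: continuous_Im (cphi s).
Qed.

Lemma laplace_cintegrable z : 0 <= complex.Re z ->
  cintegrable mu D (fun t => lexp z (X t) * g t).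
Proof.
move=> z0; apply: (cintegrableMl mD (C := 1)) ig.
- exact: cmeasurable_continuous_comp (@continuous_lexp R z).
- by move=> t /X0; exact: cabs_lexp_le1.
Qed.

Lemma cabs_laplace_integral_le z : 0 <= complex.Re z -> cabs (laplace_integral z) <= gnorm.
Proof.
move=> z0; apply: (le_cabs_cintegral mD (laplace_cintegrable z0) igc) => t /X0 Xt.
by rewrite cabsM ler_piMl ?cabs_ge0 ?cabs_lexp_le1.
Qed.

Lemma is_cderive_laplace_integral z : 0 < complex.Re z ->
  is_cderive z laplace_integral (cintegral mu D (fun t => - (X t)%:C%C * lexp z (X t) * g t)).
Proof.
move=> z0; set x := complex.Re z; set l := cintegral _ _ _.
have il : cintegrable mu D (fun t => - (X t)%:C%C * lexp z (X t) * g t).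
  apply: (cintegrableMl mD (C := x^-1)) ig; last by move=> t /X0; exact: cabs_mul_lexp_le.
  apply: (@cmeasurable_continuous_comp (fun s => - s%:C%C * lexp z s)) => s.
  exact: (cvgM (cvgN (@continuous_real_complex R s)) (@continuous_lexp R z s)).
apply: (@quadratic_is_cderive R laplace_integral z l (x / 2) (16 / x ^+ 2 * gnorm)).
- by rewrite divr_gt0.
- by rewrite mulr_ge0 // divr_ge0 ?sqr_ge0.
move=> w wx; have zw0 : 0 <= complex.Re (z + w).
  by have := normr_Re_le w => /ler_normlP[]; rewrite ReD -/x; lra.
have iz := laplace_cintegrable (ltW z0); have izw := laplace_cintegrable zw0.
have iw := cintegrableZl mD w il.
rewrite mulrC /laplace_integral -(cintegralZl mD w il) -(cintegralB mD izw iz).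
rewrite -(cintegralB mD (cintegrableB mD izw iz) iw).
have -> : 16 / x ^+ 2 * gnorm * cabs w ^+ 2 = 16 / x ^+ 2 * cabs w ^+ 2 * gnorm by ring.
rewrite -RintegralZl //.
apply: (le_cabs_cintegral mD (cintegrableB mD (cintegrableB mD izw iz) iw)).
  exact: (integrableZl mD _ igc).
move=> t Dt; have -> : lexp (z + w) (X t) * g t - lexp z (X t) * g t -
    w * (- (X t)%:C%C * lexp z (X t) * g t) =
    (lexp (z + w) (X t) - lexp z (X t) - - (X t)%:C%C * lexp z (X t) * w) * g t by ring.
by rewrite cabsM ler_wpM2r ?cabs_ge0 // cabs_lexp_taylor // X0.
Qed.

Lemma bounded_holo_laplace_integral : bounded_holo_on (@Cplus R) gnorm laplace_integral.
Proof.
move=> z z0; split; last exact: cabs_laplace_integral_le (ltW z0).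
exact: is_cderive_derivable (is_cderive_laplace_integral z0).
Qed.

Lemma cintegrable_at0 : cintegrable mu D (fun t => at0 (X t) * g t).
Proof.
apply: (cintegrableMl mD (C := 1)) ig; last by move=> t _; exact: cabs_at0_le1.
split; last by exact: measurable_cst.
rewrite (_ : (fun t => _) = \1_[set (0 : R)] \o X) //.
by apply: measurableT_comp => //; exact: measurable_indic.
Qed.

Lemma cabs_laplace_integralB_at0_le z (r : R) : 0 <= complex.Re z ->
  cabs (laplace_integral z - cintegral mu D (fun t => at0 (X t) * g t)) <=
  \int[mu]_(t in D `&` X @^-1` `]0, r]) cabs (g t) + expR (- (complex.Re z * r)) * gnorm.
Proof.
move=> z0; pose E := D `&` X @^-1` `]0, r].
have mE : measurable E by apply: mX => //; exact: measurable_itv.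
rewrite /laplace_integral -(cintegralB mD (laplace_cintegrable z0) cintegrable_at0).
pose h t := cabs (g t) * \1_E t + expR (- (complex.Re z * r)) * cabs (g t).
have i_near : mu.-integrable D (EFin \o (fun t => cabs (g t) * \1_E t)).
  apply: le_integrable igc => //.
    apply/measurable_EFinP; apply: measurable_funM; last exact: measurable_indic.
    by apply: measurable_cabs; exact: cintegrable_measurable ig.
  move=> t _; rewrite lee_fin normrM ler_piMr ?normr_ge0 // indicE.
  by rewrite ger0_norm // lern1 leq_b1.
have i_far : mu.-integrable D (EFin \o (fun t => expR (- (complex.Re z * r)) * cabs (g t))).
  exact: (integrableZl mD _ igc).
apply: le_trans (le_cabs_cintegral mD (h := h) _ (integrableD mD i_near i_far) _) _.
- exact: cintegrableB (laplace_cintegrable z0) cintegrable_at0.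
- move=> t Dt; rewrite -mulrBl cabsM mulrC /h (mulrC (expR _)) -mulrDr ler_wpM2l ?cabs_ge0 //.
  have -> : \1_E t = \1_(`]0, r]%classic) (X t) :> R.
    by rewrite /E indicI /= !indicE (mem_set Dt) mul1r.
  exact: cabs_lexpB_at0_le z0 (X0 Dt).
rewrite RintegralD // RintegralZl // lerD2r le_eqVlt; apply/orP; left; apply/eqP.
have DE : D `&` E = E by rewrite /E setIA setIid.
rewrite -/E -[in RHS]DE Rintegral_mkcondr; apply: eq_Rintegral => t _.
by rewrite patchE indicE; case: ifPn => _ /=; rewrite ?mulr1 ?mulr0.
Qed.

Lemma laplace_integral_at_infinity (b e : R) : 0 < e -> exists A : R, forall a, A <= a ->
  cabs (laplace_integral (a +i* b)%C - cintegral mu D (fun t => at0 (X t) * g t)) <= e.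
Proof.
move=> e0; have e2 : 0 < e / 2 by rewrite divr_gt0.
pose E n := D `&` X @^-1` `]0, n.+1%:R^-1].
have mE n : measurable (E n) by apply: mX => //; exact: measurable_itv.
have ED n : E n `<=` D by move=> t [].
have [|||n En] := @integral_vanishing_sets R _ _ mu D E
  (EFin \o (fun t => cabs (g t))) mD mE ED igc _ _ _ _ e2.
- by [].
- by move=> t _; rewrite lee_fin cabs_ge0.
- move=> t Dt; exists (Num.bound (X t)^-1) => n nb [_ /=]; rewrite in_itv /= => /andP[Xt0].
  apply/negP; rewrite -ltNge invf_plt ?posrE //.
  by rewrite (lt_le_trans (archi_boundP _)) ?invr_ge0 ?(ltW Xt0) // ler_nat ltnW.
pose r : R := n.+1%:R^-1; have r0 : 0 < r by rewrite invr_gt0.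
exists (gnorm / (e / 2) / r) => a aA.
have a0 : 0 <= a by rewrite (le_trans _ aA) // !divr_ge0 ?gnorm_ge0 // ltW.
have z0 : 0 <= complex.Re ((a +i* b)%C : R[i]) by [].
rewrite (le_trans (cabs_laplace_integralB_at0_le r z0)) // [leRHS]splitr; apply: lerD.
  rewrite -lee_fin /Rintegral fineK; first exact: ltW.
  exact: (integrable_fin_num (mE n) (integrableS mD (mE n) (ED n) igc)).
rewrite expRN mulrC ler_pdivrMr ?expR_gt0 //.
rewrite (le_trans (_ : _ <= e / 2 * (a * r))) //; last first.
  by rewrite ler_pM2l // (le_trans _ (expR_ge1Dx _)) // lerDr.
by move: aA; rewrite !ler_pdivrMr // mulrC.
Qed.

End LaplaceIntegral.

Section DensityMeasure.
Context d (T : measurableType d) (R : realType).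
Variables (mu : {sigma_finite_measure set T -> \bar R}) (w : T -> R).
Hypotheses (mw : measurable_fun setT w) (w0 : forall x, 0 <= w x)
  (iw : mu.-integrable setT (EFin \o w)).

(* The hypotheses are arguments so that the measure structure can be inferred. *)
Definition density_measure (_ : measurable_fun setT w) (_ : forall x, 0 <= w x)
  (_ : mu.-integrable setT (EFin \o w)) (A : set T) : \bar R := (\int[mu]_(x in A) (w x)%:E)%E.

Local Notation nu := (density_measure mw w0 iw).

Let density0 : nu set0 = 0%E.
Proof. by rewrite /density_measure integral_set0. Qed.

Let density_ge0 A : (0 <= nu A)%E.
Proof. by apply: integral_ge0 => x _; rewrite lee_fin. Qed.

Let density_sigma_additive : semi_sigma_additive nu.
Proof.
move=> /= F mF tF mUF; rewrite /density_measure; apply: cvg_toP.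
  apply: ereal_nondecreasing_is_cvgn => m n mn.
  by apply: lee_sum_nneg_natr => // k _ _; exact: density_ge0.
rewrite ge0_integral_bigcup //=.
- by apply: measurable_funTS; exact: measurableT_comp.
- by move=> x _; rewrite lee_fin.
Qed.

HB.instance Definition _ := isMeasure.Build _ _ _ nu density0 density_ge0 density_sigma_additive.

Let density_fin : fin_num_fun nu.
Proof. by move=> A mA; apply: integrable_fin_num => //; exact: integrableS iw. Qed.

HB.instance Definition _ := @Measure_isFinite.Build _ _ _ nu density_fin.

Lemma density_measure_dominates : nu `<< mu.
Proof.
apply/null_content_dominatesP => A mA A0; rewrite /density_measure.
by apply: null_set_integral => //; apply/measurable_funTS/measurableT_comp.
Qed.

Lemma integral_density_measure (f : T -> \bar R) (D : set T) : measurable D ->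
  nu.-integrable D f -> (\int[nu]_(x in D) f x = \int[mu]_(x in D) (f x * (w x)%:E))%E.
Proof.
move=> mD If; have mf := measurable_int _ If.
rewrite -(Radon_Nikodym_change_of_variables density_measure_dominates) //=.
apply: ae_eq_integral => //.
- apply: emeasurable_funM => //; apply: (measurable_int mu).
  apply: (integrableS _ _ (@subsetT _ _)) => //=.
  by apply: Radon_Nikodym_integrable; exact: density_measure_dominates.
- by apply: emeasurable_funM => //; apply/measurable_funTS/measurableT_comp.
- apply: ae_eqe_mul2l => /=; rewrite Radon_NikodymE //=; first exact: density_measure_dominates.
  move=> dominated; case: cid => /= h [h0 ih hE].
  apply: integral_ae_eq => //=; first exact: integrableS ih.
  + by apply/measurable_funTS/measurableT_comp.
  + by move=> E _ mE; rewrite -hE.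
Qed.

Lemma cintegral_density_measure (phi : T -> R[i]) (D : set T) : measurable D ->
  cintegrable nu D phi -> cintegral nu D phi = cintegral mu D (fun t => (w t)%:C%C * phi t).
Proof.
move=> mD [iR iI]; rewrite /cintegral /Rintegral; congr (_ +i* _)%C; congr fine.
- rewrite integral_density_measure //; apply: eq_integral => t _; rewrite /= -EFinM cReM /=.
  by rewrite mul0r subr0 mulrC.
- rewrite integral_density_measure //; apply: eq_integral => t _; rewrite /= -EFinM cImM /=.
  by rewrite mul0r addr0 mulrC.
Qed.

End DensityMeasure.

Lemma finite_measure_cintegrable1 d (T : measurableType d) (R : realType)
    (nu : {finite_measure set T -> \bar R}) (D : set T) :
  measurable D -> cintegrable nu D (fun=> 1).
Proof.
move=> mD; split; apply: measurable_bounded_integrable => //.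
- by rewrite ltey_eq fin_num_measure.
- by exists 1; split; [rewrite num_real|move=> y y1 t _ /=; rewrite normr1 ltW].
- by rewrite ltey_eq fin_num_measure.
- by exists 1; split; [rewrite num_real|move=> y y1 t _ /=; rewrite normr0 (le_trans ler01) // ltW].
Qed.

Section FiniteMeasureTransform.
Variable R : realType.
Implicit Types (nu : {finite_measure set R -> \bar R}) (z : R[i]) (mu : cmeas R) (t : R).
Local Notation I0 := (`[0%R, +oo[%classic : set R).

Lemma half_line_ge0 t : I0 t -> 0 <= t.
Proof. by rewrite /= in_itv /= andbT. Qed.

Let mI0 : measurable I0. Proof. exact: measurable_itv. Qed.
Let mid : measurable_fun I0 (@idfun R). Proof. exact: measurable_id. Qed.
Let i1 nu := finite_measure_cintegrable1 nu mI0.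
Let holo_transform nu := bounded_holo_laplace_integral mI0 mid half_line_ge0 (i1 nu).

Lemma lapRE nu z : 0 <= complex.Re z -> lapR nu z = laplace_integral nu I0 idfun (fun=> 1) z.
Proof.
move=> z0; have [_ iI] := laplace_cintegrable mI0 mid half_line_ge0 (i1 nu) z0.
have ReE t : complex.Re (lexp z t * 1) = expR (- (complex.Re z * t)) * cos (complex.Im z * t).
  by rewrite mulr1 /= ReN ImN cReM cImM /= !mulr0 subr0 add0r cosN.
have ImE t : complex.Im (lexp z t * 1) = - (expR (- (complex.Re z * t)) * sin (complex.Im z * t)).
  by rewrite mulr1 /= ReN ImN cReM cImM /= !mulr0 subr0 add0r sinN mulrN.
rewrite /lapR /laplace_integral /cintegral; congr (_ +i* _)%C.
  by apply: eq_Rintegral => t _; rewrite ReE.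
rewrite -mulN1r -RintegralZl //.
  by apply: eq_Rintegral => t _; rewrite ImE mulN1r.
have := integrableZl mI0 (-1) iI; apply: eq_integrable => // t _.
by rewrite -[LHS]/((-1)%:E * (complex.Im (lexp z t * 1))%:E)%E ImE -EFinM mulN1r opprK.
Qed.

Lemma bounded_holo_lapR nu : exists M, bounded_holo_on (@Cplus R) M (lapR nu).
Proof.
exists (\int[nu]_(t in I0) cabs (1 : R[i])) => z z0; have [dz Mz] := @holo_transform nu z z0.
split; last by rewrite (lapRE nu (ltW z0)).
apply: near_eq_cderivable dz; apply/nbhs_cabsP; exists (complex.Re z); first exact: z0.
by move=> w wz; rewrite (lapRE nu (ltW (cdisc_Cplus (lexx _) wz))).
Qed.

Lemma bounded_holo_lap mu : exists M, bounded_holo_on (@Cplus R) M (lap mu).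
Proof.
have [M1 holo1] := bounded_holo_lapR (cm1 mu); have [M2 holo2] := bounded_holo_lapR (cm2 mu).
have [M3 holo3] := bounded_holo_lapR (cm3 mu); have [M4 holo4] := bounded_holo_lapR (cm4 mu).
exists (M1 + M2 + (M3 + M4)) => z z0.
have [d12 b12] := bounded_holo_onB holo1 holo2 z0.
have [d34 b34] := bounded_holo_onB holo3 holo4 z0.
split; first exact: (cderivableD d12 (cderivableM (@cderivable_cst R 'i%C z) d34)).
by rewrite (le_trans (le_cabsD _ _)) // cabsM cabs_i mul1r lerD.
Qed.

Definition mass0 nu : R[i] := cintegral nu I0 (@at0 R).

Lemma mass0E nu : mass0 nu = cintegral nu I0 (fun t => at0 (idfun t) * 1).
Proof. by apply: eq_cintegral => t _; rewrite mulr1. Qed.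

Lemma lapR_at_infinity nu (b e : R) : 0 < e -> exists A : R, forall a, A <= a ->
  cabs (lapR nu (a +i* b)%C - mass0 nu) <= e.
Proof.
move=> e0; have [A HA] := laplace_integral_at_infinity mI0 mid half_line_ge0 (i1 nu) b e0.
exists (Num.max A 0) => a; rewrite ge_max => /andP[/HA Aa a0].
by rewrite lapRE // mass0E.
Qed.

End FiniteMeasureTransform.

Section Weight.
Variables (R : realType) (eps N : R).
Hypotheses (eps0 : 0 < eps) (epsN : eps < N).
Implicit Types (nu : {finite_measure set R -> \bar R}) (z : R[i]) (mu : cmeas R) (t : R).
Local Notation I0 := (`[0%R, +oo[%classic : set R).

(* [e^{-eps t} - e^{-N t}] on the half-line, plus [1] at [0]: the unit mass contributes
   the constant [mu {0}], which is the limit of the transform at infinity. *)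
Definition weight t : R :=
  \1_[set (0 : R)] t + Num.max 0 (expR (- (eps * t)) - expR (- (N * t))).

Lemma weight_pos t : 0 <= t ->
  weight t = \1_[set (0 : R)] t + (expR (- (eps * t)) - expR (- (N * t))).
Proof.
move=> t0; rewrite /weight max_r // subr_ge0 ler_expR lerN2 ler_wpM2r //.
exact: ltW.
Qed.

Lemma weight_neg t : t < 0 -> weight t = 0.
Proof.
move=> t0; rewrite /weight indicE memNset /=; last by move=> t00; rewrite t00 ltxx in t0.
by rewrite add0r max_l // subr_le0 ler_expR lerN2 ler_nM2r // ltW.
Qed.

Lemma measurable_weight : measurable_fun setT weight.
Proof.
have mexp (a : R) : measurable_fun setT (fun t : R => expR (- (a * t))).
  apply: continuous_measurable_fun => t; apply: continuous_comp; last exact: continuous_expR.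
  by apply: cvgN; apply: cvgM; [exact: cvg_cst|exact: cvg_id].
apply: measurable_funD; first exact: measurable_indic.
by apply: measurable_maxr; [exact: measurable_cst|exact: measurable_funB].
Qed.

Lemma weight_ge0 t : 0 <= weight t.
Proof. by rewrite addr_ge0 ?indicE // le_max lexx. Qed.

Lemma weight_le2 t : weight t <= 2.
Proof.
have [t0|/weight_neg -> //] := leP 0 t; rewrite weight_pos //.
have : \1_[set (0 : R)] t <= 1 :> R by rewrite indicE lern1 leq_b1.
have : expR (- (eps * t)) <= 1 by rewrite -expR0 ler_expR oppr_le0 mulr_ge0 // ltW.
by have := expR_ge0 (- (N * t)); lra.
Qed.

Lemma weight_integrable nu : nu.-integrable setT (EFin \o weight).
Proof.
apply: measurable_bounded_integrable => //.
- by rewrite ltey_eq fin_num_measure.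
- exact: measurable_weight.
- exists 2; split; first by rewrite num_real.
  by move=> y y2 t _ /=; rewrite ger0_norm ?weight_ge0 // (le_trans (weight_le2 t)) // ltW.
Qed.

Definition weighted nu : {finite_measure set R -> \bar R} :=
  density_measure measurable_weight weight_ge0 (weight_integrable nu).

Lemma weighted_neg nu : weighted nu `]-oo, 0%R[ = 0%E.
Proof. by apply: integral0_eq => t; rewrite /= in_itv /= => /weight_neg ->. Qed.

Lemma lapR_weighted nu z : Cplus z ->
  lapR (weighted nu) z = translate eps (lapR nu) z - translate N (lapR nu) z + mass0 nu.
Proof.
move=> z0; have mI0 : measurable I0 by exact: measurable_itv.
have mid : measurable_fun I0 (@idfun R) by exact: measurable_id.
have iw := finite_measure_cintegrable1 (weighted nu) mI0.
have i1 := finite_measure_cintegrable1 nu mI0.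
have ze : 0 <= complex.Re (z + eps%:C%C) by apply: ltW; apply: Cplus_translate; rewrite ?ltW.
have zN : 0 <= complex.Re (z + N%:C%C).
  by apply: ltW; apply: Cplus_translate => //; rewrite ltW // (lt_trans eps0).
have ie := laplace_cintegrable mI0 mid (@half_line_ge0 R) i1 ze.
have iN := laplace_cintegrable mI0 mid (@half_line_ge0 R) i1 zN.
have i0 := cintegrable_at0 mI0 mid i1.
have iz := laplace_cintegrable mI0 mid (@half_line_ge0 R) iw (ltW z0).
rewrite /translate !lapRE ?(ltW z0) // /laplace_integral cintegral_density_measure //.
rewrite mass0E -(cintegralB mI0 ie iN) -(cintegralD mI0 (cintegrableB mI0 ie iN) i0).
apply: eq_cintegral => t /half_line_ge0 t0; rewrite weight_pos // !mulr1 !lexpD !lexp_real /=.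
have [->|t_neq0] := eqVneq t 0.
  by rewrite !mulr0 !oppr0 expR0 subrr addr0 -/(at0 0) at0_0 lexp0; ring.
rewrite at0_neq0 // indicE memNset; last by move/eqP: t_neq0.
by rewrite add0r addr0 rmorphB; ring.
Qed.

Definition weighted_cmeas mu : cmeas R :=
  CMeas (weighted (cm1 mu)) (weighted (cm2 mu)) (weighted (cm3 mu)) (weighted (cm4 mu)).

Lemma weighted_cmeas_vanish mu (A : set R) : measurable A ->
  (forall B, measurable B -> B `<=` A -> cmval mu B = 0) -> cmval (weighted_cmeas mu) A = 0.
Proof.
move=> mA mu0.
have same (nu nu' : {finite_measure set R -> \bar R}) :
    (forall B, measurable B -> B `<=` A -> fine (nu B) - fine (nu' B) = 0) ->
    fine (weighted nu A) - fine (weighted nu' A) = 0.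
  move=> nuE; apply/eqP; rewrite subr_eq0; apply/eqP; congr fine.
  apply: eq_measure_integral => B mB BA; have /eqP := nuE B mB BA.
  rewrite subr_eq0 => /eqP fineE; rewrite -[LHS]fineK ?fin_num_measure // fineE fineK //.
  exact: fin_num_measure.
apply: complex_ext => /=; apply: same => B mB BA; have := mu0 B mB BA.
  by move=> /(congr1 (@complex.Re R)).
by move=> /(congr1 (@complex.Im R)).
Qed.

End Weight.

Section MeasureSpaces.
Variable R : realType.
Implicit Types (P : cmeas R -> Prop) (mu : cmeas R).

Definition weight_stable P := forall eps N mu (eps0 : 0 < eps) (epsN : eps < N),
  P mu -> P (weighted_cmeas eps0 epsN mu).

Lemma weight_stable_translate_diff P : weight_stable P -> stable_translate_diff (LN P).
Proof.
move=> Pw _ eps N [mu [_ Pmu ->]] eps0 epsN.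
exists (lap (weighted_cmeas eps0 epsN mu)),
  ((mass0 (cm1 mu) - mass0 (cm2 mu)) + 'i%C * (mass0 (cm3 mu) - mass0 (cm4 mu))).
split=> [|z z0|b e e0].
- by exists (weighted_cmeas eps0 epsN mu); split=> //; [split; exact: weighted_neg|exact: Pw].
- by rewrite /lap /= !(lapR_weighted eps0 epsN) // /translate /lap; ring.
have e4 : 0 < e / 4 by rewrite divr_gt0.
have [A1 far1] := lapR_at_infinity (cm1 mu) b e4; have [A2 far2] := lapR_at_infinity (cm2 mu) b e4.
have [A3 far3] := lapR_at_infinity (cm3 mu) b e4; have [A4 far4] := lapR_at_infinity (cm4 mu) b e4.
exists (Num.max (Num.max A1 A2) (Num.max A3 A4)) => a; rewrite !ge_max.
move=> /andP[/andP[/far1 {}far1 /far2 {}far2] /andP[/far3 {}far3 /far4 {}far4]].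
rewrite /lap; move: (lapR (cm1 mu) _) (lapR (cm2 mu) _) (lapR (cm3 mu) _) (lapR (cm4 mu) _)
  far1 far2 far3 far4 => l1 l2 l3 l4 far1 far2 far3 far4.
have -> : l1 - l2 + 'i%C * (l3 - l4) -
    (mass0 (cm1 mu) - mass0 (cm2 mu) + 'i%C * (mass0 (cm3 mu) - mass0 (cm4 mu))) =
    (l1 - mass0 (cm1 mu)) - (l2 - mass0 (cm2 mu)) +
    'i%C * ((l3 - mass0 (cm3 mu)) - (l4 - mass0 (cm4 mu))) by ring.
rewrite (le_trans (le_cabsD _ _)) // cabsM cabs_i mul1r.
have := le_cabsB (l1 - mass0 (cm1 mu)) (l2 - mass0 (cm2 mu)).
have := le_cabsB (l3 - mass0 (cm3 mu)) (l4 - mass0 (cm4 mu)); lra.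
Qed.

Theorem LN_closB P : weight_stable P -> closB (LN P) = closInf (LN P).
Proof.
move=> Pw; apply: closB_eq_closInf; last exact: weight_stable_translate_diff.
by move=> _ [mu [_ _ ->]]; exact: bounded_holo_lap.
Qed.

Lemma weight_stable_Mall : weight_stable (@Mall R).
Proof. by []. Qed.

Lemma weight_stable_Mac : weight_stable (@Mac R).
Proof.
move=> eps N mu eps0 epsN muac A mA A0; apply: weighted_cmeas_vanish => // B mB BA.
apply: muac => //; apply/eqP; rewrite -measure_le0 -A0.
by apply: le_measure => //; rewrite inE.
Qed.

Lemma weight_stable_Mdisc : weight_stable (@Mdisc R).
Proof.
move=> eps N mu eps0 epsN [S [cS muS]]; exists S; split=> // A mA AS.
apply: weighted_cmeas_vanish => // B mB BA; apply: muS => //.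
by rewrite -subset0 -AS; exact: setSI.
Qed.

Lemma weight_stable_Msing : weight_stable (@Msing R).
Proof.
move=> eps N mu eps0 epsN [mu_atom [S [mS S0 muS]]]; split=> [t|].
  apply: weighted_cmeas_vanish => // B mB /subset_set1[->|-> //].
  by rewrite /cmval !measure0 /= subrr.
exists S; split=> // A mA AS; apply: weighted_cmeas_vanish => // B mB BA; apply: muS => //.
by rewrite -subset0 -AS; exact: setSI.
Qed.

End MeasureSpaces.

Section BorelDisplay.
Variable R : realType.

(* Lebesgue measure lives on [measurableTypeR R], which differs from [R] only by its display. *)
Definition borel_val (t : measurableTypeR R) : R := t.

Lemma measurable_borel_val (D : set (measurableTypeR R)) : measurable_fun D borel_val.
Proof. by move=> mD A mA; exact: measurableI. Qed.

End BorelDisplay.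

Section TruncatedResolvent.
Variable R : realType.
Implicit Types (z w : R[i]) (T s l e : R).
Local Notation leb := (@lebesgue_measure R).

Definition truncated_resolvent T w : R[i] := itv_integral 0 T (lexp w).

Lemma itv_lexp_cintegrable (a b : R) w : cintegrable leb `[a, b] (lexp w).
Proof. by apply: continuous_itv_cintegrable => t _; exact: continuous_lexp. Qed.

(* Damping by [e^{-st}] makes this the Laplace integral of [e^{st}] on [[0, T]]. *)
Lemma cderivable_truncated_resolvent T w : cderivable (truncated_resolvent T) w.
Proof.
pose s : R := 1 - complex.Re w; pose g (t : R) := lexp (- s%:C%C) t.
have mT : measurable (`[0, T] : set (measurableTypeR R)) by exact: measurable_itv.
have pos (t : measurableTypeR R) : `[0, T]%classic t -> 0 <= borel_val t.
  by rewrite /= in_itv /= => /andP[].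
have dL : cderivable (laplace_integral leb `[0, T] (@borel_val R) g)
    (w + s%:C%C).
  apply: is_cderive_derivable.
  have ig := itv_lexp_cintegrable 0 T (- s%:C%C).
  apply: (is_cderive_laplace_integral mT (@measurable_borel_val _ _) pos ig).
  by rewrite ReD /= addrC subrK ltr01.
apply: (@near_eq_cderivable R (fun v =>
    laplace_integral leb `[0, T] (@borel_val R) g (v + s%:C%C))).
  apply/nbhs_cabsP; exists 1 => // v _; apply: eq_cintegral => t _.
  by rewrite -lexpD addrK.
exact: cderivable_comp (cderivableD (@cderivable_id R w) (@cderivable_cst R s%:C%C w)) dL.
Qed.

Lemma cabs_truncated_resolvent_le T w : 0 <= T ->
  cabs (truncated_resolvent T w) <= T * expR (T * cabs w).
Proof.
move=> T0; rewrite mulrC -[X in _ * X]subr0.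
apply: (le_cabs_itv_integral T0 (itv_lexp_cintegrable _ _ _)) => t /andP[t0 tT].
rewrite cabs_lexp ler_expR -mulNr -ReN mulrC (le_trans (_ : _ <= t * cabs w)) //.
  by rewrite ler_wpM2l // -cabsN Re_le_cabs.
by rewrite ler_wpM2r ?cabs_ge0.
Qed.

Lemma mul_truncated_resolvent T w : 0 <= T -> w * truncated_resolvent T w = 1 - lexp w T.
Proof.
move=> T0; have cf : continuous_on_itv 0 T (fun t => - w * cexp (- w * (t +i* 0)%C)).
  by move=> t _; exact: (cvgM (cvg_cst _) (@continuous_cexp_ray R (- w) 0 t)).
have := @itv_integral_primitive R (fun v => cexp (- w * v)) (fun v => - w * cexp (- w * v)) 0 0 T T0
  (fun t _ => is_cderive_cexpMl (- w) (t +i* 0)%C) cf.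
have -> : cexp (- w * (T +i* 0)%C) = lexp w T by rewrite mulNr.
have -> : cexp (- w * (0 +i* 0)%C) = 1 by rewrite mulNr -(lexp0 w).
move=> primE; rewrite -[RHS]opprB -primE /itv_integral /truncated_resolvent -mulN1r.
have mT : measurable (`[0, T] : set (measurableTypeR R)) by exact: measurable_itv.
rewrite /itv_integral -(cintegralZl mT w (itv_lexp_cintegrable _ _ _)).
rewrite -(cintegralZl mT (-1) (continuous_itv_cintegrable cf)).
by apply: eq_cintegral => t _; rewrite /lexp mulN1r !mulNr opprK.
Qed.

Lemma truncated_resolvent_decay T w : 0 <= T -> 0 <= complex.Re w -> w != 0 ->
  cabs (truncated_resolvent T w) <= 2 / cabs w.
Proof.
move=> T0 w0 w_neq0; rewrite ler_pdivlMr ?cabs_gt0 // mulrC -cabsM mul_truncated_resolvent //.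
rewrite (le_trans (le_cabsB _ _)) // cabs1.
by have := cabs_lexp_le1 w0 T0; lra.
Qed.

Lemma C0cl_truncated_resolvent T : 0 <= T -> C0cl (truncated_resolvent T).
Proof.
move=> T0; apply: continuous_C0cl => [w _|e e0].
  exact: cderivable_continuous (@cderivable_truncated_resolvent T w).
exists (2 / e) => w w0 ew; have w_gt0 : 0 < cabs w by rewrite (lt_trans _ ew) ?divr_gt0.
rewrite (le_lt_trans (truncated_resolvent_decay T0 w0 _)) -?cabs_gt0 //.
by rewrite ltr_pdivrMr // mulrC -ltr_pdivrMr.
Qed.

Lemma truncated_resolvent_close l e : 0 < l -> 0 < e -> exists2 T, 0 <= T &
  sup_close e (fun z => (z + l%:C%C)^-1) (fun z => truncated_resolvent T (z + l%:C%C)).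
Proof.
move=> l0 e0; pose T := (e * l)^-1 / l.
have T0 : 0 <= T by rewrite divr_ge0 ?invr_ge0 ?mulr_ge0 // ltW.
exists T => // z z0; have zl := halfplane_addr_neq0 (ltW z0) l0.
have -> : (z + l%:C%C)^-1 - truncated_resolvent T (z + l%:C%C) =
    (z + l%:C%C)^-1 * lexp (z + l%:C%C) T.
  apply: (mulfI zl); rewrite mulrBr mul_truncated_resolvent // mulfV // mulrA mulfV //.
  by rewrite mul1r subKr.
have lexp_le : cabs (lexp (z + l%:C%C) T) <= e * l.
  rewrite lexpD cabsM (le_trans (ler_piMl (cabs_ge0 _) (cabs_lexp_le1 (ltW z0) T0))) //.
  rewrite cabs_lexp /= expRN invf_ple ?posrE ?expR_gt0 ?mulr_gt0 //.
  by rewrite /T mulrCA mulfV ?gt_eqF // mulr1 (le_trans _ (expR_ge1Dx _)) // lerDr.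
have res_le := cabs_resolvent_le (ltW z0) l0.
rewrite cabsM (le_trans (ler_pM (cabs_ge0 _) (cabs_ge0 _) res_le lexp_le)) //.
by rewrite mulrCA mulVf ?gt_eqF // mulr1.
Qed.

End TruncatedResolvent.

Section DenseSpaces.
Variable R : realType.
Implicit Types (f g h : R[i] -> R[i]) (z : R[i]) (Y : set (R[i] -> R[i])) (s l e : R).

Definition lin_stable Y := forall (c : R[i]) f g, Y f -> Y g ->
  exists2 h, Y h & forall z, Cplus z -> h z = f z + c * g z.

Definition translate_stable Y := forall f s, Y f -> 0 <= s ->
  exists2 h, Y h & forall z, Cplus z -> h z = translate s f z.

Definition approx_resolvents Y := forall l e, 0 < l -> 0 < e ->
  exists2 g, Y g & sup_close e (fun z => (z + l%:C%C)^-1) g.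

Lemma C0cl_stable_translate_diff Y : lin_stable Y -> translate_stable Y ->
  (forall g, Y g -> C0cl g) -> stable_translate_diff Y.
Proof.
move=> Ylin Ytr YC g eps N Yg eps0 epsN; have [_ vg] := C0cl_elim (YC g Yg).
have [h1 Yh1 h1E] := Ytr g eps Yg (ltW eps0).
have [h2 Yh2 h2E] := Ytr g N Yg (ltW (lt_trans eps0 epsN)).
have [h Yh hE] := Ylin (-1) h1 h2 Yh1 Yh2; exists h, 0; split=> // [z z0|b e e0].
  by rewrite hE // h1E // h2E // mulN1r addr0.
have [M gM] := vg e e0; exists (Num.max 1 (M + 1)) => a; rewrite ge_max => /andP[a1 aM].
rewrite subr0; apply: gM; first exact: lt_le_trans ltr01 a1.
by rewrite (lt_le_trans _ (Re_le_cabs _)) //= (lt_le_trans _ aM) // ltrDl.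
Qed.

Lemma C0cl_bounded_holo f : holo f -> C0cl f -> exists M, bounded_holo_on (@Cplus R) M f.
Proof.
by move=> hf /C0cl_bounded[M fM]; exists M => z z0; split; [exact: hf|exact: fM].
Qed.

Theorem C0cl_closB_eq_closInf Y : (forall g, Y g -> holo g) -> (forall g, Y g -> C0cl g) ->
  lin_stable Y -> translate_stable Y -> closB Y = closInf Y.
Proof.
move=> Yh YC Ylin Ytr; apply: closB_eq_closInf; last exact: C0cl_stable_translate_diff.
by move=> g Yg; apply: C0cl_bounded_holo; [exact: Yh|exact: YC].
Qed.

Lemma approx_resolvents_dense Y f : lin_stable Y -> approx_resolvents Y -> holo f -> C0cl f ->
  forall e, 0 < e -> exists2 g, Y g & sup_close e f g.
Proof.
move=> Ylin Yres hf f0.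
apply: (C0cl_resolvent_span hf f0
  (P := fun f => forall e, 0 < e -> exists2 g, Y g & sup_close e f g)).
- by move=> l l0 e; exact: Yres.
- move=> c f1 f2 close1 close2 e e0; have e2 : 0 < e / 2 by rewrite divr_gt0.
  have k0 : 0 < 1 + cabs c by rewrite ltr_pwDl // cabs_ge0.
  have [g1 Yg1 fg1] := close1 _ e2; have [g2 Yg2 fg2] := close2 _ (divr_gt0 e2 k0).
  have [h Yh hE] := Ylin c g1 g2 Yg1 Yg2; exists h => // z z0.
  rewrite hE // opprD addrACA -mulrBr (le_trans (le_cabsD _ _)) // [leRHS]splitr lerD ?fg1 //.
  rewrite cabsM; have := fg2 z z0; rewrite ler_pdivlMr // mulrDr mulr1 (mulrC (cabs c)).
  by have := cabs_ge0 (f2 z - g2 z); lra.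
- move=> h hY e e0; have e2 : 0 < e / 2 by rewrite divr_gt0.
  have [f1 f1Y hf1] := hY _ e2; have [g Yg f1g] := f1Y _ e2; exists g => // z z0.
  have := hf1 z z0; have := f1g z z0; have := cabs_distD (f1 z) (h z) (g z).
  by lra.
Qed.

Theorem closB_C0cl Y : closB Y = closInf Y -> (forall g, Y g -> C0cl g) ->
  lin_stable Y -> approx_resolvents Y -> closB Y = [set f | Bspace f /\ C0cl f].
Proof.
move=> -> YC Ylin Yres; apply/seteqP; split=> f [Bf fY]; split=> //.
  apply: C0cl_sup_closed => e e0; have [g Yg fg] := fY e e0.
  by exists g; [exact: YC|exact: supn_lt_close].
have [hf _] := Bf => e e0.
have [g Yg fg] := approx_resolvents_dense Ylin Yres hf fY (divr_gt0 e0 (ltr0Sn _ 1)).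
by exists g => //; rewrite (le_lt_trans (supn_le fg)) // lte_fin; lra.
Qed.

End DenseSpaces.

Section RationalFunctions.
Variable R : realType.
Implicit Types (p q : {poly R[i]}) (z : R[i]).

Lemma cderivable_horner p z : cderivable (horner p) z.
Proof.
elim/poly_ind: p => [|p c dp].
  rewrite (_ : horner 0 = fun=> 0); first exact: cderivable_cst.
  by apply/funext => w; rewrite horner0.
rewrite (_ : horner _ = fun w => p.[w] * w + c); last by apply/funext => w; rewrite hornerMXaddC.
exact: cderivableD (cderivableM dp (@cderivable_id R z)) (@cderivable_cst R c z).
Qed.

Lemma cderivable_rat p q z : q.[z] != 0 -> cderivable (fun z => p.[z] / q.[z]) z.
Proof.
move=> qz; have dp := @cderivable_horner p z; have dq := @cderivable_horner q z.
exact: cderivableM dp (cderivableV dq qz).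
Qed.

Lemma poly_growth_le p m : (size p <= m)%N -> exists2 C : R, 0 <= C &
  forall z, 1 <= cabs z -> cabs p.[z] * cabs z <= C * cabs z ^+ m.
Proof.
move=> pm; exists (\sum_(i < m) cabs p`_i); first by apply: sumr_ge0 => i _; exact: cabs_ge0.
move=> z z1; rewrite (horner_coef_wide _ pm) !mulr_suml.
apply: (@le_trans _ _ ((\sum_(i < m) cabs (p`_i * z ^+ i)) * cabs z)).
  rewrite ler_wpM2r ?cabs_ge0 //.
  elim/big_ind2: _ => [|x1 x2 y1 y2 h1 h2|//]; first by rewrite cabs0.
  by rewrite (le_trans (le_cabsD _ _)) // lerD.
rewrite mulr_suml; apply: ler_sum => i _; rewrite cabsM cabsX -mulrA -exprSr.
by rewrite ler_wpM2l ?cabs_ge0 // ler_weXn2l.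
Qed.

Lemma poly_growth_ge q m : size q = m.+1 -> exists2 c : R, 0 < c & exists M : R,
  forall z, M < cabs z -> c * cabs z ^+ m <= cabs q.[z].
Proof.
move=> qm; pose L := cabs (lead_coef q).
have L0 : 0 < L by rewrite cabs_gt0 lead_coef_eq0 -size_poly_gt0 qm.
pose low := q - lead_coef q *: 'X^m.
have [C C0 lowC] : exists2 C : R, 0 <= C &
    forall z, 1 <= cabs z -> cabs low.[z] * cabs z <= C * cabs z ^+ m.
  apply: poly_growth_le; apply/leq_sizeP => j mj; rewrite coefB coefZ coefXn.
  have [->|jm] := eqVneq j m; first by rewrite mulr1 lead_coefE qm subrr.
  by rewrite mulr0 subr0 nth_default // qm ltn_neqAle eq_sym jm.
exists (L / 2); first by rewrite divr_gt0.
exists (Num.max 1 (2 * C / L)) => z; rewrite gt_max => /andP[z1 zC].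
have z0 := lt_trans ltr01 z1; have zm : 0 < cabs z ^+ m by rewrite exprn_gt0.
have qE : q.[z] = lead_coef q * z ^+ m + low.[z].
  by rewrite /low hornerD hornerN hornerZ hornerXn addrC subrK.
have low_le : cabs low.[z] <= L / 2 * cabs z ^+ m.
  rewrite -(ler_pM2r z0) (le_trans (lowC z (ltW z1))) // mulrAC ler_pM2r //.
  by move: zC; rewrite ltr_pdivrMr //; lra.
have := lerB_cabs (lead_coef q * z ^+ m) (- low.[z]); rewrite opprK -qE cabsN cabsM cabsX -/L.
by move: (_ ^+ m) (cabs q.[z]) (cabs low.[z]) low_le => X Y Z low_le; lra.
Qed.

Lemma rat_decay p q : (size p < size q)%N -> forall e : R, 0 < e -> exists M : R,
  forall z, M < cabs z -> cabs (p.[z] / q.[z]) < e.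
Proof.
case qm : (size q) => [//|m]; rewrite ltnS => pm e e0.
have [C C0 pC] := poly_growth_le pm; have [c c0 [M qM]] := poly_growth_ge qm.
exists (Num.max (Num.max M 1) (C / c / e)) => z; rewrite !gt_max => /andP[/andP[zM z1] zC].
have z0 := lt_trans ltr01 z1; have zm : 0 < cabs z ^+ m by rewrite exprn_gt0.
have qz : 0 < cabs q.[z] by rewrite (lt_le_trans _ (qM z zM)) // mulr_gt0.
rewrite cabsM cabsV ltr_pdivrMr // -(ltr_pM2r z0) (le_lt_trans (pC z (ltW z1))) //.
apply: (@lt_le_trans _ _ (e * (c * cabs z ^+ m) * cabs z)); last first.
  by rewrite ler_pM2r // ler_pM2l // qM.
have -> : e * (c * cabs z ^+ m) * cabs z = e * c * cabs z * cabs z ^+ m by ring.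
by rewrite ltr_pM2r //; move: zC; rewrite !ltr_pdivrMr // (mulrC (cabs z)) mulrAC.
Qed.

Lemma denominator_neq0 q z : (forall z, root q z -> complex.Re z < 0) -> 0 <= complex.Re z ->
  q.[z] != 0.
Proof. by move=> rootq z0; apply: contraTneq z0 => /rootP/rootq; rewrite -ltNge. Qed.

Lemma R0_C0cl g : R0 R g -> C0cl g.
Proof.
move=> [p [q [pq rootq ->]]]; apply: continuous_C0cl => [z z0|e e0].
  have dpq := cderivable_rat (p := p) (denominator_neq0 rootq z0).
  exact: cderivable_continuous dpq.
by have [M pqM] := rat_decay pq e0; exists M => z _; exact: pqM.
Qed.

Lemma R0_holo g : R0 R g -> holo g.
Proof.
move=> [p [q [pq rootq ->]]] z z0.
exact: (cderivable_rat (p := p) (denominator_neq0 rootq (ltW z0))).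
Qed.

Lemma R0_lin : lin_stable (R0 R).
Proof.
move=> c _ _ [p1 [q1 [pq1 rootq1 ->]]] [p2 [q2 [pq2 rootq2 ->]]].
exists (fun z => (p1 * q2 + c *: (p2 * q1)).[z] / (q1 * q2).[z]).
  exists (p1 * q2 + c *: (p2 * q1)), (q1 * q2); split=> //; last first.
    by move=> z; rewrite rootM => /orP[/rootq1|/rootq2].
  have q1_gt0 : (0 < size q1)%N by exact: leq_ltn_trans pq1.
  have q2_gt0 : (0 < size q2)%N by exact: leq_ltn_trans pq2.
  rewrite size_mul -?size_poly_gt0 // (leq_ltn_trans (size_polyD _ _)) // gtn_max.
  apply/andP; split.
    rewrite (leq_ltn_trans (size_polyMleq _ _)) //.
    by rewrite -ltnS !prednK ?addn_gt0 ?q2_gt0 ?orbT // ltn_add2r.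
  rewrite (leq_ltn_trans (size_scale_leq _ _)) // (leq_ltn_trans (size_polyMleq _ _)) //.
  by rewrite -ltnS !prednK ?addn_gt0 ?q1_gt0 ?orbT // addnC ltn_add2l.
move=> z z0; have q1z := denominator_neq0 rootq1 (ltW z0).
have q2z := denominator_neq0 rootq2 (ltW z0); rewrite hornerD hornerZ !hornerM.
by move: (p1.[z]) (p2.[z]) (q1.[z]) (q2.[z]) q1z q2z => a b k l k0 l0; field; rewrite k0 l0.
Qed.

Lemma R0_translate : translate_stable (R0 R).
Proof.
move=> _ s [p [q [pq rootq ->]]] s0; pose shift (r : {poly R[i]}) := r \Po ('X + (s%:C)%C%:P).
exists (fun z => (shift p).[z] / (shift q).[z]).
  exists (shift p), (shift q); split=> //; first by rewrite !size_comp_poly2 ?size_XaddC.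
  by move=> z; rewrite /root horner_comp !hornerE => /rootq; rewrite ReD /=; lra.
by move=> z _; rewrite !horner_comp !hornerE.
Qed.

Lemma R0_resolvents : approx_resolvents (R0 R).
Proof.
move=> l e l0 e0; exists (fun z => (1 : {poly R[i]}).[z] / ('X + (l%:C)%C%:P).[z]).
  exists 1, ('X + (l%:C)%C%:P); split=> //; first by rewrite size_XaddC size_poly1.
  by move=> z; rewrite /root !hornerE addr_eq0 => /eqP ->; rewrite ReN /=; lra.
by move=> z _; rewrite !hornerE ?mul1r subrr cabs0 ltW.
Qed.

End RationalFunctions.

Section EntireFunctions.
Variable R : realType.
Implicit Types (f g : R[i] -> R[i]) (z : R[i]).

Definition exponential_type f :=
  exists A B : R, [/\ 0 <= A, 0 <= B & forall z, cabs (f z) <= A * expR (B * cabs z)].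

Lemma J0P f : J0 R f <-> [/\ forall z, cderivable f z, exponential_type f & C0cl f].
Proof.
split=> [[df [A [B fAB]] _ f0]|[df [A [B [_ _ fAB]]] f0]]; split=> //.
- exists `|A|, `|B|; split=> // z; rewrite (le_trans (fAB z)) //.
  rewrite (le_trans (ler_wpM2r (expR_ge0 _) (ler_norm A))) // ler_wpM2l //.
  by rewrite ler_expR ler_wpM2r ?cabs_ge0 ?ler_norm.
- by exists A, B.
- by have [M fM] := C0cl_bounded f0; rewrite (le_lt_trans (supn_le fM)) // ltry.
Qed.

Lemma J0_C0cl g : J0 R g -> C0cl g.
Proof. by move=> /J0P[]. Qed.

Lemma J0_holo g : J0 R g -> holo g.
Proof. by move=> /J0P[dg _ _] z _; exact: dg. Qed.

Lemma J0_lin : lin_stable (J0 R).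
Proof.
move=> c f g /J0P[df [A [B [A0 B0 fAB]]] f0] /J0P[dg [C [D [C0 D0 gCD]]] g0].
exists (fun z => f z + c * g z); last by [].
apply/J0P; split; last exact: C0cl_lin_closed.
  by move=> z; exact: cderivableD (df z) (cderivableM (@cderivable_cst R c z) (dg z)).
exists (A + cabs c * C), (B + D); split; rewrite ?addr_ge0 ?mulr_ge0 ?cabs_ge0 // => z.
rewrite (le_trans (le_cabsD _ _)) // mulrDl cabsM -mulrA; apply: lerD.
  by rewrite (le_trans (fAB z)) // ler_wpM2l // ler_expR ler_wpM2r ?cabs_ge0 // lerDl.
rewrite ler_wpM2l ?cabs_ge0 // (le_trans (gCD z)) // ler_wpM2l // ler_expR.
by rewrite ler_wpM2r ?cabs_ge0 // lerDr.
Qed.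

Lemma J0_translate : translate_stable (J0 R).
Proof.
move=> g s /J0P[dg [A [B [A0 B0 gAB]]] g0] s0; exists (translate s g); last by [].
apply/J0P; split.
- move=> z.
  exact: cderivable_comp (cderivableD (@cderivable_id R z) (@cderivable_cst R s%:C%C z)) (dg _).
- exists (A * expR (B * s)), B; split; rewrite ?mulr_ge0 ?expR_ge0 // => z.
  rewrite (le_trans (gAB _)) // -mulrA ler_wpM2l // -expRD ler_expR -mulrDr ler_wpM2l //.
  by rewrite (le_trans (le_cabsD _ _)) // cabs_real ger0_norm // addrC.
- exact: C0cl_translate.
Qed.

Lemma J0_resolvents : approx_resolvents (J0 R).
Proof.
move=> l e l0 e0; have [T T0 Tclose] := truncated_resolvent_close l0 e0.
have [h Jh hE] : exists2 h, J0 R h &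
    forall z, Cplus z -> h z = translate l (truncated_resolvent T) z.
  apply: J0_translate (ltW l0); apply/J0P; split; last exact: C0cl_truncated_resolvent.
    by move=> z; exact: cderivable_truncated_resolvent.
  by exists T, T; split=> // z; exact: cabs_truncated_resolvent_le.
by exists h => // z z0; rewrite hE //; exact: Tclose.
Qed.

End EntireFunctions.

Section DensityTransform.
Variable R : realType.
Implicit Types (f g : R -> R) (w v : R -> R[i]) (z : R[i]) (a b e T : R).
Local Notation leb := (@lebesgue_measure R).
Local Notation I0 := (`[0%R, +oo[%classic : set (measurableTypeR R)).

Definition density_transform w z : R[i] := cintegral leb I0 (fun t => lexp z t * w t).

Let mI0 : measurable I0. Proof. exact: measurable_itv. Qed.

Lemma density_cintegrable (D : set (measurableTypeR R)) w z : measurable D -> D `<=` I0 ->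
  cintegrable leb D w -> 0 <= complex.Re z -> cintegrable leb D (fun t => lexp z t * w t).
Proof.
move=> mD D0 iw z0; have pos t : D t -> 0 <= borel_val t by move=> /D0; exact: half_line_ge0.
exact: (laplace_cintegrable mD (@measurable_borel_val R D) pos iw z0).
Qed.

Lemma cabs_density_integral_le (D : set (measurableTypeR R)) w z : measurable D -> D `<=` I0 ->
  cintegrable leb D w -> 0 <= complex.Re z ->
  cabs (cintegral leb D (fun t => lexp z t * w t)) <= \int[leb]_(t in D) cabs (w t).
Proof.
move=> mD D0 iw z0; have pos t : D t -> 0 <= borel_val t by move=> /D0; exact: half_line_ge0.
exact: (cabs_laplace_integral_le mD (@measurable_borel_val R D) pos iw z0).
Qed.

Lemma density_transform_lin (c : R[i]) w v z : cintegrable leb I0 w -> cintegrable leb I0 v ->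
  0 <= complex.Re z ->
  density_transform (fun t => w t + c * v t) z = density_transform w z + c * density_transform v z.
Proof.
move=> iw iv z0; have izw := density_cintegrable mI0 (@subset_refl _ I0) iw z0.
have izv := density_cintegrable mI0 (@subset_refl _ I0) iv z0.
rewrite /density_transform -(cintegralZl mI0 c izv).
rewrite -(cintegralD mI0 izw (cintegrableZl mI0 c izv)).
by apply: eq_cintegral => t _; rewrite mulrDr mulrCA.
Qed.

Lemma itv_sub_half_line T : `[0%R, T]%classic `<=` I0.
Proof. by move=> t /=; rewrite !in_itv /= andbT => /andP[]. Qed.

Lemma ray_sub_half_line T : 0 <= T -> `]T, +oo[%classic `<=` I0.
Proof. by move=> T0 t /=; rewrite !in_itv /= !andbT => Tt; exact: le_trans (ltW Tt). Qed.

Lemma C0cl_itv_integral_lexp a b : 0 <= a -> a <= b -> C0cl (fun z => itv_integral a b (lexp z)).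
Proof.
move=> a0 ab; have b0 := le_trans a0 ab.
apply: eq_C0cl (C0cl_lin_closed (-1) (C0cl_truncated_resolvent b0) (C0cl_truncated_resolvent a0)).
move=> z _; rewrite mulN1r /truncated_resolvent (itv_integral_split (m := a)) ?a0 //.
  by rewrite addrC addKr.
exact: itv_lexp_cintegrable.
Qed.

(* Where [g] is nearly constant the integral is close to a multiple of that of [lexp z];
   bisection glues these local approximations. *)
Lemma C0cl_continuous_density g a b : continuous g -> 0 <= a -> a <= b ->
  C0cl (fun z => itv_integral a b (fun t => lexp z t * (g t)%:C%C)).
Proof.
move=> cg a0 ab; apply: C0cl_sup_closed => e e0.
have cgC : continuous ((fun t => (g t)%:C%C) : R -> Cn R).
  by move=> t; apply: continuous_comp (cg t) _; exact: continuous_real_complex.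
have int_g z p q : cintegrable leb `[p, q] (fun t => lexp z t * (g t)%:C%C).
  by apply: continuous_itv_cintegrable => t _; exact: (cvgM (@continuous_lexp R z t) (cgC t)).
pose d := e / (b - a + 1); have ba1 : 0 < b - a + 1 by rewrite ltr_wpDl // subr_ge0.
have d0 : 0 < d by rewrite divr_gt0.
pose close a' b' (_ _ : R) := 0 <= a' -> a' <= b' -> exists2 h, C0cl h &
  forall z, Cplus z ->
    cabs (itv_integral a' b' (fun t => lexp z t * (g t)%:C%C) - h z) <= d * (b' - a').
suff /(_ a0 ab)[h h0 hclose] : close a b 0 1.
  exists h => // z z0; rewrite (le_trans (hclose z z0)) // /d mulrAC ler_pdivrMr //.
  by rewrite ler_pM2l // lerDl.
apply: (@rect_ind R close) => // [a' b' c' d' ab' _ left right _ _ a'0 _|x y xab _].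
  have [h1 h1_0 close1] := left a'0 ltac:(lra).
  have [h2 h2_0 close2] := right ltac:(lra) ltac:(lra).
  exists (fun z => h1 z + 1 * h2 z); first exact: C0cl_lin_closed.
  move=> z z0; rewrite (@itv_integral_split R ((a' + b') / 2)) //; last by lra.
  rewrite mul1r opprD addrACA (le_trans (le_cabsD _ _)) //.
  by rewrite (le_trans (lerD (close1 z z0) (close2 z z0))) // -mulrDr ler_pM2l //; lra.
have /cvg_cabsP/(_ d d0)/nbhs_ballP[r /= r0 rg] := cgC x.
exists (r / 2) => [|a' b' c' d' _ xab' _ _ _ _ rab _ a'0 ab']; first by rewrite divr_gt0.
have lexp_C0 := C0cl_itv_integral_lexp a'0 ab'.
have zero_C0 : C0cl (fun=> 0 : R[i]).
  by apply: eq_C0cl (C0cl_lin_closed (-1) lexp_C0 lexp_C0) => z _; rewrite mulN1r subrr.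
exists (fun z => 0 + (g x)%:C%C * itv_integral a' b' (lexp z)); first exact: C0cl_lin_closed.
move=> z z0; have mab : measurable (`[a', b'] : set (measurableTypeR R)) by exact: measurable_itv.
have ilexp := @itv_lexp_cintegrable R a' b' z.
rewrite add0r /itv_integral -(cintegralZl mab _ ilexp).
rewrite -(cintegralB mab (int_g z a' b') (cintegrableZl mab _ ilexp)).
apply: (le_cabs_itv_integral ab').
  exact: cintegrableB (int_g z a' b') (cintegrableZl mab _ ilexp).
move=> t /andP[ta tb]; rewrite mulrC -mulrBl cabsM.
rewrite (le_trans (ler_piMr (cabs_ge0 _) (cabs_lexp_le1 (ltW z0) (le_trans a'0 ta)))) //.
by apply: rg; rewrite /ball /= ltr_norml; apply/andP; split; lra.
Qed.

Lemma integrable_continuous_approx f e : leb.-integrable I0 (EFin \o f) -> 0 < e ->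
  exists T g, [/\ 0 <= T, continuous g, \int[leb]_(t in `[0%R, T]) `|f t - g t| <= e &
    \int[leb]_(t in `]T, +oo[) `|f t| <= e].
Proof.
move=> intf e0; pose U (n : nat) : set (measurableTypeR R) := `]n%:R, +oo[%classic.
have mU n : measurable (U n) by exact: measurable_itv.
have UI n : U n `<=` I0 := ray_sub_half_line (ler0n R n).
have [|||n n_small] := @integral_vanishing_sets _ _ _ leb I0 U
  (fun t => `|f t|%:E) mI0 mU UI (integrable_norm intf) _ _ _ e e0.
- by [].
- by move=> t _; rewrite lee_fin.
- move=> t; rewrite /= in_itv /= andbT => t0; exists (Num.bound t) => n nb.
  rewrite /U /= in_itv /= andbT; apply/negP; rewrite -leNgt ltW //.
  by rewrite (lt_le_trans (archi_boundP t0)) // ler_nat.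
pose J : set (measurableTypeR R) := `[0%R, n%:R : R]%classic.
have mJ : measurable J by exact: measurable_itv.
have [|||g_ [cg _ g_to_f]] := @approximation_continuous_integrable R J f => //.
- by rewrite /J /= lebesgue_measure_itv /=; case: ifP => _; rewrite ?ltry // -EFinB ltry.
- exact: integrableS mI0 mJ (@itv_sub_half_line _) intf.
have /fine_cvgP[_ /cvgrPdist_lt/(_ _ e0)[N _ small]] := g_to_f.
exists n%:R, (g_ N); split=> //.
- have := small N (leqnn N); rewrite /= sub0r normrN => /ltW; apply: le_trans.
  exact: ler_norm.
- rewrite -lee_fin /Rintegral fineK; first exact: ltW.
  have iU := integrableS mI0 (mU n) (UI n) intf.
  exact: (integrable_fin_num (mU n) (integrable_norm iU)).
Qed.

Lemma C0cl_real_density_transform f : leb.-integrable I0 (EFin \o f) ->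
  C0cl (density_transform (fun t => (f t)%:C%C)).
Proof.
move=> intf; apply: C0cl_sup_closed => e e0; have e2 : 0 < e / 2 by rewrite divr_gt0.
have [T [g [T0 cg near_fg far_f]]] := integrable_continuous_approx intf e2.
exists (fun z => itv_integral 0 T (fun t => lexp z t * (g t)%:C%C)).
  exact: C0cl_continuous_density.
move=> z /ltW z0; pose J : set (measurableTypeR R) := `[0%R, T]%classic.
pose U : set (measurableTypeR R) := `]T, +oo[%classic.
have mJ : measurable J by exact: measurable_itv.
have mU : measurable U by exact: measurable_itv.
have JI : J `<=` I0 by exact: itv_sub_half_line.
have UI : U `<=` I0 := ray_sub_half_line T0.
have JU : [disjoint J & U].
  apply/disj_setPS => t []; rewrite /J /U /= !in_itv /= andbT => /andP[_ tT].
  by rewrite ltNge tT.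
have IJU : I0 = J `|` U.
  by rewrite /J /U -itv_bndbnd_setU // bnd_simp.
have if_ : cintegrable leb I0 (fun t => (f t)%:C%C).
  by split; [exact: intf|exact: integrable0].
have ig : cintegrable leb J (fun t => (g t)%:C%C).
  split; last exact: integrable0.
  apply: continuous_compact_integrable; first exact: segment_compact.
  exact: continuous_subspaceT.
have ifJ := cintegrableS mI0 mJ JI if_; have ifU := cintegrableS mI0 mU UI if_.
have izf := density_cintegrable mI0 (@subset_refl _ I0) if_ z0.
rewrite /density_transform IJU cintegral_setU -?IJU // addrAC /itv_integral.
rewrite -(cintegralB mJ (density_cintegrable mJ JI ifJ z0) (density_cintegrable mJ JI ig z0)).
have -> : cintegral leb J (fun t => lexp z t * (f t)%:C%C - lexp z t * (g t)%:C%C) =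
    cintegral leb J (fun t => lexp z t * ((f t)%:C%C - (g t)%:C%C)).
  by apply: eq_cintegral => t _; rewrite mulrBr.
rewrite (le_trans (le_cabsD _ _)) // [e]splitr; apply: lerD.
- have := cabs_density_integral_le mJ JI (cintegrableB mJ ifJ ig) z0; move=> /le_trans; apply.
  by under eq_Rintegral do rewrite -rmorphB cabs_real.
- have := cabs_density_integral_le mU UI ifU z0; move=> /le_trans; apply.
  by under eq_Rintegral do rewrite cabs_real.
Qed.

Lemma C0cl_density_transform w : cintegrable leb I0 w -> C0cl (density_transform w).
Proof.
move=> [iR iI]; have i0 : leb.-integrable I0 (EFin \o (fun=> 0 : R)) by exact: integrable0.
have cR : cintegrable leb I0 (fun t => (complex.Re (w t))%:C%C) by split.
have cI : cintegrable leb I0 (fun t => (complex.Im (w t))%:C%C) by split.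
have C0R := C0cl_real_density_transform iR; have C0I := C0cl_real_density_transform iI.
apply: eq_C0cl (C0cl_lin_closed 'i%C C0R C0I) => z /ltW z0.
rewrite -density_transform_lin //; apply: eq_cintegral => t _; congr (_ * _).
by case: (w t) => x y; apply: complex_ext; rewrite ?ReD ?ImD ?cReM ?cImM /=; ring.
Qed.

End DensityTransform.

Section MeasureDifference.
Context d (T : measurableType d) (R : realType).
Variables (m1 m2 n1 n2 : {finite_measure set T -> \bar R}) (D : set T).
Hypotheses (mD : measurable D) (mn : forall A, measurable A -> A `<=` D ->
  fine (m1 A) - fine (m2 A) = fine (n1 A) - fine (n2 A)).

Lemma Rintegral_measure_diff (f : T -> R) :
  m1.-integrable D (EFin \o f) -> m2.-integrable D (EFin \o f) ->
  n1.-integrable D (EFin \o f) -> n2.-integrable D (EFin \o f) ->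
  \int[m1]_(t in D) f t - \int[m2]_(t in D) f t =
  \int[n1]_(t in D) f t - \int[n2]_(t in D) f t.
Proof.
move=> im1 im2 in1 in2.
have cross A : measurable A -> A `<=` D -> (measure_add m1 n2 A = measure_add n1 m2 A)%E.
  move=> mA AD; rewrite !measure_addE /=.
  rewrite -(fineK (fin_num_measure m1 _ mA)) -(fineK (fin_num_measure n2 _ mA)).
  rewrite -(fineK (fin_num_measure n1 _ mA)) -(fineK (fin_num_measure m2 _ mA)) -!EFinD.
  by congr (_%:E); have := mn mA AD; lra.
have add (m n : {finite_measure set T -> \bar R}) : m.-integrable D (EFin \o f) ->
    n.-integrable D (EFin \o f) -> fine (\int[measure_add m n]_(t in D) (f t)%:E)%E =
    \int[m]_(t in D) f t + \int[n]_(t in D) f t.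
  move=> im i_n; rewrite integral_measure_add // fineD //; exact: integrable_fin_num.
have := add _ _ in1 im2; have := add _ _ im1 in2.
by rewrite (eq_measure_integral _ cross) => ->; lra.
Qed.

Lemma cintegral_measure_diff (w : T -> R[i]) :
  cintegrable m1 D w -> cintegrable m2 D w -> cintegrable n1 D w -> cintegrable n2 D w ->
  cintegral m1 D w - cintegral m2 D w = cintegral n1 D w - cintegral n2 D w.
Proof.
move=> [r1 i1] [r2 i2] [s1 j1] [s2 j2].
by apply: complex_ext; rewrite !(ReD, ReN, ImD, ImN) /=; exact: Rintegral_measure_diff.
Qed.

End MeasureDifference.

Section BorelMeasure.
Variables (R : realType) (nu : {finite_measure set (measurableTypeR R) -> \bar R}).

Definition of_borel (A : set R) : \bar R := nu A.

Let of_borel0 : of_borel set0 = 0%E. Proof. exact: measure0. Qed.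

Let of_borel_ge0 A : (0 <= of_borel A)%E. Proof. exact: measure_ge0. Qed.

Let of_borel_sigma_additive : semi_sigma_additive of_borel.
Proof. exact: (@measure_semi_sigma_additive _ _ _ nu). Qed.

HB.instance Definition _ :=
  isMeasure.Build _ _ _ of_borel of_borel0 of_borel_ge0 of_borel_sigma_additive.

Let of_borel_fin : fin_num_fun of_borel. Proof. exact: (fin_num_measure nu). Qed.

HB.instance Definition _ := @Measure_isFinite.Build _ _ _ of_borel of_borel_fin.

Lemma integral_of_borel (D : set R) (f : R -> R) : measurable D -> measurable_fun setT f ->
  nu.-integrable D (EFin \o f) ->
  \int[of_borel]_(x in D) f x = \int[nu]_(x in D) f x.
Proof.
move=> mD mf If; have mv := @measurable_borel_val R setT; congr fine.
have := @integral_pushforward _ _ _ _ R (@borel_val R) mv nu D (EFin \o f) _ If mD.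
by apply; exact/measurable_EFinP.
Qed.

Lemma cintegral_of_borel (D : set R) (w : R -> R[i]) : measurable D -> cmeasurable setT w ->
  cintegrable nu D w -> cintegral of_borel D w = cintegral nu D w.
Proof.
move=> mD [mR mI] [iR iI].
by congr (_ +i* _)%C; exact: integral_of_borel.
Qed.

End BorelMeasure.

Section MeasureWithDensity.
Variable R : realType.
Implicit Types (f w : R -> R) (z : R[i]) (A D : set R).
Local Notation I0 := (`[0%R, +oo[%classic : set R).
Local Notation leb := (@lebesgue_measure R).
Local Notation fmeas := {finite_measure set R -> \bar R}.

Lemma cmeasurable_lexp z : cmeasurable setT (lexp z).
Proof.
split; apply: continuous_measurable_fun => s.
- exact: continuous_Re (@continuous_lexp R z s).
- exact: continuous_Im (@continuous_lexp R z s).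
Qed.

Lemma lexp_cintegrable (nu : {finite_measure set (measurableTypeR R) -> \bar R}) z :
  0 <= complex.Re z -> cintegrable nu I0 (lexp z).
Proof.
move=> z0; have mI : measurable (I0 : set (measurableTypeR R)) by exact: measurable_itv.
have i1 := finite_measure_cintegrable1 nu mI.
have -> : lexp z = fun t => lexp z (borel_val t) * 1 by apply/funext => t; rewrite mulr1.
exact: (laplace_cintegrable mI (@measurable_borel_val R I0) (@half_line_ge0 R) i1 z0).
Qed.

Lemma nonneg_density w : (forall t, 0 <= w t) -> leb.-integrable setT (EFin \o w) ->
  exists2 nu : fmeas, forall A, measurable A -> nu A = (\int[leb]_(t in A) (w t)%:E)%E &
    forall z, 0 <= complex.Re z -> lapR nu z = density_transform (fun t => (w t)%:C%C) z.
Proof.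
move=> w0 iw; have mw : measurable_fun [set: measurableTypeR R] w.
  by have /measurable_EFinP := measurable_int _ iw.
pose nu := density_measure mw w0 iw; exists (of_borel nu) => // z z0.
have mI : measurable (I0 : set (measurableTypeR R)) by exact: measurable_itv.
have ilexp := lexp_cintegrable nu z0.
have mI0 : measurable I0 by exact: measurable_itv.
rewrite lapRE // /laplace_integral.
have -> : cintegral (of_borel nu) I0 (fun t => lexp z (idfun t) * 1) =
    cintegral (of_borel nu) I0 (lexp z).
  by apply: eq_cintegral => t _; rewrite mulr1.
rewrite (cintegral_of_borel mI0 (cmeasurable_lexp z) ilexp).
rewrite (cintegral_density_measure mI ilexp).
by apply: eq_cintegral => t _; rewrite mulrC.
Qed.

Lemma signed_density f : leb.-integrable setT (EFin \o f) ->
  exists nu nu' : fmeas,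
  [/\ forall A, measurable A -> fine (nu A) - fine (nu' A) = \int[leb]_(t in A) f t,
      (forall t, t < 0 -> f t = 0) -> nu `]-oo, 0%R[ = 0%E /\ nu' `]-oo, 0%R[ = 0%E &
      forall z, 0 <= complex.Re z ->
        lapR nu z - lapR nu' z = density_transform (fun t => (f t)%:C%C) z].
Proof.
move=> intf; have fE t : f t = f^\+ t - f^\- t.
  by rewrite /funrpos /funrneg; case: (leP (f t) 0); case: (leP (- f t) 0); lra.
have ip : leb.-integrable setT (EFin \o f^\+) by exact: integrable_funrpos.
have iN : leb.-integrable setT (EFin \o f^\-).
  by rewrite -funrposN; apply: integrable_funrpos => //; exact: (integrableN intf).
have [nu nuE nuL] := nonneg_density (@funrpos_ge0 _ _ f) ip.
have [nu' nuE' nuL'] := nonneg_density (@funrneg_ge0 _ _ f) iN.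
exists nu, nu'; split.
- move=> A mA; rewrite nuE // nuE' // -RintegralB //.
  + by apply: eq_Rintegral => t _; rewrite -fE.
  + exact: integrableS ip.
  + exact: integrableS iN.
- move=> f0; rewrite nuE // nuE' //.
  split; apply: integral0_eq => t; rewrite /= in_itv /= => /f0 ft.
  + by rewrite /funrpos ft maxxx.
  + by rewrite /funrneg ft oppr0 maxxx.
- move=> z z0; rewrite nuL // nuL' // -mulN1r.
  have toC h : leb.-integrable setT (EFin \o h) -> cintegrable leb I0 (fun t => (h t)%:C%C).
    by move=> ih; split; [exact: integrableS ih|exact: integrable0].
  rewrite -(density_transform_lin _ (toC _ ip) (toC _ iN) z0).
  by apply: eq_cintegral => t _; rewrite mulN1r -rmorphB -fE.
Qed.

Lemma half_line_density D f : measurable D -> D `<=` I0 -> leb.-integrable D (EFin \o f) ->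
  exists nu nu' : fmeas,
  [/\ forall A, measurable A ->
        fine (nu A) - fine (nu' A) = \int[leb]_(t in A) (f \_ D) t,
      nu `]-oo, 0%R[ = 0%E /\ nu' `]-oo, 0%R[ = 0%E &
      forall z, 0 <= complex.Re z ->
        lapR nu z - lapR nu' z = cintegral leb D (fun t => lexp z t * (f t)%:C%C)].
Proof.
move=> mD D0 iD; have mD' : measurable (D : set (measurableTypeR R)) by [].
have ifD : leb.-integrable setT (EFin \o (f \_ D)).
  have -> : EFin \o (f \_ D) = (EFin \o f) \_ D by rewrite restrict_EFin.
  by rewrite -integrable_mkcond.
have [nu [nu' [nuE nu_neg nuL]]] := signed_density ifD; exists nu, nu'; split=> //.
- apply: nu_neg => t t0; rewrite patchE memNset // => /D0; rewrite /= in_itv /= andbT.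
  by rewrite leNgt t0.
- move=> z z0; rewrite nuL // -(setIidr D0) cintegral_mkcondr setIidr //.
  by apply: eq_cintegral => t _; rewrite patchE; case: ifP; rewrite ?mulr0.
Qed.

End MeasureWithDensity.

Section AbsolutelyContinuousMeasures.
Variable R : realType.
Implicit Types (z : R[i]) (A D : set R).
Local Notation I0 := (`[0%R, +oo[%classic : set R).
Local Notation leb := (@lebesgue_measure R).
Local Notation fmeas := {finite_measure set R -> \bar R}.

Section DifferenceCharge.
Variables m1 m2 : fmeas.

Let cdiff := cadd (charge_of_finite_measure m1) (cscale (-1) (charge_of_finite_measure m2)).

Definition diff_charge (A : set (measurableTypeR R)) : \bar R := cdiff A.

Let diff_charge0 : diff_charge set0 = 0%E. Proof. exact: charge0. Qed.

Let diff_charge_fin A : measurable A -> diff_charge A \is a fin_num.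
Proof. exact: (fin_num_measure cdiff). Qed.

Let diff_charge_sigma_additive : semi_sigma_additive diff_charge.
Proof. exact: (@charge_semi_sigma_additive _ _ _ cdiff). Qed.

HB.instance Definition _ := isCharge.Build _ _ _ diff_charge
  diff_charge0 diff_charge_fin diff_charge_sigma_additive.

Lemma diff_chargeE A : measurable A -> diff_charge A = (fine (m1 A) - fine (m2 A))%:E.
Proof.
by move=> mA; rewrite /diff_charge /cdiff /cadd /= cscaleN1 EFinB !fineK ?fin_num_measure.
Qed.

Lemma ac_density :
  (forall A, measurable A -> leb A = 0%E -> fine (m1 A) - fine (m2 A) = 0) ->
  exists2 f : R -> R, leb.-integrable I0 (EFin \o f) &
    forall z, 0 <= complex.Re z ->
      lapR m1 z - lapR m2 z = density_transform (fun t => (f t)%:C%C) z.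
Proof.
move=> ac; have mI0 : measurable I0 by exact: measurable_itv.
have dom : diff_charge `<< leb.
  by apply/null_content_dominatesP => A mA A0; rewrite diff_chargeE // ac.
pose f t := fine (Radon_Nikodym diff_charge leb t).
have fE : EFin \o f = Radon_Nikodym diff_charge leb.
  by apply/funext => t; rewrite /= fineK //; exact: Radon_Nikodym_fin_num.
have intf (A : set R) : measurable A -> leb.-integrable A (EFin \o f).
  move=> mA; apply: integrableS (@subsetT _ _) _ => //.
  by rewrite fE; exact: Radon_Nikodym_integrable.
exists f; first exact: intf.
move=> z z0; have [nu [nu' [nuE _ nuL]]] := half_line_density mI0 (@subset_refl _ I0) (intf _ mI0).
have mid := @measurable_id _ _ I0.
have ilexp (m : fmeas) := laplace_cintegrable mI0 mid (@half_line_ge0 R)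
  (finite_measure_cintegrable1 m mI0) z0.
rewrite -[RHS]nuL // !lapRE //.
apply: (cintegral_measure_diff mI0 _ (ilexp m1) (ilexp m2) (ilexp nu) (ilexp nu')) => A mA AI.
rewrite nuE //; apply: EFin_inj; rewrite -diff_chargeE // (Radon_Nikodym_integral dom) // -fE.
rewrite /Rintegral (_ : (\int[leb]_(t in A) ((f \_ I0) t)%:E = \int[leb]_(t in A) (f t)%:E)%E).
  by rewrite fineK //; exact: (integrable_fin_num _ (intf A mA)).
by apply: eq_integral => t; rewrite inE => /AI tI; rewrite patchE mem_set.
Qed.

End DifferenceCharge.

Lemma LL1_density (mu : cmeas R) : Mac mu ->
  exists2 w, cintegrable leb I0 w &
    forall z, 0 <= complex.Re z -> lap mu z = density_transform w z.
Proof.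
move=> ac.
have [|f ifR fE] := @ac_density (cm1 mu) (cm2 mu).
  by move=> A mA A0; have /(congr1 (@complex.Re R)) := ac A mA A0.
have [|g igR gE] := @ac_density (cm3 mu) (cm4 mu).
  by move=> A mA A0; have /(congr1 (@complex.Im R)) := ac A mA A0.
have i0 : leb.-integrable I0 (EFin \o (fun=> 0 : R)) by exact: integrable0.
have if_ : cintegrable leb I0 (fun t => (f t)%:C%C) by split.
have ig : cintegrable leb I0 (fun t => (g t)%:C%C) by split.
exists (fun t => (f t)%:C%C + 'i%C * (g t)%:C%C).
  have mI0 : measurable (I0 : set (measurableTypeR R)) by exact: measurable_itv.
  exact: (cintegrableD mI0 if_ (cintegrableZl mI0 'i%C ig)).
by move=> z z0; rewrite density_transform_lin // /lap fE // gE.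
Qed.

Lemma density_LL1 D w : measurable D -> D `<=` I0 -> cintegrable leb D w ->
  exists2 h, LL1 R h & forall z, Cplus z -> h z = cintegral leb D (fun t => lexp z t * w t).
Proof.
move=> mD D0 iw; have [iR iI] := iw.
have null nu nu' (f : R -> R) : (forall A, measurable A ->
    fine (nu A) - fine (nu' A) = \int[leb]_(t in A) (f \_ D) t) -> leb.-integrable D (EFin \o f) ->
    forall A, measurable A -> leb A = 0%E -> fine (nu A) - fine (nu' A) = 0.
  move=> nuE intf A mA A0; have mA' : measurable (A : set (measurableTypeR R)) by [].
  have mf : measurable_fun D f by have /measurable_EFinP := measurable_int _ intf.
  rewrite nuE // /Rintegral null_set_integral //.
  apply/measurable_EFinP/measurable_funTS.
  by apply/(measurable_restrictT _ mD).
have [p [n [reE [p_neg n_neg] reL]]] := half_line_density mD D0 iR.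
have [p' [n' [imE [p'_neg n'_neg] imL]]] := half_line_density mD D0 iI.
exists (lap (CMeas p n p' n')).
  exists (CMeas p n p' n'); split=> // A mA A0.
  by rewrite /cmval /= (null _ _ _ reE) ?(null _ _ _ imE).
move=> z /ltW z0; rewrite /lap /= reL // imL //.
have mD' : measurable (D : set (measurableTypeR R)) by [].
have i0 : leb.-integrable D (EFin \o (fun=> 0 : R)) by exact: integrable0.
have izR : cintegrable leb D (fun t => lexp z t * (complex.Re (w t))%:C%C).
  by apply: density_cintegrable => //; split.
have izI : cintegrable leb D (fun t => lexp z t * (complex.Im (w t))%:C%C).
  by apply: density_cintegrable => //; split.
rewrite -(cintegralZl mD' 'i%C izI) -(cintegralD mD' izR (cintegrableZl mD' 'i%C izI)).
apply: eq_cintegral => t _; rewrite mulrCA -mulrDr; congr (_ * _).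
by case: (w t) => x y; apply: complex_ext; rewrite ?ReD ?ImD ?cReM ?cImM /=; ring.
Qed.

Lemma LL1_C0cl g : LL1 R g -> C0cl g.
Proof.
move=> [mu [_ /LL1_density[w iw wE] ->]].
by apply: eq_C0cl (C0cl_density_transform iw) => z /ltW z0; rewrite wE.
Qed.

Lemma LL1_lin : lin_stable (LL1 R).
Proof.
move=> c _ _ [mu [_ /LL1_density[w iw wE] ->]] [mu' [_ /LL1_density[v iv vE] ->]].
have mI0 : measurable (I0 : set (measurableTypeR R)) by exact: measurable_itv.
have [h Lh hE] := density_LL1 (measurable_itv _) (@subset_refl _ I0)
  (cintegrableD mI0 iw (cintegrableZl mI0 c iv)).
exists h => // z z0; rewrite hE // wE ?vE ?(ltW z0) //.
exact: density_transform_lin iw iv (ltW z0).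
Qed.

Lemma LL1_resolvents : approx_resolvents (LL1 R).
Proof.
move=> l e l0 e0; have [T T0 Tclose] := truncated_resolvent_close l0 e0.
have [h Lh hE] := density_LL1 (measurable_itv _) (@itv_sub_half_line R T)
  (itv_lexp_cintegrable 0 T l%:C%C).
exists h => // z z0; rewrite hE //.
have -> : cintegral leb `[0, T] (fun t => lexp z t * lexp l%:C%C t) =
    truncated_resolvent T (z + l%:C%C) by apply: eq_cintegral => t _; rewrite lexpD.
exact: Tclose.
Qed.

End AbsolutelyContinuousMeasures.

Theorem mainTheorem7 (R : realType) :
  (forall Y : set (R[i] -> R[i]),
     Y = LM R \/ Y = LL1 R \/ Y = LMd R \/ Y = LMs R \/ Y = R0 R \/ Y = J0 R ->
     closB Y = closInf Y) /\
  (forall Y : set (R[i] -> R[i]),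
     Y = LL1 R \/ Y = R0 R \/ Y = J0 R ->
     closB Y = [set f | Bspace f /\ C0cl f]).
Proof.
have eR0 := C0cl_closB_eq_closInf (@R0_holo R) (@R0_C0cl R) (@R0_lin R) (@R0_translate R).
have eJ0 := C0cl_closB_eq_closInf (@J0_holo R) (@J0_C0cl R) (@J0_lin R) (@J0_translate R).
have eL1 := LN_closB (@weight_stable_Mac R).
split=> Y.
- move=> [->|[->|[->|[->|[->|->]]]]].
  + exact: LN_closB (@weight_stable_Mall R).
  + exact: eL1.
  + exact: LN_closB (@weight_stable_Mdisc R).
  + exact: LN_closB (@weight_stable_Msing R).
  + exact: eR0.
  + exact: eJ0.
- move=> [->|[->|->]].
  + exact: closB_C0cl eL1 (@LL1_C0cl R) (@LL1_lin R) (@LL1_resolvents R).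
  + exact: closB_C0cl eR0 (@R0_C0cl R) (@R0_lin R) (@R0_resolvents R).
  + exact: closB_C0cl eJ0 (@J0_C0cl R) (@J0_lin R) (@J0_resolvents R).
Qed.
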